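(* Let $f$ be a quasi-homogeneous polynomial on $\mathbb{K}^2$ of degree $d$ with respect to the weights $(\omega_1,\omega_2)$, whose germ at $0$ is of finite codimension. Let $h$ be a quasi-homogeneous polynomial of degree $d-\omega_1-\omega_2$ if $d-\omega_1-\omega_2>0$, and $h=0$ otherwise. Put $\Pi_0=f\,\frac{\partial}{\partial x}\wedge\frac{\partial}{\partial y}$ and $\Pi=f(1+h)\,\frac{\partial}{\partial x}\wedge\frac{\partial}{\partial y}$. Let $\{e_1,\dots,e_r\}$ be a basis of the vector space of quasi-homogeneous polynomials of degree $d-\omega_1-\omega_2$ (with $0$ included). Then $\{[(1+h)H_f]_{\Pi},[(1+h)e_1W]_{\Pi},\dots,[(1+h)e_rW]_{\Pi}\}$ is a basis of $H^1(\Pi)$. In particular, $H^1(\Pi)\simeq H^1(\Pi_0)$.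
   Context: $\mathbb{K}=\mathbb{R}$ or $\mathbb{C}$. $\mathcal{F}(\mathbb{K}^2)$, $\mathcal{X}(\mathbb{K}^2)$, $\mathcal{V}(\mathbb{K}^2)$ are the spaces of germs at $(0,0)$ of functions, vector fields and 2-vectors (bivector fields) on $\mathbb{K}^2$, in one fixed category: holomorphic if $\mathbb{K}=\mathbb{C}$; real analytic or $C^\infty$ if $\mathbb{K}=\mathbb{R}$. Fix positive integers $\omega_1,\omega_2$ and put $W=\omega_1x\frac{\partial}{\partial x}+\omega_2y\frac{\partial}{\partial y}$. A polynomial $g$ is quasi-homogeneous of degree $k\in\mathbb{Z}$ if $W.g=kg$ ($0$ is allowed for $h$ and is included when forming the vector space of such polynomials, which is $\{0\}$, so $r=0$, if $k$ is not the quasi-degree of any monomial). $X.g$ is the derivative of $g$ along $X$. For $g\in\mathcal{F}(\mathbb{K}^2)$, $H_g=\frac{\partial g}{\partial y}\frac{\partial}{\partial x}-\frac{\partial g}{\partial x}\frac{\partial}{\partial y}$. For $X=A\frac{\partial}{\partial x}+B\frac{\partial}{\partial y}$, $\operatorname{div}X=\frac{\partial A}{\partial x}+\frac{\partial B}{\partial y}$. The germ $f$ is of finite codimension if $\mathcal{F}(\mathbb{K}^2)/I_f$ is finite-dimensional over $\mathbb{K}$, where $I_f$ is the ideal of $\mathcal{F}(\mathbb{K}^2)$ generated by $\frac{\partial f}{\partial x},\frac{\partial f}{\partial y}$. For a germ $\Lambda=F\frac{\partial}{\partial x}\wedge\frac{\partial}{\partial y}$ of Poisson structure, the (germified) Poisson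 complex is $0\to\mathcal{F}(\mathbb{K}^2)\xrightarrow{\delta_1}\mathcal{X}(\mathbb{K}^2)\xrightarrow{\delta_2}\mathcal{V}(\mathbb{K}^2)\to0$ with $\delta_1(g)=[g,\Lambda]=F\,H_g$ and $\delta_2(X)=[X,\Lambda]=(X.F-(\operatorname{div}X)F)\frac{\partial}{\partial x}\wedge\frac{\partial}{\partial y}$. $Z^1(\Lambda)=\ker\delta_2$, $B^1(\Lambda)=\operatorname{Im}\delta_1$, $H^1(\Lambda)=Z^1(\Lambda)/B^1(\Lambda)$. $[X]_{\Pi}$ is the class of $X\in Z^1(\Pi)$ modulo $B^1(\Pi)$. *)

(* Defs.v *)
From HB Require Import structures.
From mathcomp Require Import all_boot all_order all_algebra.
From mathcomp Require Import all_classical all_reals topology normedtype derive.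
From mathcomp Require Import complex ring.
(* The notations of mpoly clash with those of mathcomp-analysis. *)
From mathcomp.multinomials Require Import -(notations) mpoly.

Set Implicit Arguments.
Unset Strict Implicit.
Unset Printing Implicit Defensive.

Import Order.TTheory GRing.Theory Num.Theory numFieldNormedType.Exports.
Local Open Scope classical_set_scope.
Local Open Scope quotient_scope.
Local Open Scope ring_scope.

Section LinearAlgebra.
Context {K : pzRingType} {V : lmodType K}.

(* S is meant to be a linear subspace; if it contains 0, the uniqueness of the
   coordinates includes the linear independence of v. *)
Definition is_basis_of (S : set V) (I : finType) (v : I -> V) :=
  (forall i, S (v i)) /\
  (forall u, S u -> exists! c : {ffun I -> K}, u = \sum_i c i *: v i).

Definition finite_dim_quotient (S T : set V) :=
  exists n (s : 'I_n -> V), (forall i, S (s i)) /\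
  forall u, S u -> exists c : 'I_n -> K, T (u - \sum_i c i *: s i).

End LinearAlgebra.

Section QuotientLmodule.
Context {K : pzRingType} {V : lmodType K} (B : zmodClosed V).
Hypothesis B_scale : GRing.scaler_closed B.

Definition lmod_quot of GRing.scaler_closed B := {ideal_quot B}.
Local Notation Q := (lmod_quot B_scale).

HB.instance Definition _ := GRing.Zmodule.on Q.
HB.instance Definition _ :=
  ZmodQuotient.copy Q {ideal_quot B}.

Fact pi_quotD (u v : V) : \pi_Q (u + v) = \pi_Q u + \pi_Q v.
Proof. exact: raddfD. Qed.

Definition quot_scale (a : K) : Q -> Q := lift_op1 Q (fun v => a *: v).

Fact pi_quot_scale a (v : V) : \pi_Q (a *: v) = quot_scale a (\pi_Q v).
Proof.
unlock quot_scale; apply/eqP; rewrite piE Quotient.equivE -scalerBr.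
by apply: B_scale; rewrite Quotient.idealrBE reprK.
Qed.

Fact quot_scaleA a b x : quot_scale a (quot_scale b x) = quot_scale (a * b) x.
Proof. by rewrite -[x]reprK -!pi_quot_scale scalerA. Qed.

Fact quot_scale1 : left_id 1 quot_scale.
Proof. by move=> x; rewrite -[x]reprK -pi_quot_scale scale1r. Qed.

Fact quot_scaleDr : right_distributive quot_scale +%R.
Proof.
move=> a x y; rewrite -[x]reprK -[y]reprK -!pi_quot_scale -!pi_quotD.
by rewrite -pi_quot_scale scalerDr pi_quotD.
Qed.

Fact quot_scaleDl x : {morph quot_scale^~ x : a b / a + b}.
Proof.
by move=> a b; rewrite -[x]reprK -!pi_quot_scale -pi_quotD scalerDl.
Qed.

HB.instance Definition _ := GRing.Zmodule_isLmodule.Build K Q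
  quot_scaleA quot_scale1 quot_scaleDr quot_scaleDl.

End QuotientLmodule.

Section NearZero.
Context {K : numFieldType}.

Definition near_zero : {pred K * K -> K} :=
  fun f => `[< \forall z \near (0 : K * K), f z = 0 >].

Fact near_zero_idealr : idealr_closed near_zero.
Proof.
split.
- by apply/asboolP; near=> z.
- by apply/negP => /asboolP /nbhs_singleton /eqP; rewrite (negPf (oner_neq0 _)).
- move=> a f g /asboolP f0 /asboolP g0; apply/asboolP.
  near=> z.
  have -> : (a * f + g) z = a z * f z + g z by [].
  by rewrite (near f0 z _) ?(near g0 z _) ?mulr0 ?addr0.
Unshelve. all: by end_near. Qed.

HB.instance Definition _ := isIdealr.Build _ near_zero near_zero_idealr.

Fact near_zero_scale : GRing.scaler_closed near_zero.
Proof.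
move=> a f /asboolP f0; apply/asboolP; near=> z.
have -> : (a *: f) z = a * f z by [].
by rewrite (near f0 z _) ?mulr0.
Unshelve. all: by end_near. Qed.

HB.instance Definition _ := GRing.isScaleClosed.Build K _ near_zero
  near_zero_scale.

End NearZero.

Section Germs.
Context {K : numFieldType}.
Implicit Types (f : K * K -> K).

(* germs at the origin of arbitrary functions on K^2 *)
Definition germ := lmod_quot (@near_zero_scale K).

HB.instance Definition _ := GRing.Lmodule.on germ.
HB.instance Definition _ := GRing.ComNzRing.copy germ {ideal_quot (@near_zero K)}.
HB.instance Definition _ :=
  NzRingQuotient.copy germ {ideal_quot (@near_zero K)}.

Definition germ_of f : germ := \pi_germ f.

Lemma germ_ofP f g : germ_of f = germ_of g <-> \forall z \near (0 : K * K), f z = g z.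
Proof.
split.
  move=> /eqP; rewrite /germ_of piE => /asboolP fg.
  near=> z; apply/eqP; rewrite -subr_eq0; apply/eqP.
  by near: z.
move=> fg; apply/eqP; rewrite /germ_of piE; apply/asboolP.
near=> z; have -> : (f - g) z = f z - g z by [].
by rewrite (near fg z _) ?subrr.
Unshelve. all: by end_near. Qed.

Lemma germ_ofD f g : germ_of (f + g) = germ_of f + germ_of g.
Proof. exact: pi_quotD. Qed.

Lemma germ_ofZ a f : germ_of (a *: f) = a *: germ_of f.
Proof. exact: (pi_quot_scale (@near_zero_scale K)). Qed.

Lemma germ_ofM f g : germ_of (f * g) = germ_of f * germ_of g.
Proof. exact: rmorphM. Qed.

Fact germ_scaleAl (a : K) (u v : germ) : a *: (u * v) = a *: u * v.
Proof.
rewrite -[u]reprK -[v]reprK -!/(germ_of _) -germ_ofM -!germ_ofZ -germ_ofM.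
by congr germ_of; apply/funext => z; exact: mulrA.
Qed.

HB.instance Definition _ := GRing.Lmodule_isLalgebra.Build K germ germ_scaleAl.
HB.instance Definition _ := GRing.Lalgebra_isComAlgebra.Build K germ.

Definition dx f : K * K -> K := fun z => derive1 (fun t : K => f (t, z.2)) z.1.
Definition dy f : K * K -> K := fun z => derive1 (fun t : K => f (z.1, t)) z.2.

Definition germ_dx (u : germ) : germ := germ_of (dx (repr u)).
Definition germ_dy (u : germ) : germ := germ_of (dy (repr u)).

Lemma near_section f g (U : set (K * K)) : open U -> {in U, f =1 g} ->
  forall z, U z ->
    (\forall t \near z.1, f (t, z.2) = g (t, z.2)) /\
    (\forall t \near z.2, f (z.1, t) = g (z.1, t)).
Proof.
move=> oU fg [x y] Uz.
have /= [[A B]/= [nA nB] AB] : nbhs (x, y) U by exact: open_nbhs_nbhs.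
split.
- apply: filterS nA => t At; apply: fg; rewrite inE; apply: AB; split => //=.
  exact: nbhs_singleton nB.
- apply: filterS nB => t Bt; apply: fg; rewrite inE; apply: AB; split => //=.
  exact: nbhs_singleton nA.
Qed.

Lemma eq_dx f g (U : set (K * K)) : open U -> {in U, f =1 g} ->
  {in U, dx f =1 dx g}.
Proof.
move=> oU fg z /[!inE] Uz; rewrite /dx !derive1E.
have [nf ng] := near_section oU fg Uz; exact: near_eq_derive.
Qed.

Lemma eq_dy f g (U : set (K * K)) : open U -> {in U, f =1 g} ->
  {in U, dy f =1 dy g}.
Proof.
move=> oU fg z /[!inE] Uz; rewrite /dy !derive1E.
have [nf ng] := near_section oU fg Uz; exact: near_eq_derive.
Qed.

Lemma near_openP (P : set (K * K)) : (\forall z \near (0 : K * K), P z) <->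
  exists2 U : set (K * K), open U /\ U 0 & U `<=` P.
Proof. by rewrite /prop_near1 nbhsE; split=> -[U oU UP]; exists U. Qed.

Lemma germ_dxE f : germ_dx (germ_of f) = germ_of (dx f).
Proof.
apply/germ_ofP/near_openP.
have /germ_ofP/near_openP[U [oU U0] fU] : germ_of (repr (germ_of f)) = germ_of f.
  exact: reprK.
exists U => // z Uz; apply: (eq_dx oU) => [w|]; rewrite inE//.
exact: fU.
Qed.

Lemma germ_dyE f : germ_dy (germ_of f) = germ_of (dy f).
Proof.
apply/germ_ofP/near_openP.
have /germ_ofP/near_openP[U [oU U0] fU] : germ_of (repr (germ_of f)) = germ_of f.
  exact: reprK.
exists U => // z Uz; apply: (eq_dy oU) => [w|]; rewrite inE//.
exact: fU.
Qed.

(* w lists the successive partial derivatives: true for d/dx, false for d/dy *)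
Definition iter_partial (w : seq bool) f : K * K -> K :=
  foldr (fun b g => if b then dx g else dy g) f w.

(* The neighbourhood does not depend on w.  For K = C the derivatives are the
   complex ones. *)
Definition smooth f := \forall z \near (0 : K * K), forall w,
  let g := iter_partial w f in
  [/\ {for z, continuous g},
      derivable (fun t : K => g (t, z.2)) z.1 1 &
      derivable (fun t : K => g (z.1, t)) z.2 1].

(* f is near 0 the sum of an absolutely convergent power series; absolute
   convergence is expressed by the boundedness of the sums of moduli *)
Definition power_series f :=
  exists a : nat -> nat -> K, \forall z \near (0 : K * K),
  (exists M : K, forall n,
     \sum_(i < n) \sum_(j < n) `|a i j * z.1 ^+ i * z.2 ^+ j| <= M) /\
  (fun n => \sum_(i < n) \sum_(j < n) a i j * z.1 ^+ i * z.2 ^+ j)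
     @ \oo --> f z.

Fact derive1_linear a (u v : K -> K) t : derivable u t 1 -> derivable v t 1 ->
  derive1 (a *: u + v) t = a * derive1 u t + derive1 v t.
Proof.
move=> du dv; rewrite !derive1E (deriveD (derivableZ du) dv).
by rewrite (deriveZ a du).
Qed.

Lemma iter_partialD a f g (U : set (K * K)) : open U ->
  (forall z, U z -> forall w,
    [/\ derivable (fun t : K => iter_partial w f (t, z.2)) z.1 1,
        derivable (fun t : K => iter_partial w f (z.1, t)) z.2 1,
        derivable (fun t : K => iter_partial w g (t, z.2)) z.1 1 &
        derivable (fun t : K => iter_partial w g (z.1, t)) z.2 1]) ->
  forall w, {in U, iter_partial w (a *: f + g) =1
                   a *: iter_partial w f + iter_partial w g}.
Proof.
move=> oU dfg; elim=> [//|b w IH] z Uz /=.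
have /dfg /(_ w)[fx fy gx gy] : U z by rewrite inE in Uz.
case: b.
  by rewrite (eq_dx oU IH Uz); exact: derive1_linear.
by rewrite (eq_dy oU IH Uz); exact: derive1_linear.
Qed.

Lemma smooth_openP f : smooth f <-> exists2 U : set (K * K), open U /\ U 0 &
  forall z, U z -> forall w, let g := iter_partial w f in
  [/\ {for z, continuous g},
      derivable (fun t : K => g (t, z.2)) z.1 1 &
      derivable (fun t : K => g (z.1, t)) z.2 1].
Proof. exact: near_openP. Qed.

Lemma smoothD a f g : smooth f -> smooth g -> smooth (a *: f + g).
Proof.
move=> /smooth_openP[U [oU U0] Uf] /smooth_openP[V [oV V0] Vg].
have oUV : open (U `&` V) by exact: openI.
apply/smooth_openP; exists (U `&` V) => // z UVz w /=.
have E : {in U `&` V, iter_partial w (a *: f + g) =1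
                      a *: iter_partial w f + iter_partial w g}.
  apply: iter_partialD => // y [Uy Vy] v.
  by have [_ ? ?] := Uf _ Uy v; have [_ ? ?] := Vg _ Vy v.
have [Ex Ey] := near_section oUV E UVz.
have Ez : \forall y \near z, iter_partial w (a *: f + g) y =
    (a *: iter_partial w f + iter_partial w g) y.
  apply: filterS (open_nbhs_nbhs (conj oUV UVz)) => y UVy.
  by apply: E; rewrite inE.
case: UVz => Uz Vz.
have [cf fx fy] := Uf _ Uz w; have [cg gx gy] := Vg _ Vz w.
split.
- rewrite /prop_for /continuous_at (nbhs_singleton Ez).
  have fgz : (a *: iter_partial w f + iter_partial w g) @ z -->
      (a *: iter_partial w f + iter_partial w g) z.
    by apply: cvgD; [exact: cvgZl_tmp|exact: cg].
  apply: cvg_trans fgz; apply: near_eq_cvg.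
  by apply: filterS Ez => y ->.
- apply: (near_eq_derivable (f := a *: (fun t : K => iter_partial w f (t, z.2)) +
    (fun t : K => iter_partial w g (t, z.2)))); last first.
    exact: (derivableD (derivableZ fx) gx).
  by apply: filterS Ex => t /esym.
- apply: (near_eq_derivable (f := a *: (fun t : K => iter_partial w f (z.1, t)) +
    (fun t : K => iter_partial w g (z.1, t)))); last first.
    exact: (derivableD (derivableZ fy) gy).
  by apply: filterS Ey => t /esym.
Qed.

Lemma power_seriesD a f g :
  power_series f -> power_series g -> power_series (a *: f + g).
Proof.
move=> [b fb] [c gc]; exists (fun i j => a * b i j + c i j).
apply: filterS2 fb gc => z [[M fM] fl] [[N gN] gl].
split.
  exists (`|a| * M + N) => n.
  apply: le_trans (lerD (ler_wpM2l (normr_ge0 a) (fM n)) (gN n)).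
  rewrite mulr_sumr -big_split/= ler_sum// => i _.
  rewrite mulr_sumr -big_split/= ler_sum// => j _.
  by rewrite 2!mulrDl (le_trans (ler_normD _ _))// -!mulrA normrM.
have -> : (a *: f + g) z = a *: f z + g z by [].
rewrite (_ : (fun n => _) =
    (fun n => a *: (\sum_(i < n) \sum_(j < n) b i j * z.1 ^+ i * z.2 ^+ j) +
      \sum_(i < n) \sum_(j < n) c i j * z.1 ^+ i * z.2 ^+ j)); last first.
  apply/funext => n; rewrite /GRing.scale/= mulr_sumr -big_split/=.
  apply: eq_bigr => i _; rewrite mulr_sumr -big_split/=.
  by apply: eq_bigr => j _; rewrite !mulrDl !mulrA.
by apply: cvgD; [exact: cvgZl_tmp|exact: gl].
Qed.

End Germs.

Inductive category := Holomorphic | RealAnalytic | Smooth.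

Definition base_field (R : realType) (c : category) : numFieldType :=
  if c is Holomorphic then (R[i] : numFieldType) else R.

Section PoissonComplex.
Context {K : numFieldType}.
Variable c : category.

(* The convergent power series is what defines holomorphic and real analytic
   germs; it implies smoothness, which is stated so as to have the partial
   derivatives at hand. *)
Definition of_category : set (K * K -> K) :=
  [set f | smooth f /\ (c = Smooth \/ power_series f)].

Definition germs : set (@germ K) := [set germ_of f | f in of_category].

Lemma germs_linear a (u v : germ) : germs u -> germs v -> germs (a *: u + v).
Proof.
move=> [f [sf af] <-] [g [sg ag] <-]; exists (a *: f + g).
  split; first exact: smoothD.
  case: af => [|af]; first by left.
  by case: ag => [|ag]; [left|right; exact: power_seriesD].
by rewrite germ_ofD germ_ofZ.
Qed.

Lemma germs0 : germs 0.
Proof.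
have cst0 w : iter_partial w (0 : K * K -> K) = 0.
  elim: w => [//|b w /= ->]; apply/funext => z.
  by case: b; rewrite /dx /dy derive1E derive_cst.
exists 0; last exact: raddf0.
split; last first.
  right; exists (fun _ _ => 0).
  apply/near_openP; exists setT; [by split=> //; exact: openT|move=> z _; split].
    by exists 0 => n; rewrite big1// => i _; rewrite big1// => j _; rewrite !mul0r normr0.
  rewrite (_ : (fun n => _) = cst 0); first exact: cvg_cst.
  by apply/funext => n; rewrite big1// => i _; rewrite big1// => j _; rewrite !mul0r.
apply/smooth_openP; exists setT; [by split=> //; exact: openT|].
move=> z _ w /=; rewrite cst0; split; try exact: derivable_cst.
exact: cvg_cst.
Qed.

Lemma germ_partial_linear a (u v : germ) : germs u -> germs v ->
  germ_dx (a *: u + v) = a *: germ_dx u + germ_dx v /\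
  germ_dy (a *: u + v) = a *: germ_dy u + germ_dy v.
Proof.
move=> [f [/smooth_openP[U [oU U0] Uf] _] <-].
move=> [g [/smooth_openP[V [oV V0] Vg] _] <-].
have oUV : open (U `&` V) by exact: openI.
rewrite -germ_ofZ -germ_ofD !germ_dxE !germ_dyE -!germ_ofZ -!germ_ofD.
have E w : {in U `&` V, iter_partial w (a *: f + g) =1
                        a *: iter_partial w f + iter_partial w g}.
  apply: iter_partialD => // y [Uy Vy] s.
  by have [_ ? ?] := Uf _ Uy s; have [_ ? ?] := Vg _ Vy s.
split; apply/germ_ofP/near_openP; exists (U `&` V) => // z UVz.
  by apply: (E [:: true]); rewrite inE.
by apply: (E [:: false]); rewrite inE.
Qed.

Definition vfield := (@germ K * @germ K)%type.

(* the product of a function and a vector field *)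
Definition gscale (u : germ) (X : vfield) : vfield := (u * X.1, u * X.2).

Definition vf_apply (X : vfield) (g : germ) : germ :=
  X.1 * germ_dx g + X.2 * germ_dy g.

Definition div (X : vfield) : germ := germ_dx X.1 + germ_dy X.2.

Definition hamiltonian (g : germ) : vfield := (germ_dy g, - germ_dx g).

(* Bivector fields are identified with their coefficient along
   d/dx /\ d/dy; F is the coefficient of the Poisson structure. *)
Definition delta1 (F g : germ) : vfield := gscale F (hamiltonian g).
Definition delta2 (F : germ) (X : vfield) : germ := vf_apply X F - div X * F.

Variable F : @germ K.

Definition cocycle : {pred vfield} :=
  fun X => `[< [/\ germs X.1, germs X.2 & delta2 F X = 0] >].

Definition coboundary : {pred vfield} :=
  fun X => `[< exists2 g, germs g & X = delta1 F g >].

Fact cocycle_submod : GRing.submod_closed cocycle.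
Proof.
split.
  apply/asboolP; split; [exact: germs0|exact: germs0|].
  rewrite /delta2 /vf_apply /div /= !mul0r addr0 sub0r.
  have [] := germ_partial_linear (-1) germs0 germs0.
  by rewrite scaler0 addr0 !scaleN1r !addNr => -> ->; rewrite addr0 mul0r oppr0.
move=> a X Y /asboolP[X1 X2 dX] /asboolP[Y1 Y2 dY]; apply/asboolP; split => /=;
  [exact: germs_linear|exact: germs_linear|].
have [b sE] : exists b : germ, forall x, a *: x = b * x :> germ.
  by exists a%:A => x; rewrite mulr_algl.
have -> : delta2 F (a *: X + Y) = a *: delta2 F X + delta2 F Y.
  rewrite /delta2 /vf_apply /div /=.
  rewrite (germ_partial_linear a X1 Y1).1 (germ_partial_linear a X2 Y2).2.
  by rewrite !sE; ring.
by rewrite dX dY scaler0 addr0.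
Qed.

HB.instance Definition _ := GRing.isSubmodClosed.Build K vfield cocycle
  cocycle_submod.

Fact coboundary_submod : GRing.submod_closed coboundary.
Proof.
have dE a u v : germs u -> germs v ->
    delta1 F (a *: u + v) = a *: delta1 F u + delta1 F v.
  move=> gu gv; have [ux uy] := germ_partial_linear a gu gv.
  rewrite /delta1 /gscale /hamiltonian /= ux uy.
  have [b sE] : exists b : germ, forall x, a *: x = b * x :> germ.
    by exists a%:A => x; rewrite mulr_algl.
  by congr (_, _); rewrite /= !sE; ring.
split.
  apply/asboolP; exists 0; first exact: germs0.
  have := dE (-1) _ _ germs0 germs0.
  by rewrite scaler0 addr0 scaleN1r addNr.
move=> a X Y /asboolP[u gu ->] /asboolP[v gv ->]; apply/asboolP.
by exists (a *: u + v); [exact: germs_linear|rewrite dE].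
Qed.

HB.instance Definition _ := GRing.isSubmodClosed.Build K vfield coboundary
  coboundary_submod.

Record Z1 := MkZ1 { Z1_val : vfield; Z1P : Z1_val \in cocycle }.

HB.instance Definition _ := [isSub for Z1_val].
HB.instance Definition _ := [Choice of Z1 by <:].
HB.instance Definition _ := [SubChoice_isSubLmodule of Z1 by <:].

(* For F in germs, coboundaries are cocycles. *)
Definition B1 : {pred Z1} := fun X => val X \in coboundary.

Fact B1_submod : GRing.submod_closed B1.
Proof.
split; first by rewrite /B1 unfold_in raddf0 rpred0.
by move=> a X Y BX BY; rewrite unfold_in linearP rpredD// rpredZ.
Qed.

HB.instance Definition _ := GRing.isSubmodClosed.Build K Z1 B1 B1_submod.

Fact B1_scale : GRing.scaler_closed B1.
Proof. exact: rpredZ. Qed.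

Definition H1 := lmod_quot B1_scale.

HB.instance Definition _ := GRing.Lmodule.on H1.
HB.instance Definition _ := ZmodQuotient.on H1.

Definition H1_class (X : Z1) : H1 := \pi_H1 X.

Lemma H1_class_linear a X Y : H1_class (a *: X + Y) = a *: H1_class X + H1_class Y.
Proof. by rewrite /H1_class pi_quotD (pi_quot_scale B1_scale). Qed.

Lemma H1_class_eq0 X : (H1_class X == 0) = (val X \in coboundary).
Proof. by rewrite /H1_class -[0](raddf0 \pi_H1) piE Quotient.equivE subr0. Qed.

Definition jacobian_ideal (f : germ) : set germ :=
  [set u * germ_dx f + v * germ_dy f | u in germs & v in germs].

Definition finite_codim (f : germ) := finite_dim_quotient germs (jacobian_ideal f).

End PoissonComplex.

Section QuasiHomogeneous.
Context {K : numFieldType}.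

Definition poly_germ (p : mpoly 2 K) : germ :=
  germ_of (fun z : K * K => meval (fun i => if i == 0 then z.1 else z.2) p).

Variables w1 w2 : nat.

Definition euler_field : @vfield K :=
  (germ_of (fun z => w1%:R * z.1), germ_of (fun z => w2%:R * z.2)).

(* W p for W = w1 x d/dx + w2 y d/dy *)
Definition euler_poly (p : mpoly 2 K) : mpoly 2 K :=
  w1%:R *: (mpolyX K (mnm1 0) * mderiv 0 p) +
  w2%:R *: (mpolyX K (mnm1 1) * mderiv 1 p).

Definition quasi_homogeneous (k : int) : set (mpoly 2 K) :=
  [set p | euler_poly p = k%:~R *: p].

End QuasiHomogeneous.

(* Main.v *)
(* Multiplication by v = 1 + h, a unit, identifies the cocycles of f v with those
   of f, and coboundaries with coboundaries, so only f matters.  If X is a cocycle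
   of f, then u = div X / d gives (X - u W).f = 0; as f has finite codimension,
   some powers of x and y lie in the ideal (df/dx, df/dy), which is therefore
   generated by a regular sequence, and X - u W = g H_f.  Solving
   W.k = d (g - g(0)) and subtracting f H_k leaves g(0) H_f + u' W, where the
   cocycle condition becomes W.u' = (d - w1 - w2) u'.  Such a germ u' is a
   polynomial, because W + c is injective for c > 0 and differentiation lowers
   quasi-degrees.

   The only analytic input is that a x d/dx + b y d/dy + c is bijective on germs
   for natural numbers a, b and c > 0.  On convergent power series it acts
   diagonally; on smooth germs its inverse maps g to the integral over [0, 1] of
   t^(c-1) g(t^a x, t^b y). *)
Require Import Defs.
From HB Require Import structures.
From mathcomp Require Import all_boot all_order all_algebra.
From mathcomp Require Import all_classical all_reals topology normedtype derive.
From mathcomp Require Import sequences realfun measure lebesgue_measure.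
From mathcomp Require Import lebesgue_integral ftc.
From mathcomp Require Import complex ring.
From mathcomp.multinomials Require Import -(notations) mpoly.

Set Implicit Arguments.
Unset Strict Implicit.
Unset Printing Implicit Defensive.

Import Order.TTheory GRing.Theory Num.Theory numFieldNormedType.Exports.
Local Open Scope classical_set_scope.
Local Open Scope ring_scope.

(** * Euler operators and division in algebras with two derivations *)

(** The ring of smooth germs is neither Noetherian nor a domain, so the usual facts on regular
    sequences and zero divisors cannot simply be quoted. The algebra is therefore done in a
    [plane_algebra], whose axioms hold in all three categories, and every division comes from the
    Euler operators. For [(a, b, c) = (1, 0, 1)] the operator is [v |-> D1 (x * v)]: its injectivity
    makes [x] regular, and its surjectivity gives [D1 u] a primitive divisible by [x]. This is why
    [a] and [b] may vanish, while [c = 0] is excluded: constants would lie in the kernel. Finite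
    codimension is used only through two equations [x ^+ N = a * P + b * Q] and
    [y ^+ M = a' * P + b' * Q], where [P] and [Q] are the partial derivatives of [f]. They yield the
    exactness of the Koszul complex of [P, Q], the nonvanishing of the degree [d] and, as there are
    no nilpotents, the regularity of [f]. *)

Record plane_algebra (K : numFieldType) (T : comAlgType K)
    (D1 D2 : {linear T -> T}) (x y : T) : Prop := PlaneAlgebra {
  pa_D1M : forall u v, D1 (u * v) = D1 u * v + u * D1 v;
  pa_D2M : forall u v, D2 (u * v) = D2 u * v + u * D2 v;
  pa_D1x : D1 x = 1;
  pa_D1y : D1 y = 0;
  pa_D2x : D2 x = 0;
  pa_D2y : D2 y = 1;
  pa_D12 : forall u, D1 (D2 u) = D2 (D1 u);
  pa_surj : forall (a b c : nat) u, (0 < c)%N ->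
    exists v, a%:R * x * D1 v + b%:R * y * D2 v + c%:R * v = u;
  pa_inj : forall (a b c : nat) v, (0 < c)%N ->
    a%:R * x * D1 v + b%:R * y * D2 v + c%:R * v = 0 -> v = 0;
  pa_const : forall u, D1 u = 0 -> D2 u = 0 -> exists k : K, u = k%:A;
  pa_unit : forall a b, exists u, (1 + x * a + y * b) * u = 1;
  pa_reduced : forall u : T, u * u = 0 -> u = 0 }.

Section PlaneAlgebra.
Context {K : numFieldType} {T : comAlgType K} {D1 D2 : {linear T -> T}} {x y : T}.
Hypothesis PA : plane_algebra D1 D2 x y.

Let D1M := pa_D1M PA.
Let D2M := pa_D2M PA.
Let D1x := pa_D1x PA.
Let D1y := pa_D1y PA.
Let D2x := pa_D2x PA.
Let D2y := pa_D2y PA.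
Let D12 := pa_D12 PA.

Lemma derivA (D : {linear T -> T}) (k : K) :
  (forall u v, D (u * v) = D u * v + u * D v) -> D k%:A = 0.
Proof.
move=> DM; rewrite linearZ/=.
have : D (1 * 1) = D 1 + D 1 by rewrite DM mulr1 mul1r.
by rewrite mulr1 -[LHS]addr0 => /addrI <-; rewrite scaler0.
Qed.

Lemma natA n : n%:R = (n%:R : K)%:A :> T.
Proof. by rewrite scaler_nat. Qed.

Lemma D1A k : D1 k%:A = 0. Proof. exact: derivA. Qed.
Lemma D2A k : D2 k%:A = 0. Proof. exact: derivA. Qed.
Lemma D1n n : D1 n%:R = 0. Proof. by rewrite natA D1A. Qed.
Lemma D2n n : D2 n%:R = 0. Proof. by rewrite natA D2A. Qed.

Lemma D1D u v : D1 (u + v) = D1 u + D1 v. Proof. exact: linearD. Qed.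
Lemma D2D u v : D2 (u + v) = D2 u + D2 v. Proof. exact: linearD. Qed.
Lemma D1N u : D1 (- u) = - D1 u. Proof. exact: linearN. Qed.
Lemma D2N u : D2 (- u) = - D2 u. Proof. exact: linearN. Qed.

Definition dE := (D1M, D2M, D1x, D1y, D2x, D2y, D1n, D2n, D1A, D2A,
  D1D, D2D, D1N, D2N).

Lemma mulA (k : K) (u : T) : k *: u = k%:A * u. Proof. by rewrite mulr_algl. Qed.

Lemma invA (k : K) : k != 0 -> k%:A * k^-1%:A = 1 :> T.
Proof. by move=> k0; rewrite -mulA scalerA mulfV// scale1r. Qed.

Lemma x_regular v : x * v = 0 -> v = 0.
Proof.
move=> xv; apply: (pa_inj PA (a := 1) (b := 0) (c := 1)) => //.
have : D1 (x * v) = 0 by rewrite xv raddf0.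
by rewrite D1M D1x => <-; ring.
Qed.

Lemma y_regular v : y * v = 0 -> v = 0.
Proof.
move=> yv; apply: (pa_inj PA (a := 0) (b := 1) (c := 1)) => //.
have : D2 (y * v) = 0 by rewrite yv raddf0.
by rewrite D2M D2y => <-; ring.
Qed.

(** Solving [x * D1 v + v = D1 u] means [D1 (x * v) = D1 u]. The remainder [p] is the restriction of
    [u] to the line [x = 0]; [D1 p = 0] expresses that it does not depend on [x]. *)
Lemma div_x u : exists v p, u = x * v + p /\ D1 p = 0.
Proof.
have [v Ev] := pa_surj PA 1 0 (D1 u) (isT : (0 < 1)%N).
exists v, (u - x * v); split; first ring.
by rewrite !dE -Ev; ring.
Qed.

Lemma div_y p : D1 p = 0 -> exists q (k : K), p = y * q + k%:A.
Proof.
move=> p1; have [q Eq] := pa_surj PA 0 1 (D2 p) (isT : (0 < 1)%N).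
(* The equation of [q], differentiated in [x], becomes homogeneous because [D1 p = 0]; injectivity
   then makes [q] independent of [x] too, so that both derivatives kill [p - y * q]. *)
have q1 : D1 q = 0.
  apply: (pa_inj PA (a := 0) (b := 1) (c := 1)) => //.
  have : D1 (D2 p) = 0 by rewrite D12 p1 raddf0.
  by rewrite -Eq !dE D12 => <-; ring.
have [||k mk] := pa_const PA (u := p - y * q); rewrite ?dE.
- by rewrite p1 q1; ring.
- by rewrite -Eq; ring.
- by exists q, k; rewrite -mk; ring.
Qed.

Lemma hadamard u : exists k a b, u = k%:A + x * a + y * b.
Proof.
have [v [p [-> /div_y[q [k ->]]]]] := div_x u.
by exists k, v, q; ring.
Qed.

(** This replaces evaluation at the origin: the constant term found by [hadamard] is unique. If [k]
    were nonzero, dividing by it would turn the left side into one of the units of [pa_unit], and a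
    unit is not zero. *)
Lemma const_max_ideal k a b : k%:A + x * a + y * b = 0 -> k = 0.
Proof.
move=> E; apply/eqP/negP => /negP k0.
have [u] := pa_unit PA (k^-1%:A * a) (k^-1%:A * b).
have -> : 1 + x * (k^-1%:A * a) + y * (k^-1%:A * b) = k^-1%:A * (k%:A + x * a + y * b).
  apply/eqP; rewrite -subr_eq0; apply/eqP.
  by transitivity (1 - k%:A * k^-1%:A : T); [ring | rewrite invA// subrr].
by rewrite E mulr0 mul0r => /esym/eqP; rewrite oner_eq0.
Qed.

Lemma unit_ne0 k a b : k != 0 -> exists u, (k%:A + x * a + y * b) * u = 1.
Proof.
move=> k0; have [u Eu] := pa_unit PA (k^-1%:A * a) (k^-1%:A * b).
exists (k^-1%:A * u); apply: etrans Eu; apply/eqP; rewrite -subr_eq0; apply/eqP.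
by transitivity ((k%:A * k^-1%:A - 1) * u); [ring | rewrite invA// subrr mul0r].
Qed.

(** After [div_x] only the part [p] of [U] that does not depend on [x] matters. Then [y * p] is both
    independent of [x] and a multiple of [x], which forces it to vanish. *)
Lemma y_x_regular U V : y * U = x * V -> exists U', U = x * U'.
Proof.
have [v [p [-> p1]]] := div_x U => E; exists v.
have E' : y * p = x * (V - y * v) by rewrite mulrBr -E; ring.
have V0 : V - y * v = 0.
  apply: (pa_inj PA (a := 1) (b := 0) (c := 1)) => //.
  have : D1 (x * (V - y * v)) = 0 by rewrite -E' D1M D1y p1; ring.
  by rewrite D1M D1x => <-; ring.
by rewrite V0 mulr0 in E'; rewrite (y_regular E') addr0.
Qed.

Lemma yX_x_regular N U V : y ^+ N * U = x * V -> exists U', U = x * U'.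
Proof.
elim: N V => [|N IHN] V E; first by exists V; rewrite -E expr0 mul1r.
rewrite exprS -mulrA in E.
by have [W WE] := y_x_regular E; exact: IHN WE.
Qed.

Lemma yX_xX_regular N M U V : y ^+ N * U = x ^+ M * V -> exists U', U = x ^+ M * U'.
Proof.
elim: M U V => [|M IH] U V E; first by exists U; rewrite expr0 mul1r.
have [U1 UE] : exists U1, U = x * U1.
  by apply: (@yX_x_regular N _ (x ^+ M * V)); rewrite E exprS mulrA.
have [U2 U2E] : exists U2, U1 = x ^+ M * U2.
  apply: (IH _ V); apply/eqP; rewrite -subr_eq0; apply/eqP/x_regular.
  by rewrite mulrBr [x * (x ^+ M * V)]mulrA -exprS -E UE; ring.
by exists U2; rewrite UE U2E exprS mulrA.
Qed.

Lemma xX_neq0 N u : x ^+ N * u = 0 -> u = 0.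
Proof.
elim: N => [|N IH]; first by rewrite expr0 mul1r.
by rewrite exprS -mulrA => /x_regular.
Qed.

(* The coefficients [a b a' b'] witness that P, Q is a regular sequence: they
   reduce the divisibility of (A, B) by (Q, -P) to that of x^N and y^M. *)
Lemma koszul_exact P Q N M a b a' b' A B :
  x ^+ N = a * P + b * Q -> y ^+ M = a' * P + b' * Q ->
  A * P + B * Q = 0 -> exists g, A = g * Q /\ B = - (g * P).
Proof.
move=> xN yM AB.
(* If [(A, B) = g (Q, - P)], then [b * A - a * B = g * (a * P + b * Q) = x ^+ N * g]; this is how
   [g] is found. *)
have [g gE] : exists g, b * A - a * B = x ^+ N * g.
  apply: (@yX_xX_regular M _ _ (b' * A - a' * B)).
  have -> : y ^+ M * (b * A - a * B) =
     x ^+ N * (b' * A - a' * B) + (a' * b - a * b') * (A * P + B * Q).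
    by rewrite xN yM; ring.
  by rewrite AB mulr0 addr0.
exists g; split; apply/eqP; rewrite -subr_eq0; apply/eqP/(@xX_neq0 N).
  have -> : x ^+ N * (A - g * Q) = x ^+ N * A - Q * (x ^+ N * g) by ring.
  rewrite -gE xN; have -> : (a * P + b * Q) * A - Q * (b * A - a * B) = a * (A * P + B * Q) by ring.
  by rewrite AB mulr0.
have -> : x ^+ N * (B - - (g * P)) = x ^+ N * B + P * (x ^+ N * g) by ring.
rewrite -gE xN; have -> : (a * P + b * Q) * B + P * (b * A - a * B) = b * (A * P + B * Q) by ring.
by rewrite AB mulr0.
Qed.

(** * From finite codimension to powers of the coordinates in the Jacobian ideal *)

Lemma poly_at (z : T) (p : {poly K}) : p != 0 -> exists (k : nat) (c : K) (a : T),
  c != 0 /\ horner_alg z p = z ^+ k * (c%:A + z * a).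
Proof.
elim/poly_ind: p => [|p c IH]; first by rewrite eqxx.
rewrite rmorphD rmorphM/= horner_algX horner_algC.
have [-> | c0] := eqVneq c 0.
  rewrite addr0 scale0r addr0 mulf_eq0 polyX_eq0 orbF => /IH[k [c' [a [c0 ->]]]].
  by exists k.+1, c', a; split=> //; rewrite exprS; ring.
by move=> _; exists 0%N, c, (horner_alg z p); split=> //; rewrite expr0 mul1r; ring.
Qed.

(** The quotient by [(P, Q)] is spanned by [n] elements, so the [n + 1] powers of [z] up to the
    exponent [n] satisfy a linear relation there: a nonzero polynomial in [z] lies in the ideal. It
    is a power of [z] times a unit, and the unit can be cancelled. *)
Lemma finite_codim_xX (z P Q : T) n (s : 'I_n -> T) :
    (forall p : {poly K}, p != 0 -> exists (k : nat) (u u' : T),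
      horner_alg z p = z ^+ k * u /\ u * u' = 1) ->
    (forall u, exists (c : 'I_n -> K) (a b : T), u - \sum_i c i *: s i = a * P + b * Q) ->
  exists N a b, z ^+ N = a * P + b * Q.
Proof.
move=> zP sP.
have /choice[C CP] : forall i : 'I_n.+1, exists c : 'I_n -> K,
    exists a b, z ^+ i - \sum_j c j *: s j = a * P + b * Q by move=> i; exact: sP.
pose M := \matrix_(i < n.+1, j < n) C i j.
have : kermx M != 0.
  by rewrite kermx_eq0 /row_free neq_ltn ltnS rank_leq_col.
case/rowV0Pn => v /sub_kermxP vM v0.
pose p := \poly_(i < n.+1) v 0 (inord i).
have pE : horner_alg z p = \sum_(i < n.+1) v 0 i *: z ^+ i.
  rewrite /p poly_def raddf_sum/=; apply: eq_bigr => i _.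
  by rewrite inord_val linearZ/= rmorphXn/= horner_algX mulr_algl.
have p0 : p != 0.
  apply: contraNneq v0 => p0; apply/eqP/rowP => j; rewrite mxE.
  have := congr1 (fun q : {poly K} => q`_j) p0.
  by rewrite /= coef_poly ltn_ord inord_val coef0.
have [a [b pI]] : exists a b, horner_alg z p = a * P + b * Q.
  have /choice[a /choice[b ab]] := CP.
  exists (\sum_i v 0 i *: a i), (\sum_i v 0 i *: b i).
  have -> : horner_alg z p = \sum_i v 0 i *: (z ^+ i - \sum_j C i j *: s j).
    rewrite pE; under [RHS]eq_bigr do rewrite scalerBr.
    rewrite sumrB -[LHS]subr0; congr (_ - _).
    under eq_bigr do rewrite scaler_sumr.
    rewrite exchange_big/= big1// => j _.
    under eq_bigr do rewrite scalerA.
    rewrite -scaler_suml; have /rowP/(_ j) := vM; rewrite !mxE.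
    by under eq_bigr do rewrite mxE; move=> ->; rewrite scale0r.
  rewrite !mulr_suml -big_split/=; apply: eq_bigr => i _.
  by rewrite ab scalerDr !scalerAl.
have [k [u [u' [zk uu']]]] := zP _ p0.
exists k, (a * u'), (b * u').
have -> : z ^+ k = (z ^+ k * u) * u' by rewrite -mulrA uu' mulr1.
by rewrite -zk pI; ring.
Qed.

Lemma intA (c : int) : c%:~R = (c%:~R : K)%:A :> T.
Proof. by rewrite scaler_int. Qed.

Lemma D1z (c : int) : D1 c%:~R = 0. Proof. by rewrite intA D1A. Qed.
Lemma D2z (c : int) : D2 c%:~R = 0. Proof. by rewrite intA D2A. Qed.

Lemma char0_regular n (u : T) : (0 < n)%N -> n%:R * u = 0 -> u = 0.
Proof.
move=> n0 nu; have n0' : n%:R != 0 :> K by rewrite pnatr_eq0 -lt0n.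
by rewrite -[u]mul1r -(invA n0') [_%:A * _]mulrC -mulrA -natA nu mulr0.
Qed.

Lemma int_inv (c : int) : c != 0 -> exists e : K, c%:~R * e%:A = 1 :> T.
Proof.
move=> c0; exists (c%:~R)^-1; rewrite intA; apply: invA.
by rewrite intr_eq0.
Qed.

Lemma deriv_exp (D : {linear T -> T}) (u : T) n :
  (forall u v, D (u * v) = D u * v + u * D v) ->
  D (u ^+ n) = n%:R * u ^+ n.-1 * D u.
Proof.
move=> DM; elim: n => [|n IH].
  by rewrite expr0 -[1]scale1r derivA// !mul0r.
rewrite exprS DM IH; case: n {IH} => [|n]; first by rewrite !expr0; ring.
by rewrite /= -natr1 exprS; ring.
Qed.

(** * Polynomials as elements of the algebra *)

Definition coord (i : 'I_2) : T := if i == 0 then x else y.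

Definition peval (p : mpoly 2 K) : T := mmap (in_alg T) coord p.

HB.instance Definition _ := GRing.RMorphism.copy peval (mmap (in_alg T) coord).

Lemma pevalZ c p : peval (c *: p) = c *: peval p.
Proof. by rewrite /peval mmapZ /= mulr_algl. Qed.

Lemma pevalX m : peval (mpolyX K m) = x ^+ m 0 * y ^+ m 1.
Proof.
rewrite /peval mmapX /mmap1 !big_ord_recl big_ord0 mulr1.
by congr (_ ^+ m _ * _ ^+ m _); apply/val_inj.
Qed.

Lemma peval_var i : peval (mpolyX K (mnm1 i)) = coord i.
Proof. by rewrite /peval mmapX mmap1U. Qed.

Lemma peval_mderiv (D : {linear T -> T}) i :
  (forall u v, D (u * v) = D u * v + u * D v) ->
  (forall j, D (coord j) = (j == i)%:R) ->
  forall p, D (peval p) = peval (mderiv i p).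
Proof.
move=> DM Dc; elim/mpolyind => [|c m p _ _ IH].
  by rewrite mderiv0 !raddf0.
rewrite mderivD !raddfD/= IH mderivZ !pevalZ linearZ/=; congr (_ *: _ + _).
rewrite mderivX pevalZ !pevalX DM !deriv_exp// (Dc 0) (Dc 1) !mnmBE !mnm1E.
rewrite scaler_nat.
case: i {Dc IH} => -[|[|//]] i2 /=.
  rewrite (_ : Ordinal i2 = 0) ?eqxx//=; last exact: val_inj.
  by rewrite subn1 subn0 -[in RHS]mulr_natl; ring.
rewrite (_ : Ordinal i2 = 1) ?eqxx//=; last exact: val_inj.
by rewrite subn1 subn0 -[in RHS]mulr_natl; ring.
Qed.

Lemma D1_peval p : D1 (peval p) = peval (mderiv 0 p).
Proof.
apply: peval_mderiv => // -[[|[|//]] i2]; rewrite /coord.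
  by rewrite (_ : Ordinal i2 = 0) ?eqxx//; apply: val_inj.
by rewrite (_ : Ordinal i2 = 1) ?eqxx//; apply: val_inj.
Qed.

Lemma D2_peval p : D2 (peval p) = peval (mderiv 1 p).
Proof.
apply: peval_mderiv => // -[[|[|//]] i2]; rewrite /coord.
  by rewrite (_ : Ordinal i2 = 0) ?eqxx//; apply: val_inj.
by rewrite (_ : Ordinal i2 = 1) ?eqxx//; apply: val_inj.
Qed.

Lemma peval_const p : exists a b, peval p = (mcoeff mnm0 p)%:A + x * a + y * b.
Proof.
elim/mpolyind: p => [|c m p _ _ [a [b IH]]].
  by exists 0, 0; rewrite mcoeff0 scale0r raddf0; ring.
rewrite raddfD/= pevalZ pevalX IH mcoeffD mcoeffZ mcoeffX.
rewrite scalerDl -scalerA mulA.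
have [m0|m0] := eqVneq m mnm0.
  exists a, b; rewrite m0 !mnm0E !expr0 mulr1 scale1r.
  ring.
rewrite scale0r scaler0.
case m0E : (m 0) => [|k].
  case m1E : (m 1) => [|l].
    case/eqP: m0; apply/mnmP => -[[|[|//]] i2]; rewrite mnm0E.
      by rewrite (_ : Ordinal i2 = 0) ?m0E//; apply: val_inj.
    by rewrite (_ : Ordinal i2 = 1) ?m1E//; apply: val_inj.
  by exists a, (c%:A * y ^+ l + b); rewrite exprS expr0; ring.
by exists (c%:A * x ^+ k * y ^+ m 1 + a), b; rewrite exprS; ring.
Qed.

(** Taylor's argument: the constant coefficient vanishes by [const_max_ideal], and a coefficient of
    positive degree is read off from a derivative, up to an exponent that is invertible in
    characteristic zero. Identities between germs of polynomials thus become identities between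
    polynomials. *)
Lemma peval_inj p : peval p = 0 -> p = 0.
Proof.
move=> p0; apply/mpolyP => m; rewrite mcoeff0.
have [n] : exists n, mdeg m = n by exists (mdeg m).
elim: n p m p0 => [|n IH] p m p0 mn.
  move/eqP: mn; rewrite mdeg_eq0 => /eqP ->.
  by have [a [b]] := peval_const p; rewrite p0 => /esym/const_max_ideal.
have [i mi] : exists i, (0 < m i)%N.
  have : m != mnm0 by apply: contra_eqN mn => /eqP ->; rewrite mdeg0.
  move=> m0; apply/existsP; apply: contraNT m0 => /existsPn mi.
  by apply/eqP/mnmP => i; rewrite mnm0E; have := mi i; rewrite -eqn0Ngt => /eqP.
have mE : m = mnm_add (mnm_sub m (mnm1 i)) (mnm1 i) by rewrite submK// lep1mP -lt0n.
have /(IH _ (mnm_sub m (mnm1 i))) : peval (mderiv i p) = 0.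
  case: (i) => -[|[|//]] i2.
    by rewrite (_ : Ordinal i2 = 0) -?D1_peval ?p0 ?raddf0//; apply: val_inj.
  by rewrite (_ : Ordinal i2 = 1) -?D2_peval ?p0 ?raddf0//; apply: val_inj.
rewrite mcoeff_mderiv -mE => /(_ _)/eqP; rewrite mulrn_eq0/= => E; apply/eqP/E.
by move: mn; rewrite {1}mE mdegD mdeg1 addn1 => -[].
Qed.

(** * Quasi-homogeneous elements and the cocycles of [f] *)

Section Poisson.
Variables w1 w2 : nat.
Hypotheses (w1_gt0 : (0 < w1)%N) (w2_gt0 : (0 < w2)%N).

Definition eulerD (u : T) : T := w1%:R * x * D1 u + w2%:R * y * D2 u.

Lemma peval_euler p : eulerD (peval p) = peval (euler_poly w1 w2 p).
Proof.
rewrite /euler_poly raddfD/= !pevalZ !rmorphM/= !peval_var /coord/= /eulerD.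
by rewrite D1_peval D2_peval !scaler_nat -!mulrA !mulr_natl.
Qed.

(** The commutator of [D1] with [W] is [w1 D1]: differentiation lowers the quasi-degree by the
    weight of the variable. *)
Lemma eulerD_D1 (c : int) u : eulerD u = c%:~R * u ->
  eulerD (D1 u) = (c - w1%:Z)%:~R * D1 u.
Proof.
move=> E; apply/eqP; rewrite -subr_eq0 intrB; apply/eqP.
transitivity (D1 (eulerD u) - D1 (c%:~R * u)); last by rewrite E subrr.
by rewrite /eulerD !dE D1z D12; ring.
Qed.

Lemma eulerD_D2 (c : int) u : eulerD u = c%:~R * u ->
  eulerD (D2 u) = (c - w2%:Z)%:~R * D2 u.
Proof.
move=> E; apply/eqP; rewrite -subr_eq0 intrB; apply/eqP.
transitivity (D2 (eulerD u) - D2 (c%:~R * u)); last by rewrite E subrr.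
by rewrite /eulerD !dE D2z D12; ring.
Qed.

Lemma eulerD_neg (c : int) u : c < 0 -> eulerD u = c%:~R * u -> u = 0.
Proof.
case: c => // n _; rewrite NegzE /eulerD => E.
apply: (pa_inj PA (a := w1) (b := w2) (c := n.+1)) => //.
by rewrite E mulrNz; ring.
Qed.

(** Both partial derivatives have negative quasi-degree, hence vanish by [eulerD_neg]. *)
Lemma eulerD0 u : eulerD u = 0 -> exists k : K, u = k%:A.
Proof.
move=> E; have E0 : eulerD u = (0 : int)%:~R * u by rewrite E mul0r.
apply: (pa_const PA).
  by apply: eulerD_neg (eulerD_D1 E0); rewrite sub0r oppr_lt0.
by apply: eulerD_neg (eulerD_D2 E0); rewrite sub0r oppr_lt0.
Qed.

(** Compare the constant terms in [W u = c u], where the left side has none. Applied to [h], of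
    positive degree, it makes [1 + h] a unit. *)
Lemma eulerD_max_ideal (c : int) u : c != 0 -> eulerD u = c%:~R * u ->
  exists a b, u = x * a + y * b.
Proof.
move=> c0 E; have [k [a [b uE]]] := hadamard u; exists a, b.
have := @const_max_ideal (c%:~R * k) (c%:~R * a - w1%:R * D1 u) (c%:~R * b - w2%:R * D2 u).
have -> : (c%:~R * k)%:A + x * (c%:~R * a - w1%:R * D1 u) + y * (c%:~R * b - w2%:R * D2 u) =
    c%:~R * u - eulerD u.
  by rewrite [in c%:~R * u]uE -scalerA mulA -intA /eulerD; ring.
rewrite E subrr => /(_ erefl)/eqP; rewrite mulf_eq0 intr_eq0 (negPf c0) /= => /eqP k0.
by rewrite uE k0 scale0r add0r.
Qed.

(** Induction on a bound for the degree, started by the negative degrees. The partial derivatives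
    have smaller degree, hence are polynomials, and for [c != 0] Euler's formula
    [c u = w1 x D1 u + w2 y D2 u] rebuilds [u] from them. *)
Lemma eulerD_poly (c : int) u : eulerD u = c%:~R * u -> exists p, u = peval p.
Proof.
have [n] : exists n : nat, c < n%:Z.
  by exists `|c|.+1%N; rewrite (le_lt_trans (ler_norm c))// ltz_nat.
elim: n c u => [|n IH] c u cn E.
  by exists 0; rewrite raddf0 (eulerD_neg cn E).
have lt w : (0 < w)%N -> c - w%:Z < n%:Z.
  by move=> w0; rewrite ltrBlDr (lt_le_trans cn)// -PoszD lez_nat -addn1 leq_add2l.
have [p1 p1E] := IH _ _ (lt _ w1_gt0) (eulerD_D1 E).
have [p2 p2E] := IH _ _ (lt _ w2_gt0) (eulerD_D2 E).
have [c0|c0] := eqVneq c 0.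
  move: E; rewrite c0 mul0r => /eulerD0[k ->].
  by exists (mpolyC 2 k); rewrite /peval mmapC.
have [e ce] := int_inv c0.
exists (e *: (w1%:R *: (mpolyX K (mnm1 0) * p1) + w2%:R *: (mpolyX K (mnm1 1) * p2))).
rewrite pevalZ raddfD/= !pevalZ !rmorphM/= !peval_var /coord/= -p1E -p2E.
rewrite mulA !scaler_nat; transitivity (e%:A * eulerD u).
  by rewrite E mulrA [e%:A * _]mulrC ce mul1r.
by rewrite /eulerD; ring.
Qed.

Variables (d : int) (f : T).
Hypothesis f_homog : eulerD f = d%:~R * f.

Let P := D1 f.
Let Q := D2 f.

Hypothesis x_jac : exists N a b, x ^+ N = a * P + b * Q.
Hypothesis y_jac : exists N a b, y ^+ N = a * P + b * Q.

(** In degree zero [f] would be constant, and its Jacobian ideal, being zero, could not contain a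
    power of [x]. *)
Lemma degree_neq0 : d != 0.
Proof.
apply/eqP => d0; move: f_homog; rewrite d0 mul0r => /eulerD0[k fk].
have [N [a [b]]] := x_jac; rewrite /P /Q fk D1A D2A !mulr0 addr0 => xN.
by have := @xX_neq0 N 1; rewrite mulr1 => /(_ xN)/eqP; rewrite oner_eq0.
Qed.

(** Differentiating [f * t = 0] and multiplying by [t] shows that both partial derivatives of [f]
    kill [t * t]. Hence so does a power of [x], which is regular, and [t * t = 0] forces [t = 0]. *)
Lemma homog_regular t : f * t = 0 -> t = 0.
Proof.
move=> ft.
have zero (D : {linear T -> T}) : (forall u v, D (u * v) = D u * v + u * D v) ->
    D f * (t * t) = 0.
  move=> DM; have : D (f * t) = 0 by rewrite ft raddf0.
  rewrite DM => E; transitivity ((D f * t + f * D t) * t - f * t * D t); first ring.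
  by rewrite E ft !mul0r subr0.
apply: (pa_reduced PA); have [N [a [b xN]]] := x_jac; apply: (@xX_neq0 N).
rewrite xN; transitivity (a * (P * (t * t)) + b * (Q * (t * t))); first ring.
by rewrite !zero// !mulr0 addr0.
Qed.

(** In the divergence of [l H_f + u W + f H_k], the field [H_f] contributes nothing, [u W]
    contributes [W u + (w1 + w2) u], and [f H_k] contributes [H_k.f]. *)
Lemma divergence (l : K) u k :
  D1 (l%:A * Q + u * (w1%:R * x) + f * D2 k) +
  D2 (- (l%:A * P) + u * (w2%:R * y) - f * D1 k) =
  eulerD u + (w1%:R + w2%:R) * u + P * D2 k - Q * D1 k.
Proof. by rewrite /eulerD /P /Q !dE !D12; ring. Qed.

(* The pair (A, B) is a cocycle X.  With u0 = div X / d the field X - u0 W kills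
   f, hence is g H_f; solving W k = d (g - g(0)) makes X - f H_k equal to
   g(0) H_f + u W, and the cocycle condition becomes W u = (d - w1 - w2) u. *)
Lemma cocycle_decomposition A B :
    A * P + B * Q = (D1 A + D2 B) * f ->
  exists (l : K) (u k : T), [/\ eulerD u = (d - w1%:Z - w2%:Z)%:~R * u,
    A = l%:A * Q + u * (w1%:R * x) + f * D2 k &
    B = - (l%:A * P) + u * (w2%:R * y) - f * D1 k].
Proof.
move=> AB; have [e de] := int_inv degree_neq0.
set dv := D1 A + D2 B in AB.
have fE : w1%:R * x * P + w2%:R * y * Q = d%:~R * f by exact: f_homog.
have [N [a [b xN]]] := x_jac; have [M [a' [b' yM]]] := y_jac.
have [|g [gA gB]] := koszul_exact (A := A - e%:A * dv * (w1%:R * x))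
    (B := B - e%:A * dv * (w2%:R * y)) xN yM.
  transitivity ((A * P + B * Q) - e%:A * dv * (w1%:R * x * P + w2%:R * y * Q)); first ring.
  rewrite AB fE; transitivity ((1 - d%:~R * e%:A) * (dv * f)); first ring.
  by rewrite de subrr mul0r.
have [l [s [t gE]]] := hadamard g.
(* [W] itself has [c = 0] and is not covered by surjectivity. But [W (x * k1) = x * (W k1 + w1 k1)],
   and [W + w1] is covered; likewise [W + w2] for the multiples of [y]. *)
have [k1 k1E] := pa_surj PA w1 w2 (d%:~R * s) w1_gt0.
have [k2 k2E] := pa_surj PA w1 w2 (d%:~R * t) w2_gt0.
pose k := x * k1 + y * k2.
have kE : eulerD k = d%:~R * (g - l%:A).
  transitivity (x * (d%:~R * s) + y * (d%:~R * t)); last by rewrite gE; ring.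
  by rewrite -k1E -k2E /eulerD /k !dE; ring.
(* The coefficient comes from the identity [(W k) H_f - (W f) H_k = (Q D1 k - P D2 k) W]: since
   [W k = d (g - l)] and [W f = d f], it says that [(g - l) H_f - f H_k] is a multiple of [W]. *)
pose u := e%:A * (dv + (Q * D1 k - P * D2 k)).
have divE (c : T) : c = d%:~R * e%:A * c by rewrite de mul1r.
have AE : A = l%:A * Q + u * (w1%:R * x) + f * D2 k.
  apply/eqP; rewrite -subr_eq0; apply/eqP; rewrite (divE (f * D2 k)).
  transitivity ((g - l%:A) * Q - e%:A * (Q * D1 k - P * D2 k) * (w1%:R * x)
     - e%:A * (d%:~R * f) * D2 k).
    by rewrite mulrBl -gA /u; ring.
  rewrite -fE (divE ((g - l%:A) * Q)).
  transitivity (e%:A * (d%:~R * (g - l%:A)) * Q - e%:A * (Q * D1 k - P * D2 k) * (w1%:R * x)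
     - e%:A * (w1%:R * x * P + w2%:R * y * Q) * D2 k); first ring.
  by rewrite -kE /eulerD; ring.
have BE : B = - (l%:A * P) + u * (w2%:R * y) - f * D1 k.
  apply/eqP; rewrite -subr_eq0; apply/eqP; rewrite (divE (f * D1 k)).
  transitivity (- ((g - l%:A) * P) - e%:A * (Q * D1 k - P * D2 k) * (w2%:R * y)
     + e%:A * (d%:~R * f) * D1 k).
    by rewrite mulrBl opprB -[g * P]opprK -gB /u; ring.
  rewrite -fE (divE ((g - l%:A) * P)).
  transitivity (- (e%:A * (d%:~R * (g - l%:A)) * P) - e%:A * (Q * D1 k - P * D2 k) * (w2%:R * y)
     + e%:A * (w1%:R * x * P + w2%:R * y * Q) * D1 k); first ring.
  by rewrite -kE /eulerD; ring.
exists l, u, k; split=> //.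
(* The divergence of the cocycle is computed from the definition of [u] and again by [divergence];
   the terms in [k] cancel and leave [d u = W u + (w1 + w2) u]. *)
have uE : d%:~R * u = dv + (Q * D1 k - P * D2 k) by rewrite /u mulrA -divE.
have dvE : dv = eulerD u + (w1%:R + w2%:R) * u + P * D2 k - Q * D1 k.
  by rewrite -(divergence l) -AE -BE.
rewrite !intrB !mulrBl uE dvE -!pmulrn; ring.
Qed.

Lemma generator_cocycle (l : K) u : eulerD u = (d - w1%:Z - w2%:Z)%:~R * u ->
  (l%:A * Q + u * (w1%:R * x)) * P + (- (l%:A * P) + u * (w2%:R * y)) * Q =
  (D1 (l%:A * Q + u * (w1%:R * x)) + D2 (- (l%:A * P) + u * (w2%:R * y))) * f.
Proof.
move=> uE; have := divergence l u 0; rewrite !raddf0 !mulr0 !addr0 !subr0 => ->.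
rewrite uE !intrB -!pmulrn.
transitivity (u * eulerD f); first by rewrite /eulerD -/P -/Q; ring.
by rewrite f_homog; ring.
Qed.

(** Replacing [f] by [f v] and [X] by [v X] multiplies [X.f - (div X) f] by [v * v]: the two terms
    that contain [X.v] cancel. *)
Lemma unit_cocycle v v' A B : v * v' = 1 ->
  (v * A) * D1 (f * v) + (v * B) * D2 (f * v) = (D1 (v * A) + D2 (v * B)) * (f * v) <->
  A * P + B * Q = (D1 A + D2 B) * f.
Proof.
move=> vv'.
have E : (v * A) * D1 (f * v) + (v * B) * D2 (f * v) - (D1 (v * A) + D2 (v * B)) * (f * v) =
    v * v * (A * P + B * Q - (D1 A + D2 B) * f) by rewrite !D1M !D2M -/P -/Q; ring.
split=> [/eqP|/eqP]; rewrite -subr_eq0 => /eqP E0; apply/eqP; rewrite -subr_eq0; apply/eqP.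
  have -> : A * P + B * Q - (D1 A + D2 B) * f =
      (v * v') * (v * v') * (A * P + B * Q - (D1 A + D2 B) * f) by rewrite vv' !mul1r.
  transitivity (v' * v' * (v * v * (A * P + B * Q - (D1 A + D2 B) * f))); first ring.
  by rewrite -E E0 mulr0.
by rewrite E E0 mulr0.
Qed.

(** The two equations say [l H_f + u W = f H_k]. Combining them so that [u] disappears gives
    [f * W k = l d f], hence [W k = l d] as [f] is regular. But [W k] has no constant term, so
    [l = 0]; then [k] is constant and [u W = 0]. *)
Lemma cocycle_independence (l : K) u k :
    eulerD u = (d - w1%:Z - w2%:Z)%:~R * u ->
    l%:A * Q + u * (w1%:R * x) = f * D2 k ->
    - (l%:A * P) + u * (w2%:R * y) = - (f * D1 k) ->
  l = 0 /\ u = 0.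
Proof.
move=> uE E1 E2.
have lk : eulerD k = l%:A * d%:~R.
  apply/eqP; rewrite -subr_eq0; apply/eqP/homog_regular.
  transitivity (w1%:R * x * (f * D1 k) + w2%:R * y * (f * D2 k) - l%:A * (d%:~R * f)).
    by rewrite /eulerD; ring.
  rewrite -f_homog -E1 -[f * D1 k]opprK -E2 /eulerD -/P -/Q; ring.
have l0 : l = 0.
  have := @const_max_ideal (- (l * d%:~R)) (w1%:R * D1 k) (w2%:R * D2 k).
  have -> : (- (l * d%:~R))%:A + x * (w1%:R * D1 k) + y * (w2%:R * D2 k) =
      eulerD k - l%:A * d%:~R.
    by rewrite scaleNr -scalerA -intA mulA /eulerD; ring.
  rewrite lk subrr => /(_ erefl)/eqP; rewrite oppr_eq0 mulf_eq0 intr_eq0.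
  by rewrite (negPf degree_neq0) orbF => /eqP.
split=> //; move: lk; rewrite l0 scale0r mul0r => /eulerD0[c kc].
move: E1; rewrite l0 kc D2A scale0r mul0r add0r mulr0 => E1.
apply: x_regular; apply: (char0_regular w1_gt0).
by rewrite -[RHS]E1; ring.
Qed.

End Poisson.
End PlaneAlgebra.

(** * Double power series *)

Section DoubleSums.
Context {K : numFieldType}.
Implicit Types (t u : nat -> nat -> K) (r s : K).

Definition psum t (n : nat) : K := \sum_(i < n) \sum_(j < n) t i j.

(* A [numFieldType] need be neither archimedean nor complete; these are the two
   consequences that power series need, so that R and C can be treated at once. *)
(* A [numFieldType] need be neither archimedean nor complete; these are the two
   consequences that power series need, so that R and C can be treated at once. *)
(* A [numFieldType] need be neither archimedean nor complete; these are the two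
   consequences that power series need, so that R and C can be treated at once. *)
Definition summable_field :=
  (forall r : K, 0 <= r -> r < 1 -> (fun n => r ^+ n) @ \oo --> (0 : K)) /\
  forall t, (exists M, forall n, psum (fun i j => `|t i j|) n <= M) -> cvg (psum t @ \oo).

(** Geometric domination, rather than plain absolute summability, gives explicit rates for the
    differences of partial sums compared below. *)
Definition dominated t := exists M r, [/\ 0 <= M, 0 <= r, r < 1 &
  forall i j, `|t i j| <= M * r ^+ (i + j)].

Lemma psumD t u n : psum (fun i j => t i j + u i j) n = psum t n + psum u n.
Proof. by rewrite /psum -big_split; apply: eq_bigr => i _; rewrite -big_split. Qed.

Lemma psumZ k t n : psum (fun i j => k * t i j) n = k * psum t n.
Proof. by rewrite /psum mulr_sumr; apply: eq_bigr => i _; rewrite mulr_sumr. Qed.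

Lemma psumB t u n : psum (fun i j => t i j - u i j) n = psum t n - psum u n.
Proof. by rewrite /psum -sumrB; apply: eq_bigr => i _; rewrite -sumrB. Qed.

Lemma psum_swap t n : psum (fun i j => t j i) n = psum t n.
Proof. exact: exchange_big. Qed.

Lemma eq_psum t u n : (forall i j, t i j = u i j) -> psum t n = psum u n.
Proof. by move=> tu; apply: eq_bigr => i _; apply: eq_bigr => j _. Qed.

Lemma ler_psum t u n : (forall i j, t i j <= u i j) -> psum t n <= psum u n.
Proof. by move=> tu; apply: ler_sum => i _; apply: ler_sum => j _. Qed.

Lemma ler_norm_psum t n : `|psum t n| <= psum (fun i j => `|t i j|) n.
Proof.
apply: (le_trans (ler_norm_sum _ _ _)); apply: ler_sum => i _.
exact: ler_norm_sum.
Qed.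

Lemma geometric_sum_le r n : 0 <= r -> r < 1 -> \sum_(i < n) r ^+ i <= (1 - r)^-1.
Proof.
move=> r0 r1; have r10 : 0 < 1 - r by rewrite subr_gt0.
rewrite -[leRHS]mul1r ler_pdivlMr//; case: n => [|n].
  by rewrite big_ord0 mul0r.
suff -> : (\sum_(i < n.+1) r ^+ i) * (1 - r) = 1 - r ^+ n.+1.
  by rewrite gerBl exprn_ge0.
elim: n => [|n IH]; first by rewrite big_ord_recr big_ord0 /= expr0 expr1; ring.
by rewrite big_ord_recr/= mulrDl IH [in RHS]exprS; ring.
Qed.

Lemma psum_geometric M r n :
  psum (fun i j => M * r ^+ (i + j)) n = M * (\sum_(i < n) r ^+ i) * (\sum_(i < n) r ^+ i).
Proof.
rewrite /psum -mulrA mulr_suml mulr_sumr; apply: eq_bigr => i _.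
rewrite mulr_sumr mulr_sumr; apply: eq_bigr => j _.
by rewrite exprD.
Qed.

Lemma dominated_bounded t : dominated t ->
  exists B, forall n, psum (fun i j => `|t i j|) n <= B.
Proof.
move=> [M [r [M0 r0 r1 tM]]]; exists (M * (1 - r)^-1 * (1 - r)^-1) => n.
apply: le_trans (ler_psum _ tM) _; rewrite psum_geometric.
have r10 : 0 <= (1 - r)^-1 by rewrite invr_ge0 subr_ge0 ltW.
have s0 : 0 <= \sum_(i < n) r ^+ i by apply: sumr_ge0 => i _; rewrite exprn_ge0.
by rewrite ler_pM// ?mulr_ge0// ?ler_wpM2l// geometric_sum_le.
Qed.

Hypothesis KS : summable_field.

Lemma cvgZ0 M r : 0 <= r -> r < 1 -> (fun n => M * r ^+ n) @ \oo --> (0 : K).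
Proof.
move=> r0 r1; rewrite -[X in _ --> X](mulr0 M).
by apply: cvgMl_tmp; exact: KS.1.
Qed.

Lemma cvg_dist0 (u v : nat -> K) (e : nat -> K) (l : K) :
  u @ \oo --> l -> (forall n, `|u n - v n| <= e n) -> e @ \oo --> (0 : K) ->
  v @ \oo --> l.
Proof.
move=> ul uv e0; apply/cvgrPdist_le => /= eps eps0.
have eps2 : 0 < eps / 2 by rewrite divr_gt0.
move/cvgrPdist_le : ul => /(_ _ eps2); move/cvgr0Pnorm_le : e0 => /(_ _ eps2).
apply: filterS2 => n en un; rewrite [eps]splitr.
have -> : l - v n = (l - u n) + (u n - v n) by ring.
rewrite (le_trans (ler_normD _ _))// lerD// (le_trans (uv n))//.
by rewrite (le_trans _ en)// real_ler_norm// ger0_real// (le_trans _ (uv n)).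
Qed.

Lemma lim_norm_le (u : nat -> K) (l B : K) : u @ \oo --> l -> (forall n, `|u n| <= B) -> `|l| <= B.
Proof.
move=> ul uB; apply/ler_addgt0Pl => e e0.
move/cvgrPdist_le : ul => /(_ _ e0)[n _ /(_ n (leqnn n)) /= un].
by rewrite -[l](subrK (u n)) (le_trans (ler_normD _ _))// lerD.
Qed.

Lemma dominated_cvg t : dominated t -> cvg (psum t @ \oo).
Proof. by move=> /dominated_bounded; exact: KS.2. Qed.

Definition unshift t i j : K := if i is i'.+1 then t i' j else 0.

(** The square sum of order [n + 1] of the shifted family exceeds that of order [n] of [t] by the
    column [j = n] alone, whose size is at most a constant times [r ^+ n]. *)
Lemma psum_unshift t (l : K) : dominated t ->
  psum t @ \oo --> l -> psum (unshift t) @ \oo --> l.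
Proof.
move=> [M [r [M0 r0 r1 tM]]] tl; rewrite -cvg_shiftS.
have r10 : 0 <= (1 - r)^-1 by rewrite invr_ge0 subr_ge0 ltW.
apply: (cvg_dist0 tl _ (cvgZ0 (M * (1 - r)^-1) r0 r1)) => n.
rewrite /= /psum big_ord_recl/= [X in _ - (X + _)]big1 ?add0r//.
rewrite -normrN opprB -sumrB; under eq_bigr do rewrite big_ord_recr/= addrAC subrr add0r.
apply: (le_trans (ler_norm_sum _ _ _)).
apply: (@le_trans _ _ (\sum_(i < n) M * r ^+ n * r ^+ i)).
  apply: ler_sum => i _; rewrite (le_trans (tM _ _))//.
  by rewrite -mulrA -exprD addnC.
by rewrite -mulr_sumr [leRHS]mulrAC ler_wpM2l ?mulr_ge0 ?exprn_ge0// geometric_sum_le.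
Qed.

Lemma sum_triangle (F : nat -> nat -> K) n :
  \sum_(p < n) \sum_(i < p.+1) F i (p - i)%N =
  \sum_(i < n) \sum_(k < n | (i + k < n)%N) F i k.
Proof.
transitivity (\sum_(i < n) \sum_(k < n - i) F i k); last first.
  apply: eq_bigr => i _; rewrite (big_ord_widen_cond n predT (F i)) ?leq_subr//.
  by apply: eq_bigl => k; rewrite /= ltn_subRL.
elim: n => [|n IH]; first by rewrite !big_ord0.
rewrite big_ord_recr/= IH [RHS]big_ord_recr/= subSnn big_ord1.
rewrite big_ord_recr/= subnn addrA; congr (_ + _).
rewrite -big_split/=; apply: eq_bigr => i _.
by rewrite subSn ?big_ord_recr// ltnW.
Qed.

Definition cauchy t u p q : K :=
  \sum_(i < p.+1) \sum_(j < q.+1) t i j * u (p - i)%N (q - j)%N.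

Lemma psum_cauchy t u n : psum (cauchy t u) n =
  \sum_(i < n) \sum_(k < n | (i + k < n)%N)
    \sum_(j < n) \sum_(l < n | (j + l < n)%N) t i j * u k l.
Proof.
rewrite /psum /cauchy; under eq_bigr do rewrite exchange_big/=.
rewrite (sum_triangle (fun i k => \sum_(q < n) \sum_(j < q.+1) t i j * u k (q - j)%N)).
apply: eq_bigr => i _; apply: eq_bigr => k _.
exact: (sum_triangle (fun j l => t i j * u k l)).
Qed.

Lemma psum_mul t u n : psum t n * psum u n =
  \sum_(i < n) \sum_(k < n) \sum_(j < n) \sum_(l < n) t i j * u k l.
Proof.
rewrite /psum mulr_suml; apply: eq_bigr => i _; rewrite mulr_sumr.
apply: eq_bigr => k _; rewrite mulr_suml; apply: eq_bigr => j _.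
by rewrite mulr_sumr.
Qed.

(** The number [(1 + r) / 2] is below [1] and its square is at least [r], by the inequality of
    arithmetic and geometric means. The decay is thus split into two factors: in [cauchy_cvg] one
    makes the discarded terms small, the other keeps them summable. *)
Lemma dominated_sqr t : dominated t -> exists M r, [/\ 0 <= M, 0 <= r, r < 1 &
  forall i j, `|t i j| <= M * (r ^+ (i + j) * r ^+ (i + j))].
Proof.
move=> [M [r [M0 r0 r1 tM]]].
have two0 : 0 < 2 :> K by [].
have q0 : 0 <= (1 + r) / 2 by rewrite divr_ge0 ?addr_ge0 // ltW.
exists M, ((1 + r) / 2); split=> //.
  by rewrite ltr_pdivrMr// mul1r -[ltRHS]/(1 + 1) ltrD2l.
have rq : r <= (1 + r) / 2 * ((1 + r) / 2).
  rewrite -subr_ge0; have -> : (1 + r) / 2 * ((1 + r) / 2) - r = ((1 - r) / 2) ^+ 2 by field.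
  by rewrite exprn_ge0// divr_ge0// subr_ge0 ltW.
move=> i j; rewrite (le_trans (tM i j))// ler_wpM2l// -exprMn.
by rewrite lerXn2r// nnegrE mulr_ge0.
Qed.

(** The product of the square sums and the square sum of the Cauchy product differ by the terms with
    [i + k >= n] or [j + l >= n]. There the total exponent is at least [n], so one factor of
    [dominated_sqr] yields [q ^+ n], and the other leaves four geometric sums, whence [C * C]. *)
Lemma cauchy_cvg t u (l m : K) : dominated t -> dominated u ->
  psum t @ \oo --> l -> psum u @ \oo --> m -> psum (cauchy t u) @ \oo --> l * m.
Proof.
move=> /dominated_sqr[M [r [M0 r0 r1 tM]]] /dominated_sqr[N [s [N0 s0 s1 uN]]] tl um.
have rsc : r >=< s by rewrite real_comparable// ger0_real.
have rs : r <= Num.max r s by rewrite comparable_le_max// lexx.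
have sr : s <= Num.max r s by rewrite comparable_le_max// lexx orbT.
set q := Num.max r s in rs sr.
have q0 : 0 <= q by exact: le_trans rs.
have q1 : q < 1 by rewrite comparable_gt_max// r1.
pose S n := \sum_(i < n) q ^+ i.
have S0 n : 0 <= S n by apply: sumr_ge0 => i _; rewrite exprn_ge0.
have S1 n : S n <= (1 - q)^-1 by exact: geometric_sum_le.
pose C := (1 - q)^-1 * (1 - q)^-1.
apply: (cvg_dist0 (cvgM tl um) _ (cvgZ0 (M * N * (C * C)) q0 q1)) => n.
rewrite [X in X - _]psum_mul psum_cauchy.
pose G i k j l := if (i + k < n)%N && (j + l < n)%N then 0 else t i j * u k l.
rewrite (_ : _ - _ = \sum_(i < n) \sum_(k < n) \sum_(j < n) \sum_(l < n) G i k j l); last first.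
  rewrite -sumrB; apply: eq_bigr => i _.
  rewrite [X in _ - X]big_mkcond -sumrB; apply: eq_bigr => k _; rewrite /G.
  case: ifPn => _ /=; last by rewrite subr0.
  rewrite -sumrB; apply: eq_bigr => j _.
  rewrite [X in _ - X]big_mkcond -sumrB; apply: eq_bigr => l' _.
  by case: ifPn => _; rewrite ?subrr ?subr0.
have GM i k j l' : `|G i k j l'| <= M * N * q ^+ n * (q ^+ i * q ^+ k * (q ^+ j * q ^+ l')).
  have rhs0 : 0 <= M * N * q ^+ n * (q ^+ i * q ^+ k * (q ^+ j * q ^+ l')).
    by rewrite !mulr_ge0 ?exprn_ge0.
  rewrite /G; case: ifPn => [_|ijkl]; first by rewrite normr0.
  have le_n : (n <= (i + j) + (k + l'))%N.
    move: ijkl; rewrite negb_and -!leqNgt => /orP[ik|jl].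
      by rewrite (leq_trans ik)// addnACA leq_addr.
    by rewrite (leq_trans jl)// addnACA leq_addl.
  have tq : `|t i j| <= M * (q ^+ (i + j) * q ^+ (i + j)).
    by rewrite (le_trans (tM i j))// ler_wpM2l// ler_pM// ?exprn_ge0// lerXn2r// nnegrE.
  have uq : `|u k l'| <= N * (q ^+ (k + l') * q ^+ (k + l')).
    by rewrite (le_trans (uN k l'))// ler_wpM2l// ler_pM// ?exprn_ge0// lerXn2r// nnegrE.
  rewrite normrM (le_trans (ler_pM _ _ tq uq))//.
  have -> : M * (q ^+ (i + j) * q ^+ (i + j)) * (N * (q ^+ (k + l') * q ^+ (k + l'))) =
      M * N * q ^+ ((i + j) + (k + l')) * (q ^+ i * q ^+ k * (q ^+ j * q ^+ l')).
    by rewrite !exprD; ring.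
  rewrite ler_wpM2r ?mulr_ge0 ?exprn_ge0// ler_wpM2l ?mulr_ge0//.
  by rewrite ler_wiXn2l// ltW.
have -> : M * N * (C * C) * q ^+ n = M * N * q ^+ n * (C * C) by ring.
apply: (@le_trans _ _ (M * N * q ^+ n * (S n * S n * (S n * S n)))); last first.
  have SC : S n * S n <= C by rewrite /C ler_pM.
  by rewrite ler_wpM2l ?mulr_ge0 ?exprn_ge0// ler_pM ?mulr_ge0.
rewrite [leRHS](_ : _ = \sum_(i < n) \sum_(k < n) \sum_(j < n) \sum_(l < n)
    M * N * q ^+ n * (q ^+ i * q ^+ k * (q ^+ j * q ^+ l))); last first.
  have -> : S n * S n = \sum_(i < n) \sum_(k < n) q ^+ i * q ^+ k.
    by rewrite /S mulr_suml; apply: eq_bigr => i _; rewrite mulr_sumr.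
  rewrite mulr_suml mulr_sumr; apply: eq_bigr => i _.
  rewrite mulr_suml mulr_sumr; apply: eq_bigr => k _.
  rewrite !mulr_sumr; apply: eq_bigr => j _.
  by rewrite !mulr_sumr.
do 4 (rewrite (le_trans (ler_norm_sum _ _ _))//; apply: ler_sum; move=> ? _).
exact: GM.
Qed.

End DoubleSums.

(** * Polydiscs around the origin *)

Section Boxes.
Context {K : numFieldType}.
Implicit Types (r s : K) (z : K * K).

Definition box r : set (K * K) := [set z | `|z.1| < r /\ `|z.2| < r].

Lemma norm_lt_open r : open [set t : K | `|t| < r].
Proof.
rewrite (_ : [set t | _] = ball (0 : K) r); first exact: ball_open.
by apply/seteqP; split => t; rewrite -ball_normE /= sub0r normrN.
Qed.

Lemma box_open r : open (box r).
Proof.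
rewrite (_ : box r = fst @^-1` [set t : K | `|t| < r] `&` snd @^-1` [set t : K | `|t| < r]) //.
by apply: openI; apply: open_comp; try exact: norm_lt_open; move=> z _; [exact: cvg_fst|exact: cvg_snd].
Qed.

Lemma box0 r : 0 < r -> box r 0.
Proof. by move=> r0; split; rewrite /= normr0. Qed.

Lemma box_le r s z : r <= s -> box r z -> box s z.
Proof. by move=> rs [z1 z2]; split; exact: lt_le_trans rs. Qed.

(** The order of [K] is only partial when [K] is the complex field, so minima of radii are taken
    among real elements. *)
Lemma real_min2 r s : 0 < r -> 0 < s -> exists2 q, 0 < q & q <= r /\ q <= s.
Proof.
move=> r0 s0; case: (real_leP (gtr0_real r0) (gtr0_real s0)) => rs.
  by exists r.
by exists s => //; split=> //; exact: ltW.
Qed.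

Lemma real_max2 r s : 0 <= r -> 0 <= s -> exists2 q, 0 <= q & [/\ r <= q, s <= q & q = r \/ q = s].
Proof.
move=> r0 s0; case: (real_leP (ger0_real r0) (ger0_real s0)) => rs.
  by exists s => //; split=> //; right.
by exists r => //; split=> //; [exact: ltW|left].
Qed.

Lemma near_boxP (P : K * K -> Prop) :
  (\forall z \near (0 : K * K), P z) <-> exists2 r, 0 < r & forall z, box r z -> P z.
Proof.
split.
  move=> [[A B] /= [nA nB] AB].
  move/nbhs_ballP: nA => [r /= r0 rA]; move/nbhs_ballP: nB => [s /= s0 sB].
  have [q q0 [qr qs]] := real_min2 r0 s0; exists q => // -[x y] [/= xq yq].
  apply: (AB (x, y)); split => /=.
    by apply: rA; rewrite -ball_normE /= sub0r normrN (lt_le_trans xq).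
  by apply: sB; rewrite -ball_normE /= sub0r normrN (lt_le_trans yq).
move=> [r r0 rP]; apply/near_openP; exists (box r); last exact: rP.
by split; [exact: box_open|exact: box0].
Qed.

Lemma box_between r z : box r z -> exists m, [/\ 0 <= m, m < r, `|z.1| <= m & `|z.2| <= m].
Proof.
move=> [z1 z2]; have [m m0 [m1 m2 mE]] := real_max2 (normr_ge0 z.1) (normr_ge0 z.2).
by exists m; split=> //; case: mE => ->.
Qed.

Lemma midpoint r s : r < s -> r < (r + s) / 2 /\ (r + s) / 2 < s.
Proof.
move=> rs; have two0 : 0 < 2 :> K by [].
by rewrite ltr_pdivlMr// ltr_pdivrMr// !mulr_natr !mulr2n ltrD2l ltrD2r.
Qed.

End Boxes.

(** * Sums, products and termwise derivatives of double power series *)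

Section PowerSeries.
Context {K : numFieldType}.
Hypothesis KS : @summable_field K.
Implicit Types (a b : nat -> nat -> K) (r s : K) (z : K * K).

(** Abel's condition: the terms are bounded on every smaller polydisc. It involves no convergence,
    and sums, products and derivatives preserve it with the same [r]. *)
Definition geo r a := forall s, 0 < s -> s < r ->
  exists M, forall i j, `|a i j| * s ^+ (i + j) <= M.

Definition term a z i j : K := a i j * z.1 ^+ i * z.2 ^+ j.

Definition ev a z : K := lim (psum (term a z) @ \oo).

Lemma evP a z (l : K) : psum (term a z) @ \oo --> l -> ev a z = l.
Proof. exact: cvg_lim. Qed.

Lemma geo_le r s a : s <= r -> geo r a -> geo s a.
Proof. by move=> sr ga q q0 qs; apply: ga => //; exact: lt_le_trans sr. Qed.

(* For [s < r] the coefficients satisfy [|a i j| <= M s^-(i+j)]. *)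
Lemma geo_bound r a m : geo r a -> 0 <= m -> m < r -> exists M q,
  [/\ 0 <= M, 0 <= q, q < 1 & forall i j, `|a i j| * m ^+ (i + j) <= M * q ^+ (i + j)].
Proof.
move=> ga m0 mr; have [ms sr] := midpoint mr.
set s := (m + r) / 2 in ms sr; have s0 : 0 < s by exact: le_lt_trans ms.
have [M aM] := ga _ s0 sr.
exists M, (m / s); split.
- by apply: le_trans (aM 0%N 0%N); rewrite mulr_ge0.
- by rewrite divr_ge0// ltW.
- by rewrite ltr_pdivrMr// mul1r.
move=> i j; rewrite expr_div_n mulrA -[leLHS](mulfK (lt0r_neq0 (exprn_gt0 (i + j) s0))).
rewrite ler_pM2r ?invr_gt0 ?exprn_gt0//.
by rewrite mulrAC ler_wpM2r ?exprn_ge0.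
Qed.

Lemma geo_dominated r a z : geo r a -> box r z -> dominated (term a z).
Proof.
move=> ga /box_between[m [m0 mr z1 z2]].
have [M [q [M0 q0 q1 aM]]] := geo_bound ga m0 mr; exists M, q; split=> // i j.
rewrite /term !normrM !normrX -mulrA (le_trans _ (aM i j))// ler_wpM2l//.
by rewrite exprD ler_pM ?exprn_ge0// lerXn2r// nnegrE.
Qed.

Lemma ev_cvg r a z : geo r a -> box r z -> psum (term a z) @ \oo --> ev a z.
Proof. by move=> ga rz; exact: (dominated_cvg KS (geo_dominated ga rz)). Qed.

Lemma geoD r k a b : geo r a -> geo r b -> geo r (fun i j => k * a i j + b i j).
Proof.
move=> ga gb s s0 sr; have [M aM] := ga _ s0 sr; have [N bN] := gb _ s0 sr.
exists (`|k| * M + N) => i j.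
have s0' : 0 <= s ^+ (i + j) by rewrite exprn_ge0// ltW.
rewrite (le_trans (ler_wpM2r s0' (ler_normD _ _)))// mulrDl lerD//.
by rewrite normrM -mulrA ler_wpM2l.
Qed.

Lemma evD r k a b z : geo r a -> geo r b -> box r z ->
  ev (fun i j => k * a i j + b i j) z = k * ev a z + ev b z.
Proof.
move=> ga gb rz; apply: evP.
rewrite (_ : psum _ = fun n => k * psum (term a z) n + psum (term b z) n); last first.
  apply/funext => n; rewrite -psumZ -psumD; apply: eq_psum => i j.
  by rewrite /term !mulrDl !mulrA.
by apply: cvgD; [apply: cvgMl_tmp; exact: ev_cvg ga rz|exact: ev_cvg gb rz].
Qed.

Definition flip_coef a i j := a j i : K.

Lemma geo_flip r a : geo r a -> geo r (flip_coef a).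
Proof.
move=> ga s s0 sr; have [M aM] := ga _ s0 sr.
by exists M => i j; rewrite addnC; exact: aM.
Qed.

Lemma ev_flip a z : ev (flip_coef a) z = ev a (z.2, z.1).
Proof.
rewrite /ev; congr (lim (_ @ \oo)); apply/funext => n.
rewrite -psum_swap; apply: eq_psum => i j.
by rewrite /term /flip_coef /= mulrAC.
Qed.

(** The factor [i] is absorbed by geometric decay: [i * q ^+ (i + j)] is at most the sum of the
    [q ^+ k] for [k < i], hence at most [(1 - q)^-1]. *)
Lemma geo_muln r a : geo r a -> geo r (fun i j => i%:R * a i j).
Proof.
move=> ga s s0 sr; have [M [q [M0 q0 q1 aM]]] := geo_bound ga (ltW s0) sr.
exists (M * (1 - q)^-1) => i j.
rewrite normrM normr_nat -mulrA (le_trans (ler_wpM2l (ler0n _ _) (aM i j)))//.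
rewrite mulrCA ler_wpM2l// (le_trans _ (geometric_sum_le i q0 q1))//.
rewrite -[i in i%:R]card_ord -sum1_card natr_sum mulr_suml ler_sum// => k _.
rewrite mul1r; apply: ler_wiXn2l => //; first exact: ltW.
by rewrite (leq_trans (ltnW (ltn_ord k)))// leq_addr.
Qed.

Definition d1 a i j : K := i.+1%:R * a i.+1 j.

Lemma geo_shift r a : 0 < r -> geo r a -> geo r (fun i j => a i.+1 j).
Proof.
move=> r0 ga s s0 sr; have [M aM] := ga _ s0 sr.
exists (M / s) => i j; rewrite ler_pdivlMr// -mulrA -exprSr -addSn.
exact: aM.
Qed.

Lemma geo_d1 r a : 0 < r -> geo r a -> geo r (d1 a).
Proof. by move=> r0 ga; exact: (geo_shift r0 (geo_muln ga)). Qed.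

Lemma geo_cauchy r a b : geo r a -> geo r b -> geo r (cauchy a b).
Proof.
move=> ga gb s s0 sr.
have [M [p [M0 p0 p1 aM]]] := geo_bound ga (ltW s0) sr.
have [N [q [N0 q0 q1 bN]]] := geo_bound gb (ltW s0) sr.
have p10 : 0 <= (1 - p)^-1 by rewrite invr_ge0 subr_ge0 ltW.
exists (M * N * ((1 - p)^-1 * (1 - p)^-1)) => k l; rewrite /cauchy.
apply: (@le_trans _ _ (\sum_(i < k.+1) \sum_(j < l.+1) M * N * (p ^+ i * p ^+ j))); last first.
  have -> : \sum_(i < k.+1) \sum_(j < l.+1) M * N * (p ^+ i * p ^+ j) =
      M * N * ((\sum_(i < k.+1) p ^+ i) * (\sum_(j < l.+1) p ^+ j)).
    rewrite mulr_suml mulr_sumr; apply: eq_bigr => i _.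
    by rewrite !mulr_sumr.
  rewrite ler_wpM2l ?mulr_ge0// ler_pM ?geometric_sum_le// sumr_ge0// => i _;
  by rewrite exprn_ge0.
rewrite -[s ^+ _]ger0_norm ?exprn_ge0 ?(ltW s0)// -normrM mulr_suml.
apply: (le_trans (ler_norm_sum _ _ _)); apply: ler_sum => i _; rewrite mulr_suml.
apply: (le_trans (ler_norm_sum _ _ _)); apply: ler_sum => j _.
have -> : s ^+ (k + l) = s ^+ (i + j) * s ^+ ((k - i) + (l - j)).
  by rewrite -exprD addnACA !subnKC// -ltnS.
rewrite !normrM !normrX (ger0_norm (ltW s0)) mulrACA.
have se0 e : 0 <= s ^+ e by rewrite exprn_ge0// ltW.
apply: (le_trans (ler_pM _ _ (aM i j) (bN _ _))); rewrite ?mulr_ge0//.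
rewrite mulrACA -[leRHS]mulr1 -exprD -[leRHS]mulrA ler_wpM2l ?mulr_ge0//.
by rewrite ler_wpM2l ?exprn_ge0// exprn_ile1// ltW.
Qed.

Lemma ev_mul r a b z : geo r a -> geo r b -> box r z ->
  ev (cauchy a b) z = ev a z * ev b z.
Proof.
move=> ga gb rz; apply: evP.
rewrite (_ : psum _ = psum (cauchy (term a z) (term b z))).
  exact: (cauchy_cvg KS (geo_dominated ga rz) (geo_dominated gb rz) (ev_cvg ga rz) (ev_cvg gb rz)).
apply/funext => n; apply: eq_psum => p q; rewrite /term /cauchy -mulrA mulr_suml.
apply: eq_bigr => i _; rewrite mulr_suml; apply: eq_bigr => j _.
have -> : z.1 ^+ p = z.1 ^+ i * z.1 ^+ (p - i) by rewrite -exprD subnKC// -ltnS.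
have -> : z.2 ^+ q = z.2 ^+ j * z.2 ^+ (q - j) by rewrite -exprD subnKC// -ltnS.
ring.
Qed.

Lemma term_d1_cvg r a z : 0 < r -> geo r a -> box r z ->
  psum (fun i j => a i j * (i%:R * z.1 ^+ i.-1) * z.2 ^+ j) @ \oo --> ev (d1 a) z.
Proof.
move=> r0 ga rz; have gd := geo_d1 r0 ga.
rewrite (_ : psum _ = psum (unshift (term (d1 a) z))).
  exact: (psum_unshift KS (geo_dominated gd rz) (ev_cvg gd rz)).
apply/funext => n; apply: eq_psum => -[|i] j /=; first by rewrite mul0r mulr0 mul0r.
by rewrite /term /d1; ring.
Qed.

Lemma ev_euler r a z : 0 < r -> geo r a -> box r z ->
  z.1 * ev (d1 a) z = ev (fun i j => i%:R * a i j) z.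
Proof.
move=> r0 ga rz; apply/esym/evP.
rewrite (_ : psum _ = fun n =>
    z.1 * psum (fun i j => a i j * (i%:R * z.1 ^+ i.-1) * z.2 ^+ j) n).
  by apply: cvgMl_tmp; exact: (term_d1_cvg r0 ga rz).
apply/funext => n; rewrite -psumZ; apply: eq_psum => -[|i] j; rewrite /term /=.
  by rewrite !mul0r mulr0 mul0r mulr0.
by rewrite exprS; ring.
Qed.

(** The remainders satisfy [R (i + 1) = (x + h) * R i + h ^+ 2 * (i * x ^+ (i - 1))], and
    [i ^ 2 + i <= (i + 1) ^ 2] closes the induction. The factor [q ^+ 2] on the left avoids the
    exponent [i - 2]. *)
Lemma taylor_term (x h q : K) i : `|x| + `|h| <= q ->
  `|(x + h) ^+ i - x ^+ i - h * (i%:R * x ^+ i.-1)| * q ^+ 2 <=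
  `|h| ^+ 2 * (i%:R * (i%:R * q ^+ i)).
Proof.
move=> xhq; have q0 : 0 <= q by apply: le_trans xhq; rewrite addr_ge0.
have xq : `|x| <= q by apply: le_trans xhq; rewrite lerDl.
elim: i => [|i IH].
  by rewrite !expr0 subrr !mul0r mulr0 subrr normr0 mul0r mulr0.
have -> : (x + h) ^+ i.+1 - x ^+ i.+1 - h * (i.+1%:R * x ^+ i.+1.-1) =
    (x + h) * ((x + h) ^+ i - x ^+ i - h * (i%:R * x ^+ i.-1)) +
    h ^+ 2 * (i%:R * x ^+ i.-1).
  case: i {IH} => [|i]; rewrite /= -?[in i.+2%:R]natr1 !exprS ?expr0; ring.
apply: (@le_trans _ _ (q * (`|h| ^+ 2 * (i%:R * (i%:R * q ^+ i))) +
    `|h| ^+ 2 * (i%:R * q ^+ i.+1))).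
  rewrite (le_trans (ler_wpM2r (exprn_ge0 _ q0) (ler_normD _ _)))// mulrDl lerD//.
    rewrite normrM -mulrA ler_pM ?mulr_ge0 ?exprn_ge0//.
    exact: le_trans (ler_normD _ _) xhq.
  have -> : `|h ^+ 2 * (i%:R * x ^+ i.-1)| * q ^+ 2 =
      `|h| ^+ 2 * (i%:R * (`|x| ^+ i.-1 * q ^+ 2)).
    by rewrite normrM normrX normrM normr_nat normrX; ring.
  apply: ler_wpM2l; first exact: exprn_ge0.
  case: i {IH} => [|i]; first by rewrite !mul0r.
  apply: ler_wpM2l => //; rewrite -[i.+2]addn2 exprD; apply: ler_wpM2r; first exact: exprn_ge0.
  by rewrite lerXn2r// nnegrE.
rewrite -[i.+1%:R]natr1 -subr_ge0 [q ^+ i.+1]exprS.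
have -> : `|h| ^+ 2 * ((i%:R + 1) * ((i%:R + 1) * (q * q ^+ i))) -
   (q * (`|h| ^+ 2 * (i%:R * (i%:R * q ^+ i))) + `|h| ^+ 2 * (i%:R * (q * q ^+ i))) =
   `|h| ^+ 2 * ((i%:R + 1) * (q * q ^+ i)) by ring.
by rewrite !mulr_ge0 ?exprn_ge0 ?addr_ge0.
Qed.

(** A quadratic remainder, uniform on a smaller closed polydisc, yields at once differentiability,
    the value of the derivative and, later, Lipschitz bounds. The constant is the sum of
    [i ^ 2 |a i j| q ^+ (i + j)] divided by [q ^+ 2], for [q] halfway between [m] and [r]. *)
Lemma ev_taylor r a m : geo r a -> 0 <= m -> m < r -> exists C e, [/\ 0 <= C, 0 < e &
  forall x y h, `|x| <= m -> `|y| <= m -> `|h| <= e ->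
  `|ev a (x + h, y) - ev a (x, y) - h * ev (d1 a) (x, y)| <= C * `|h| ^+ 2].
Proof.
move=> ga m0 mr; have [mq qr] := midpoint mr.
set q := (m + r) / 2 in mq qr; have q0 : 0 < q by exact: le_lt_trans mq.
have r0 : 0 < r by exact: lt_trans qr.
have [M [s [M0 s0 s1 aM]]] := geo_bound (geo_muln (geo_muln ga)) (ltW q0) qr.
have [B BM] : exists B, forall n,
    psum (fun i j => `|i%:R * (i%:R * a i j) * q ^+ (i + j)|) n <= B.
  apply: dominated_bounded; exists M, s; split=> // i j.
  by rewrite normrM (ger0_norm (exprn_ge0 _ (ltW q0))).
have B0 : 0 <= B by apply: le_trans (BM 0%N); rewrite /psum big_ord0.
exists (B / q ^+ 2), (q - m); split.
- by rewrite divr_ge0// exprn_ge0// ltW.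
- by rewrite subr_gt0.
move=> x y h xm ym hq.
have xhq : `|x| + `|h| <= q by rewrite -[q](subrKC m) lerD.
have rxh : box r (x + h, y).
  split=> /=; last exact: le_lt_trans mr.
  by rewrite (le_lt_trans (ler_normD _ _))// (le_lt_trans xhq).
have rx : box r (x, y) by split=> /=; exact: le_lt_trans mr.
have yq : `|y| <= q by rewrite (le_trans ym)// ltW.
apply: (@lim_norm_le _ (psum (fun i j =>
    a i j * ((x + h) ^+ i - x ^+ i - h * (i%:R * x ^+ i.-1)) * y ^+ j))).
  rewrite (_ : psum _ = fun n => psum (term a (x + h, y)) n - psum (term a (x, y)) n -
      h * psum (fun i j => a i j * (i%:R * x ^+ i.-1) * y ^+ j) n).
    apply: cvgB; first by apply: cvgB; [exact: ev_cvg ga rxh|exact: ev_cvg ga rx].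
    by apply: cvgMl_tmp; exact: (term_d1_cvg r0 ga rx).
  apply/funext => n; rewrite -psumZ -!psumB; apply: eq_psum => i j.
  by rewrite /term /=; ring.
move=> n; apply: (le_trans (ler_norm_psum _ _)).
apply: (@le_trans _ _ (`|h| ^+ 2 / q ^+ 2 *
    psum (fun i j => `|i%:R * (i%:R * a i j) * q ^+ (i + j)|) n)); last first.
  rewrite [leRHS]mulrC [B / _]mulrC mulrA; apply: ler_wpM2l => //.
  by rewrite divr_ge0// exprn_ge0// ltW.
rewrite -psumZ; apply: ler_psum => i j.
rewrite [leRHS]mulrAC ler_pdivlMr ?exprn_gt0//.
rewrite !normrM !normrX !normr_nat (ger0_norm (ltW q0)).
have -> : `|h| ^+ 2 * (i%:R * (i%:R * `|a i j|) * q ^+ (i + j)) =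
   `|a i j| * (`|h| ^+ 2 * (i%:R * (i%:R * q ^+ i))) * q ^+ j by rewrite exprD; ring.
rewrite mulrAC -[X in X * _ <= _]mulrA; apply: ler_pM.
- by rewrite mulr_ge0// mulr_ge0// exprn_ge0// ltW.
- by rewrite exprn_ge0.
- by rewrite ler_wpM2l// taylor_term.
- by apply: lerXn2r yq; rewrite nnegrE// ltW.
Qed.

End PowerSeries.

(** * Smooth functions on boxes *)

Section SmoothOn.
Context {K : numFieldType}.
Implicit Types (f g : K * K -> K) (U : set (K * K)).

Lemma derive1_idfun (t : K) : derive1 (fun s : K => s) t = 1.
Proof. by rewrite derive1E derive_id. Qed.

Definition regular_at f (z : K * K) := [/\ {for z, continuous f},
  derivable (fun t : K => f (t, z.2)) z.1 1 & derivable (fun t : K => f (z.1, t)) z.2 1].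

Definition smooth_on U f := forall z, U z -> forall w, regular_at (iter_partial w f) z.

Lemma smooth_boxP f : smooth f <-> exists2 r, 0 < r & smooth_on (box r) f.
Proof. exact: near_boxP. Qed.

Lemma smooth_on_sub U (V : set (K * K)) f : V `<=` U -> smooth_on U f -> smooth_on V f.
Proof. by move=> VU sf z /VU; exact: sf. Qed.

Lemma iter_partial_rcons w b f :
  iter_partial (rcons w b) f = iter_partial w (if b then dx f else dy f).
Proof. by rewrite /iter_partial foldr_rcons. Qed.

Lemma smooth_on_dx U f : smooth_on U f -> smooth_on U (dx f).
Proof. by move=> sf z Uz w; have := sf z Uz (rcons w true); rewrite iter_partial_rcons. Qed.

Lemma smooth_on_dy U f : smooth_on U f -> smooth_on U (dy f).
Proof. by move=> sf z Uz w; have := sf z Uz (rcons w false); rewrite iter_partial_rcons. Qed.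

Lemma smooth_on_regular U f z : smooth_on U f -> U z -> regular_at f z.
Proof. by move=> sf Uz; exact: sf z Uz [::]. Qed.

Lemma regular_at_eq U f g z : open U -> {in U, f =1 g} -> U z -> regular_at g z -> regular_at f z.
Proof.
move=> oU fg Uz [cg gx gy]; have [nx ny] := near_section oU fg Uz.
have nz : \forall y \near z, f y = g y.
  apply: filterS (open_nbhs_nbhs (conj oU Uz)) => y Uy.
  by apply: fg; rewrite inE.
split.
- rewrite /prop_for /continuous_at (nbhs_singleton nz).
  apply: cvg_trans cg; apply: near_eq_cvg.
  by apply: filterS nz => t ->.
- by apply: (near_eq_derivable _ gx); apply: filterS nx => t ->.
- by apply: (near_eq_derivable _ gy); apply: filterS ny => t ->.
Qed.

(** A coinduction principle: a family of regular functions stable, up to equality on [U], under both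
    partial derivatives consists of smooth functions. It dispenses with formulas for higher
    derivatives of products, inverses, series and integrals. *)
Lemma smooth_on_coind U (P : (K * K -> K) -> Prop) : open U ->
  (forall g, P g -> [/\ (forall z, U z -> regular_at g z),
     (exists2 h, P h & {in U, dx g =1 h}) & (exists2 h, P h & {in U, dy g =1 h})]) ->
  forall g, P g -> smooth_on U g.
Proof.
move=> oU Pstep g Pg.
have it w : exists2 h, P h & {in U, iter_partial w g =1 h}.
  elim: w => [|b w [h Ph wh]]; first by exists g.
  have [_ [hx Phx hxE] [hy Phy hyE]] := Pstep _ Ph.
  case: b => /=.
    by exists hx => // z Uz; rewrite (eq_dx oU wh Uz) hxE.
  by exists hy => // z Uz; rewrite (eq_dy oU wh Uz) hyE.
move=> z Uz w; have [h Ph wh] := it w.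
have [rh _ _] := Pstep _ Ph.
by apply: (regular_at_eq oU wh Uz); exact: rh.
Qed.

(** The family to which [smooth_on_coind] is applied: the derivative of a sum, product or inverse is
    again built from members of the class. *)
Inductive smooth_closure U : (K * K -> K) -> Prop :=
| SmoothBase f : smooth_on U f -> smooth_closure U f
| SmoothCst k : smooth_closure U (fun _ => k)
| SmoothX : smooth_closure U (fun z => z.1)
| SmoothY : smooth_closure U (fun z => z.2)
| SmoothAdd f g : smooth_closure U f -> smooth_closure U g ->
    smooth_closure U (fun z => f z + g z)
| SmoothMul f g : smooth_closure U f -> smooth_closure U g ->
    smooth_closure U (fun z => f z * g z)
| SmoothInv f : smooth_closure U f -> (forall z, U z -> f z != 0) ->
    smooth_closure U (fun z => (f z)^-1).

Lemma smooth_closureP U f : open U -> smooth_closure U f -> smooth_on U f.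
Proof.
move=> oU; apply: (smooth_on_coind oU) => {}f.
elim=> {f} [f sf|k|||f g cf [rf [fx cfx fxE] [fy cfy fyE]] cg [rg [gx cgx gxE] [gy cgy gyE]]
  |f g cf [rf [fx cfx fxE] [fy cfy fyE]] cg [rg [gx cgx gxE] [gy cgy gyE]]
  |f cf [rf [fx cfx fxE] [fy cfy fyE]] f0].
- split; first by move=> z; exact: smooth_on_regular.
    by exists (dx f) => //; apply/SmoothBase/smooth_on_dx.
  by exists (dy f) => //; apply/SmoothBase/smooth_on_dy.
- split; first by move=> z _; split; [exact: cvg_cst|exact: derivable_cst|exact: derivable_cst].
    by exists (fun=> 0); [exact: SmoothCst|move=> z _; rewrite /dx derive1E derive_cst].
  by exists (fun=> 0); [exact: SmoothCst|move=> z _; rewrite /dy derive1E derive_cst].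
- split; first by move=> z _; split; [exact: cvg_fst|exact: derivable_id|exact: derivable_cst].
    by exists (fun=> 1); [exact: SmoothCst|move=> z _; exact: derive1_idfun].
  by exists (fun=> 0); [exact: SmoothCst|move=> z _; rewrite /dy derive1E derive_cst].
- split; first by move=> z _; split; [exact: cvg_snd|exact: derivable_cst|exact: derivable_id].
    by exists (fun=> 0); [exact: SmoothCst|move=> z _; rewrite /dx derive1E derive_cst].
  by exists (fun=> 1); [exact: SmoothCst|move=> z _; exact: derive1_idfun].
- split.
  + move=> z Uz; have [cf' dfx dfy] := rf z Uz; have [cg' dgx dgy] := rg z Uz.
    by split; [exact: cvgD|exact: derivableD dfx dgx|exact: derivableD dfy dgy].
  + exists (fun z => fx z + gx z); first exact: SmoothAdd.
    move=> z Uz; have := Uz; rewrite inE => Uz'.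
    have [_ dfx _] := rf z Uz'; have [_ dgx _] := rg z Uz'.
    rewrite -(fxE z Uz) -(gxE z Uz) /dx !derive1E; exact: deriveD dfx dgx.
  + exists (fun z => fy z + gy z); first exact: SmoothAdd.
    move=> z Uz; have := Uz; rewrite inE => Uz'.
    have [_ _ dfx] := rf z Uz'; have [_ _ dgx] := rg z Uz'.
    rewrite -(fyE z Uz) -(gyE z Uz) /dy !derive1E; exact: deriveD dfx dgx.
- split.
  + move=> z Uz; have [cf' dfx dfy] := rf z Uz; have [cg' dgx dgy] := rg z Uz.
    by split; [exact: cvgM|exact: derivableM dfx dgx|exact: derivableM dfy dgy].
  + exists (fun z => f z * gx z + g z * fx z).
      by apply: SmoothAdd; exact: SmoothMul.
    move=> [x y] Uz; have := Uz; rewrite inE => Uz'.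
    have [_ dfx _] := rf _ Uz'; have [_ dgx _] := rg _ Uz'.
    rewrite -(fxE _ Uz) -(gxE _ Uz) /dx !derive1E; exact: deriveM dfx dgx.
  + exists (fun z => f z * gy z + g z * fy z).
      by apply: SmoothAdd; exact: SmoothMul.
    move=> [x y] Uz; have := Uz; rewrite inE => Uz'.
    have [_ _ dfx] := rf _ Uz'; have [_ _ dgx] := rg _ Uz'.
    rewrite -(fyE _ Uz) -(gyE _ Uz) /dy !derive1E; exact: deriveM dfx dgx.
- split.
  + move=> [x y] Uz; have [cf' dfx dfy] := rf _ Uz; have fz := f0 _ Uz.
    by split; [exact: cvgV|exact: derivableV fz dfx|exact: derivableV fz dfy].
  + exists (fun z => (-1) * ((f z)^-1 * (f z)^-1) * fx z).
      by do !apply: SmoothMul => //; [exact: SmoothCst|exact: SmoothInv|exact: SmoothInv].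
    move=> [x y] Uz; have := Uz; rewrite inE => Uz'.
    have [_ dfx _] := rf _ Uz'; have fz := f0 _ Uz'.
    rewrite -(fxE _ Uz) /dx !derive1E; apply: (etrans (deriveV fz dfx)).
    by rewrite /GRing.scale /= expr2 invfM mulN1r.
  + exists (fun z => (-1) * ((f z)^-1 * (f z)^-1) * fy z).
      by do !apply: SmoothMul => //; [exact: SmoothCst|exact: SmoothInv|exact: SmoothInv].
    move=> [x y] Uz; have := Uz; rewrite inE => Uz'.
    have [_ _ dfx] := rf _ Uz'; have fz := f0 _ Uz'.
    rewrite -(fyE _ Uz) /dy !derive1E; apply: (etrans (deriveV fz dfx)).
    by rewrite /GRing.scale /= expr2 invfM mulN1r.
Qed.

End SmoothOn.

(** * Analytic germs *)

Section QuadraticDerivative.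
Context {K : numFieldType}.

Lemma derive1_quadratic (f : K -> K) (x l C e : K) : 0 <= C -> 0 < e ->
  (forall h, `|h| <= e -> `|f (x + h) - f x - h * l| <= C * `|h| ^+ 2) ->
  derivable f x 1 /\ derive1 f x = l.
Proof.
move=> C0 e0 fl.
have lim_l : (fun h : K => h^-1 *: (f (h *: 1 + x) - f x)) @ 0^' --> l.
  apply/cvgrPdist_le => eps eps0.
  (* [C + 1] instead of [C], which may be zero. *)
  have d0 : 0 < eps / (C + 1) by rewrite divr_gt0// ltr_wpDl.
  have [d dgt0 [de dC]] := real_min2 e0 d0.
  apply/nbhs_ballP; exists d => //= h; rewrite -ball_normE /= sub0r normrN => hd hn0.
  have {}hd := ltW hd.
  have -> : l - h^-1 *: (f (h *: 1 + x) - f x) = - (h^-1 * (f (x + h) - f x - h * l)).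
    by rewrite /GRing.scale /= mulr1 [h + x]addrC; field.
  rewrite normrN normrM normfV ler_pdivrMl ?normr_gt0//.
  rewrite (le_trans (fl h (le_trans hd de)))// mulrC expr2 -mulrA ler_wpM2l//.
  apply: (@le_trans _ _ (eps / (C + 1) * (C + 1))); last first.
    by rewrite divfK// lt0r_neq0// ltr_wpDl.
  by apply: ler_pM => //; [exact: le_trans hd dC|rewrite lerDl].
split; first by apply/cvg_ex; exists l.
by rewrite derive1E; exact: (cvg_lim (@norm_hausdorff _ _) lim_l).
Qed.

End QuadraticDerivative.

Section PowerSeriesGerms.
Context {K : numFieldType}.
Hypothesis KS : @summable_field K.
Implicit Types (a b : nat -> nat -> K) (r s : K) (z : K * K).

Lemma ev_dx r a z : 0 < r -> geo r a -> box r z ->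
  derivable (fun t => ev a (t, z.2)) z.1 1 /\ dx (ev a) z = ev (d1 a) z.
Proof.
move=> r0 ga /box_between[m [m0 mr z1 z2]].
have [C [e [C0 e0 aC]]] := ev_taylor KS ga m0 mr.
apply: (@derive1_quadratic K (fun t => ev a (t, z.2)) z.1 (ev (d1 a) z) C e C0 e0).
by move=> h he; have := aC z.1 z.2 h z1 z2 he; rewrite -surjective_pairing.
Qed.

Definition d2 a := flip_coef (d1 (flip_coef a)).

Lemma geo_d2 r a : 0 < r -> geo r a -> geo r (d2 a).
Proof. by move=> r0 ga; apply/geo_flip/geo_d1/geo_flip. Qed.

Lemma ev_dy r a z : 0 < r -> geo r a -> box r z ->
  derivable (fun t => ev a (z.1, t)) z.2 1 /\ dy (ev a) z = ev (d2 a) z.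
Proof.
move=> r0 ga [z1 z2].
have [] := @ev_dx r (flip_coef a) (z.2, z.1) r0 (geo_flip ga) (conj z2 z1).
rewrite /dx /= (_ : (fun t => _) = fun t => ev a (z.1, t)); last first.
  by apply/funext => t; rewrite ev_flip.
by move=> dz E; split=> //; rewrite /dy E /d2 ev_flip.
Qed.

Lemma ev_bound r a m : geo r a -> 0 <= m -> m < r ->
  exists2 B, 0 <= B & forall z, `|z.1| <= m -> `|z.2| <= m -> `|ev a z| <= B.
Proof.
move=> ga m0 mr; have [M [q [M0 q0 q1 aM]]] := geo_bound ga m0 mr.
have [B BM] : exists B, forall n, psum (fun i j => `|M * q ^+ (i + j)|) n <= B.
  apply: dominated_bounded; exists M, q; split=> // i j.
  by rewrite ger0_norm// mulr_ge0// exprn_ge0.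
exists B; first by apply: le_trans (BM 0%N); rewrite /psum big_ord0.
move=> z z1 z2; have rz : box r z by split; exact: le_lt_trans mr.
apply: (@lim_norm_le _ _ _ _ (ev_cvg KS ga rz)) => n.
apply: (le_trans (ler_norm_psum _ _)); apply: le_trans (BM n); apply: ler_psum => i j.
rewrite [leRHS]ger0_norm ?mulr_ge0 ?exprn_ge0//; apply: le_trans (aM i j).
rewrite /term !normrM !normrX -mulrA exprD; apply: ler_wpM2l => //.
by apply: ler_pM; rewrite ?exprn_ge0//; apply: lerXn2r; rewrite ?nnegrE.
Qed.

Lemma ev_lipschitz r a m : 0 < r -> geo r a -> 0 <= m -> m < r -> exists L e,
  [/\ 0 <= L, 0 < e & forall x x' y, `|x| <= m -> `|y| <= m -> `|x' - x| <= e ->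
  `|ev a (x', y) - ev a (x, y)| <= L * `|x' - x|].
Proof.
move=> r0 ga m0 mr; have [C [e [C0 e0 aC]]] := ev_taylor KS ga m0 mr.
have [B B0 dB] := ev_bound (geo_d1 r0 ga) m0 mr.
exists (C * e + B), e; split=> //; first by rewrite addr_ge0// mulr_ge0// ltW.
move=> x x' y xm ym he; have := aC x y (x' - x) xm ym he; rewrite subrKC => E.
have -> : ev a (x', y) - ev a (x, y) = (ev a (x', y) - ev a (x, y) - (x' - x) * ev (d1 a) (x, y))
   + (x' - x) * ev (d1 a) (x, y) by ring.
rewrite (le_trans (ler_normD _ _))// [leRHS]mulrDl lerD//.
  by rewrite (le_trans E)// expr2 mulrA; apply: ler_wpM2r => //; apply: ler_wpM2l.
by rewrite normrM mulrC; apply: ler_wpM2r => //; apply: dB.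
Qed.

(** Lipschitz bounds in each variable, uniform in the other, are chained through the intermediate
    point [(x', y)]. The radius [m] lies strictly beyond both coordinates of [z], which leaves room
    for the nearby points. *)
Lemma ev_continuous r a z : 0 < r -> geo r a -> box r z -> {for z, continuous (ev a)}.
Proof.
move=> r0 ga /box_between[m0 [m00 m0r z1 z2]].
have [m0m mr] := midpoint m0r; set m := (m0 + r) / 2 in m0m mr.
have mge0 : 0 <= m by rewrite (le_trans m00)// ltW.
have [L [e [L0 e0 aL]]] := ev_lipschitz r0 ga mge0 mr.
have [L' [e' [L0' e0' aL']]] := ev_lipschitz r0 (geo_flip ga) mge0 mr.
apply/cvgrPdist_le => /= eps eps0.
have d0 : 0 < eps / (L + L' + 1) by rewrite divr_gt0// ltr_wpDl// addr_ge0.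
have mm : 0 < m - m0 by rewrite subr_gt0.
have [d1 d1p [d1a d1b]] := real_min2 e0 e0'.
have [d2 d2p [d2a d2b]] := real_min2 d1p d0.
have [d dp [da db]] := real_min2 d2p mm.
case: z z1 z2 => x y /= z1 z2.
exists (ball x d, ball y d); first by split; exact: nbhsx_ballx.
move=> [x' y'] []; rewrite -!ball_normE /= => xd yd.
have xe : `|x - x'| <= d by exact: ltW.
have ye : `|y - y'| <= d by exact: ltW.
have ym : `|y'| <= m.
  rewrite -[y'](subKr y) (le_trans (ler_normB _ _))// -[m](subrKC m0) lerD//.
  exact: le_trans ye db.
have xm : `|x'| <= m.
  rewrite -[x'](subKr x) (le_trans (ler_normB _ _))// -[m](subrKC m0) lerD//.
  exact: le_trans xe db.
have dd1 : d <= d1 by exact: le_trans d2a.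
have E1 : `|ev a (x, y) - ev a (x', y)| <= L * d.
  apply: le_trans (aL x' x y xm (le_trans z2 (ltW m0m)) _) _.
    by rewrite (le_trans xe)// (le_trans dd1).
  exact: ler_wpM2l.
have E2 : `|ev a (x', y) - ev a (x', y')| <= L' * d.
  have := aL' y' y x' ym xm; rewrite (ev_flip a (y, x')) (ev_flip a (y', x')) /=.
  move=> /(_ (le_trans ye (le_trans dd1 d1b))).
  by move=> /le_trans; apply; exact: ler_wpM2l.
have -> : ev a (x, y) - ev a (x', y') =
    (ev a (x, y) - ev a (x', y)) + (ev a (x', y) - ev a (x', y')) by ring.
apply: le_trans (ler_normD _ _) _.
apply: le_trans (lerD E1 E2) _; rewrite -mulrDl.
have LL : 0 <= L + L' by exact: addr_ge0.
apply: (@le_trans _ _ ((L + L' + 1) * (eps / (L + L' + 1)))); last first.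
  by rewrite mulrC divfK// lt0r_neq0// ltr_wpDl.
apply: ler_pM => //; first exact: ltW.
  by rewrite lerDl.
exact: le_trans da d2b.
Qed.

Lemma ev_smooth r a : 0 < r -> geo r a -> smooth (ev a).
Proof.
move=> r0 ga; apply/smooth_boxP; exists r => //.
apply: (smooth_on_coind (P := fun g => exists2 b, geo r b & g = ev b)).
- exact: box_open.
- move=> _ [b gb ->]; split.
  + move=> z rz; split; first exact: ev_continuous gb rz.
      exact: (ev_dx r0 gb rz).1.
    exact: (ev_dy r0 gb rz).1.
  + exists (ev (d1 b)); first by exists (d1 b) => //; exact: geo_d1.
    by move=> z /[!inE] rz; exact: (ev_dx r0 gb rz).2.
  + exists (ev (d2 b)); first by exists (d2 b) => //; exact: geo_d2.
    by move=> z /[!inE] rz; exact: (ev_dy r0 gb rz).2.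
by exists a.
Qed.

Definition delta (k l i j : nat) : K := ((i == k) && (j == l))%:R.

Lemma geo_delta k l r : geo r (delta k l).
Proof.
move=> s s0 sr; exists (s ^+ (k + l)) => i j; rewrite /delta.
case: andP => [[/eqP -> /eqP ->]|_]; first by rewrite normr1 mul1r.
by rewrite normr0 mul0r exprn_ge0// ltW.
Qed.

Lemma ev_delta k l z : ev (delta k l) z = z.1 ^+ k * z.2 ^+ l.
Proof.
apply: evP; apply: cvg_near_cst.
exists (k + l).+1 => // n /= kln.
have kn : (k < n)%N by rewrite (leq_trans _ kln)// ltnS leq_addr.
have ln : (l < n)%N by rewrite (leq_trans _ kln)// ltnS leq_addl.
rewrite /psum (bigD1 (Ordinal kn))//= [X in _ + X]big1 ?addr0; last first.
  move=> i ik; rewrite big1// => j _; rewrite /term /delta.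
  by rewrite -val_eqE /= in ik; rewrite (negPf ik) !mul0r.
rewrite (bigD1 (Ordinal ln))//= [X in _ + X]big1 ?addr0; last first.
  move=> j jl; rewrite /term /delta.
  by rewrite -val_eqE /= in jl; rewrite (negPf jl) andbF !mul0r.
by rewrite /term /delta !eqxx mul1r.
Qed.

Lemma geoZ r k a : geo r a -> geo r (fun i j => k * a i j).
Proof.
move=> ga s s0 sr; have [M aM] := ga _ s0 sr; exists (`|k| * M) => i j.
by rewrite normrM -mulrA ler_wpM2l.
Qed.

Lemma evZ r k a z : geo r a -> box r z -> ev (fun i j => k * a i j) z = k * ev a z.
Proof.
move=> ga rz; apply: evP.
rewrite (_ : psum _ = fun n => k * psum (term a z) n).
  by apply: cvgMl_tmp; exact: ev_cvg ga rz.
by apply/funext => n; rewrite -psumZ; apply: eq_psum => i j; rewrite /term !mulrA.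
Qed.

Lemma ev_at0 r a : 0 < r -> geo r a -> ev a 0 = a 0%N 0%N.
Proof.
move=> r0 ga; apply: evP; rewrite -cvg_shiftS; apply: cvg_near_cst.
apply: nearW => n /=; rewrite /psum big_ord_recl [X in _ + X]big1 ?addr0; last first.
  by move=> i _; rewrite big1// => j _; rewrite /term /= expr0n mulr0 mul0r.
rewrite big_ord_recl [X in _ + X]big1 ?addr0; last first.
  by move=> j _; rewrite /term /= [X in _ * X]expr0n mulr0.
by rewrite /term /= !expr0 !mulr1.
Qed.

(** The coefficient at [(0, 0)] is the value at the origin. The other coefficients reduce to it
    through derivatives, which also vanish on the box and whose coefficients are nonzero integer
    multiples of those of [a]. *)
Lemma ev_inj r a : 0 < r -> geo r a -> {in box r, ev a =1 cst 0} -> forall i j, a i j = 0.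
Proof.
move=> r0; have o := @box_open _ r.
have step b : geo r b -> {in box r, ev b =1 cst 0} ->
    {in box r, ev (d1 b) =1 cst 0} /\ {in box r, ev (d2 b) =1 cst 0}.
  move=> gb b0; split=> z rz.
    have := eq_dx o b0 rz; rewrite inE in rz; rewrite (ev_dx r0 gb rz).2 => ->.
    by rewrite /dx derive1E derive_cst.
  have := eq_dy o b0 rz; rewrite inE in rz; rewrite (ev_dy r0 gb rz).2 => ->.
  by rewrite /dy derive1E derive_cst.
move=> ga a0 i; elim: i a ga a0 => [|i IHi] a ga a0 j; last first.
  have /eqP := IHi _ (geo_d1 r0 ga) (step _ ga a0).1 j.
  by rewrite /d1 mulf_eq0 pnatr_eq0/= => /eqP.
elim: j a ga a0 => [|j IHj] a ga a0.
  by rewrite -(ev_at0 r0 ga) a0// inE; exact: box0.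
have /eqP := IHj _ (geo_d2 r0 ga) (step _ ga a0).2.
by rewrite /d2 /d1 /flip_coef mulf_eq0 pnatr_eq0/= => /eqP.
Qed.

Lemma ev_eulerx r a z : 0 < r -> geo r a -> box r z ->
  z.1 * dx (ev a) z = ev (fun i j => i%:R * a i j) z.
Proof. by move=> r0 ga rz; rewrite (ev_dx r0 ga rz).2 (ev_euler KS r0 ga rz). Qed.

Lemma ev_eulery r a z : 0 < r -> geo r a -> box r z ->
  z.2 * dy (ev a) z = ev (fun i j => j%:R * a i j) z.
Proof.
move=> r0 ga rz; rewrite (ev_dy r0 ga rz).2 /d2 ev_flip.
have [z1 z2] := rz.
rewrite (@ev_euler _ KS r (flip_coef a) (z.2, z.1) r0 (geo_flip ga) (conj z2 z1)).
by rewrite -ev_flip.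
Qed.

Lemma ev_euler_op (m n k : nat) r a z : 0 < r -> geo r a -> box r z ->
  m%:R * (z.1 * dx (ev a) z) + n%:R * (z.2 * dy (ev a) z) + k%:R * ev a z =
  ev (fun i j => (m * i + n * j + k)%:R * a i j) z.
Proof.
move=> r0 ga rz; have gx := geo_muln ga.
have gy : geo r (fun i j => j%:R * a i j) := geo_flip (geo_muln (geo_flip ga)).
rewrite (ev_eulerx r0 ga rz) (ev_eulery r0 ga rz) -addrA -(evZ k%:R ga rz).
rewrite -(evD KS n%:R gy (geoZ k%:R ga) rz) -(evD KS m%:R gx (geoD n%:R gy (geoZ k%:R ga)) rz).
congr (ev _ z); apply/funext => i; apply/funext => j.
by rewrite !natrD !natrM; ring.
Qed.

(** * The reciprocal of a power series with constant term 1 *)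

Section Inverse.
Variables (a : nat -> nat -> K).
Hypothesis a1 : a 0%N 0%N = 1.

Let a' i j := a i j - delta 0 0 i j.

Let a'0 : a' 0%N 0%N = 0.
Proof. by rewrite /a' /delta !eqxx a1 subrr. Qed.

(** Iterates of [b |-> 1 - a' b], whose fixed point is the reciprocal of [a = 1 + a']. As [a'] has
    no constant term, each step fixes the coefficients of one more total degree, so the entry
    [(i, j)] is final after [i + j + 1] steps. *)
Definition inv_approx n : nat -> nat -> K :=
  iter n (fun b i j => delta 0 0 i j - cauchy a' b i j) (fun _ _ => 0).

Let cauchy_eq (b c : nat -> nat -> K) p q :
  (forall i j, (i + j < p + q)%N -> b i j = c i j) -> cauchy a' b p q = cauchy a' c p q.
Proof.
move=> bc; rewrite /cauchy; apply: eq_bigr => i _; apply: eq_bigr => j _.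
have [/andP[/eqP -> /eqP ->]|ij] := boolP ((i == 0%N :> nat) && (j == 0%N :> nat)).
  by rewrite a'0 !mul0r.
congr (_ * _); apply: bc; have ip : (i <= p)%N by rewrite -ltnS.
have jq : (j <= q)%N by rewrite -ltnS.
rewrite -[in ltnRHS](subnK ip) -[in ltnRHS](subnK jq) addnACA -[ltnLHS]addn0 ltn_add2l.
by rewrite addn_gt0 !lt0n -negb_and.
Qed.

Let inv_stable n p q : (p + q < n)%N -> inv_approx n.+1 p q = inv_approx n p q.
Proof.
elim: n p q => // n IH p q; rewrite ltnS => pqn.
rewrite [LHS]/= [RHS]/=; congr (_ - _); apply: cauchy_eq => i j ij.
by apply: IH; exact: leq_trans pqn.
Qed.

Definition inverse i j := inv_approx (i + j).+1 i j.

Let inverseE n i j : (i + j < n)%N -> inverse i j = inv_approx n i j.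
Proof.
rewrite /inverse => /subnKC <-; elim: (n - _)%N => [|m IH]; first by rewrite addn0.
by rewrite IH addnS inv_stable// leq_addr.
Qed.

Lemma cauchy_delta b p q : cauchy (delta 0 0) b p q = b p q.
Proof.
rewrite /cauchy big_ord_recl [X in _ + X]big1 ?addr0; last first.
  by move=> i _; rewrite big1// => j _; rewrite /delta /= mul0r.
rewrite big_ord_recl [X in _ + X]big1 ?addr0; last first.
  by move=> j _; rewrite /delta /= mul0r.
by rewrite /delta /= mul1r !subn0.
Qed.

Lemma cauchy_inverse : cauchy a inverse = delta 0 0.
Proof.
apply/funext => p; apply/funext => q.
transitivity (cauchy a' inverse p q + cauchy (delta 0 0) inverse p q).
  rewrite /cauchy -big_split/=; apply: eq_bigr => i _.
  by rewrite -big_split/=; apply: eq_bigr => j _; rewrite -mulrDl subrK.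
rewrite cauchy_delta [inverse p q in X in _ + X]/inverse /=.
rewrite (@cauchy_eq inverse (inv_approx (p + q))) ?subrKC//.
by move=> i j ij; exact: inverseE.
Qed.

Lemma geo_inverse r : 0 < r -> geo r a -> exists2 s, 0 < s & geo s inverse.
Proof.
move=> r0 ga.
have ga' : geo r a'.
  rewrite (_ : a' = fun i j => (-1) * delta 0 0 i j + a i j); last first.
    by apply/funext => i; apply/funext => j; rewrite /a'; ring.
  exact/geoD/ga/geo_delta.
have [s0 sr] := midpoint r0; set s := (0 + r) / 2 in s0 sr.
have [M aM] := ga' _ s0 sr.
have M0 : 0 <= M by apply: le_trans (aM 0%N 0%N); rewrite mulr_ge0// exprn_ge0// ltW.
have D0 : 0 < 4 * M + 2 by rewrite ltr_wpDl// mulr_ge0.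
(* This choice gives [eta <= 1 / 2], even for [M = 0], so geometric sums of ratio [eta] are at most
   [2]; and it gives [4 * M * eta <= 1]. *)
pose eta := (4 * M + 2)^-1.
have eta0 : 0 < eta by rewrite invr_gt0.
have eta12 : eta <= 2^-1 by rewrite lef_pV2 ?posrE// lerDr mulr_ge0.
have eta1 : eta < 1 by rewrite (le_lt_trans eta12)// invf_lt1// ltr1n.
have geta : (1 - eta)^-1 <= 2.
  rewrite -[leRHS]invrK lef_pV2 ?posrE ?invr_gt0 ?subr_gt0// lerBrDr -lerBrDl.
  by rewrite (le_trans eta12)// [X in _ <= X - _]splitr !mul1r addrK.
have Meta : M * eta * (2 * 2) <= 1.
  have -> : M * eta * (2 * 2) = (4 * M) / (4 * M + 2) by rewrite -/eta; ring.
  by rewrite ler_pdivrMr// mul1r lerDl.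
(* One [eta] per degree pays for the summation. The other supplies, as [i + j >= 1] wherever [a'] is
   nonzero, the factor in [M * eta] that closes the induction with the bound [1], uniform in [n]. *)
pose t := s * eta ^+ 2.
have t0 : 0 < t by rewrite mulr_gt0// exprn_gt0.
have bound n p q : `|inv_approx n p q| * t ^+ (p + q) <= 1.
  elim: n p q => [|n IH] p q; first by rewrite normr0 mul0r.
  have [pq0|pq0] := boolP ((p == 0%N) && (q == 0%N)).
    case/andP: pq0 => /eqP -> /eqP ->.
    by rewrite /= /cauchy !big_ord1 a'0 mul0r subr0 /delta !eqxx normr1 mul1r.
  rewrite /= {1}/delta (negPf pq0) sub0r normrN.
  rewrite -[t ^+ _]ger0_norm ?exprn_ge0 ?(ltW t0)// -normrM /cauchy mulr_suml.
  apply: (@le_trans _ _ (\sum_(i < p.+1) \sum_(j < q.+1) M * eta * (eta ^+ i * eta ^+ j))).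
    apply: (le_trans (ler_norm_sum _ _ _)); apply: ler_sum => i _; rewrite mulr_suml.
    apply: (le_trans (ler_norm_sum _ _ _)); apply: ler_sum => j _.
    have [/andP[/eqP i0 /eqP j0]|ij] := boolP ((i == 0%N :> nat) && (j == 0%N :> nat)).
      rewrite i0 j0 a'0 !mul0r normr0 !expr0 !mulr1.
      by rewrite mulr_ge0// ltW.
    have -> : t ^+ (p + q) = t ^+ (i + j) * t ^+ ((p - i) + (q - j)).
      by rewrite -exprD addnACA !subnKC// -ltnS.
    rewrite mulrACA normrM -[leRHS]mulr1; apply: ler_pM => //; last first.
      by rewrite normrM (ger0_norm (exprn_ge0 _ (ltW t0))).
    rewrite normrM (ger0_norm (exprn_ge0 _ (ltW t0))) /t exprMn mulrA -mulrA.
    rewrite mulrA -[leRHS]mulrA; apply: ler_pM => //.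
    - by rewrite mulr_ge0// exprn_ge0// ltW.
    - by rewrite !exprn_ge0// ltW.
    rewrite -exprM mul2n -addnn -exprD -exprS.
    apply: ler_wiXn2l; rewrite ?(ltW eta0) ?(ltW eta1)// -addn1 leq_add2l.
    by rewrite addn_gt0 !lt0n -negb_and.
  have -> : \sum_(i < p.+1) \sum_(j < q.+1) M * eta * (eta ^+ i * eta ^+ j) =
      M * eta * ((\sum_(i < p.+1) eta ^+ i) * (\sum_(j < q.+1) eta ^+ j)).
    rewrite mulr_suml mulr_sumr; apply: eq_bigr => i _.
    by rewrite !mulr_sumr.
  have Se n' : 0 <= \sum_(i < n') eta ^+ i by apply: sumr_ge0 => i _; rewrite exprn_ge0// ltW.
  have S2 n' : \sum_(i < n') eta ^+ i <= 2.
    exact: le_trans (geometric_sum_le n' (ltW eta0) eta1) geta.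
  apply: le_trans Meta; apply: ler_pM => //; first by rewrite mulr_ge0// ltW.
    by rewrite mulr_ge0.
  exact: ler_pM.
exists t => // u u0 ut; exists 1 => i j; apply: le_trans (bound (i + j).+1 i j).
apply: ler_wpM2l => //; apply: lerXn2r; rewrite ?nnegrE ?(ltW u0) ?(ltW t0)//.
exact: ltW.
Qed.

End Inverse.

End PowerSeriesGerms.

(** * What the algebra requires of a category of germs *)

Section GermCalculus.
Context {K : numFieldType}.

Definition germ_x : @germ K := germ_of (fun z => z.1).
Definition germ_y : @germ K := germ_of (fun z => z.2).

Record germ_calculus (c : category) : Prop := GermCalculus {
  gc_one : @germs K c 1;
  gc_x : germs c germ_x;
  gc_y : germs c germ_y;
  gc_mul : forall u v, @germs K c u -> germs c v -> germs c (u * v);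
  gc_dx : forall u, @germs K c u -> germs c (germ_dx u);
  gc_dy : forall u, @germs K c u -> germs c (germ_dy u);
  gc_comm : forall u, @germs K c u -> germ_dx (germ_dy u) = germ_dy (germ_dx u);
  gc_surj : forall (m n k : nat) u, (0 < k)%N -> @germs K c u ->
    exists2 v, germs c v & m%:R *: (germ_x * germ_dx v) +
      n%:R *: (germ_y * germ_dy v) + k%:R *: v = u;
  gc_inj : forall (m n k : nat) v, (0 < k)%N -> @germs K c v ->
    m%:R *: (germ_x * germ_dx v) + n%:R *: (germ_y * germ_dy v) + k%:R *: v = 0 ->
    v = 0;
  gc_const : forall u, @germs K c u -> germ_dx u = 0 -> germ_dy u = 0 ->
    exists k : K, u = k%:A;
  gc_unit : forall f, @germs K c (germ_of f) -> f 0 = 1 ->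
    exists2 u, germs c u & germ_of f * u = 1 }.

Lemma germ_of1 : germ_of (1 : K * K -> K) = 1.
Proof. exact: rmorph1. Qed.

Lemma germ_of0 : germ_of (0 : K * K -> K) = 0.
Proof. exact: raddf0. Qed.

Lemma germ_ofA (k : K) : germ_of (cst k) = k%:A.
Proof.
rewrite -germ_of1 -germ_ofZ; congr germ_of; apply/funext => z.
exact: esym (mulr1 k).
Qed.

Lemma germ_euler (m n k : nat) (f : K * K -> K) :
  m%:R *: (germ_x * germ_dx (germ_of f)) + n%:R *: (germ_y * germ_dy (germ_of f)) +
    k%:R *: germ_of f =
  germ_of (fun z => m%:R * (z.1 * dx f z) + n%:R * (z.2 * dy f z) + k%:R * f z).
Proof.
by rewrite germ_dxE germ_dyE -!germ_ofM -!germ_ofZ -!germ_ofD.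
Qed.

Lemma germs_leibniz c (u v : germ) : @germs K c u -> germs c v ->
  germ_dx (u * v) = germ_dx u * v + u * germ_dx v /\
  germ_dy (u * v) = germ_dy u * v + u * germ_dy v.
Proof.
move=> [f [/smooth_openP[U [oU U0] Uf] _] <-].
move=> [g [/smooth_openP[V [oV V0] Vg] _] <-].
rewrite -germ_ofM !germ_dxE !germ_dyE -!germ_ofM -!germ_ofD.
have UV : open (U `&` V) /\ (U `&` V) 0 by split=> //; exact: openI.
split; apply/germ_ofP/near_openP; exists (U `&` V) => // -[x y] [Uz Vz].
- have [_ df _] := Uf _ Uz [::]; have [_ dg _] := Vg _ Vz [::].
  have := deriveM df dg; rewrite -!derive1E => E; apply: (etrans E).
  by rewrite addrC /GRing.scale /= mulrC.
- have [_ _ df] := Uf _ Uz [::]; have [_ _ dg] := Vg _ Vz [::].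
  have := deriveM df dg; rewrite -!derive1E => E; apply: (etrans E).
  by rewrite addrC /GRing.scale /= mulrC.
Qed.

Lemma germ_dx_x : germ_dx germ_x = 1.
Proof.
rewrite germ_dxE -germ_of1; congr germ_of; apply/funext => z.
exact: derive1_idfun.
Qed.

Lemma germ_dy_y : germ_dy germ_y = 1.
Proof.
rewrite germ_dyE -germ_of1; congr germ_of; apply/funext => z.
exact: derive1_idfun.
Qed.

Lemma germ_dy_x : germ_dy germ_x = 0.
Proof.
rewrite germ_dyE -germ_of0; congr germ_of; apply/funext => z.
by rewrite /dy derive1E derive_cst.
Qed.

Lemma germ_dx_y : germ_dx germ_y = 0.
Proof.
rewrite germ_dxE -germ_of0; congr germ_of; apply/funext => z.
by rewrite /dx derive1E derive_cst.
Qed.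

End GermCalculus.

Section AnalyticGerms.
Context {K : numFieldType}.
Hypothesis KS : @summable_field K.
Implicit Types (a b : nat -> nat -> K) (r s : K) (z : K * K) (u v : @germ K).

Lemma germ_of_box (f g : K * K -> K) r : 0 < r -> (forall z, box r z -> f z = g z) ->
  germ_of f = germ_of g.
Proof. by move=> r0 fg; apply/germ_ofP/near_boxP; exists r. Qed.

Lemma germ_of_ev_inj r a b : 0 < r -> geo r a -> geo r b ->
  germ_of (ev a) = germ_of (ev b) -> a = b.
Proof.
move=> r0 ga gb /germ_ofP/near_boxP[s s0 ab].
have [q q0 [qr qs]] := real_min2 r0 s0.
have ga' := geo_le qr ga; have gb' := geo_le qr gb.
apply/funext => i; apply/funext => j; apply/eqP; rewrite -subr_eq0; apply/eqP.
transitivity (-1 * b i j + a i j); first by ring.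
apply: (ev_inj KS q0 (geoD (-1) gb' ga')) => z; rewrite inE => qz.
rewrite (evD KS (-1) gb' ga' qz) ab ?mulN1r ?addNr//.
exact: box_le qz.
Qed.

Variable c : category.
Hypothesis cA : c <> Smooth.

(** At the diagonal point [(s, s)] each single modulus [|a i j| s ^+ (i + j)] is bounded by the sums
    of moduli, which is Abel's condition. *)
Lemma power_series_ev f : power_series f -> exists r a,
  [/\ 0 < r, geo r a & forall z, box r z -> f z = ev a z].
Proof.
move=> [a /near_boxP[r r0 fa]]; exists r, a; split=> //; last first.
  by move=> z /fa[_ fz]; apply/esym/evP.
move=> s s0 sr; have rs : box r (s, s).
  by split; rewrite /= ger0_norm// ltW.
have [[M aM] _] := fa _ rs; exists M => i j.
have jn : (j < (i + j).+1)%N by rewrite ltnS leq_addl.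
have in_ : (i < (i + j).+1)%N by rewrite ltnS leq_addr.
apply: le_trans (aM (i + j).+1).
rewrite (bigD1 (Ordinal in_))//= (bigD1 (Ordinal jn))//= -addrA.
rewrite -mulrA -exprD normrM (ger0_norm (exprn_ge0 _ (ltW s0))) lerDl.
by rewrite addr_ge0// sumr_ge0// => k _; rewrite sumr_ge0.
Qed.

Lemma ev_germs r a : 0 < r -> geo r a -> germs c (germ_of (ev a)).
Proof.
move=> r0 ga; exists (ev a) => //; split; first exact: (ev_smooth KS r0 ga).
right; exists a; apply/near_boxP; exists r => // z rz; split; last exact: (ev_cvg KS ga rz).
exact: (dominated_bounded (geo_dominated ga rz)).
Qed.

Lemma germs_ev u : germs c u -> exists r a, [/\ 0 < r, geo r a & u = germ_of (ev a)].
Proof.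
move=> [f [_ [//|/power_series_ev[r [a [r0 ga fa]]]]] <-].
by exists r, a; split=> //; exact: (germ_of_box r0).
Qed.

Lemma germ_ev_dx r a : 0 < r -> geo r a -> germ_dx (germ_of (ev a)) = germ_of (ev (d1 a)).
Proof.
move=> r0 ga; rewrite germ_dxE; apply: (germ_of_box r0) => z rz.
exact: (ev_dx KS r0 ga rz).2.
Qed.

Lemma germ_ev_dy r a : 0 < r -> geo r a -> germ_dy (germ_of (ev a)) = germ_of (ev (d2 a)).
Proof.
move=> r0 ga; rewrite germ_dyE; apply: (germ_of_box r0) => z rz.
exact: (ev_dy KS r0 ga rz).2.
Qed.

Lemma germ_ev_euler (m n k : nat) r a : 0 < r -> geo r a ->
  m%:R *: (germ_x * germ_dx (germ_of (ev a))) + n%:R *: (germ_y * germ_dy (germ_of (ev a))) +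
    k%:R *: germ_of (ev a) = germ_of (ev (fun i j => (m * i + n * j + k)%:R * a i j)).
Proof.
move=> r0 ga; rewrite germ_euler; apply: (germ_of_box r0) => z rz.
exact: (ev_euler_op KS m n k r0 ga rz).
Qed.

Lemma geo_euler (m n k : nat) r a : geo r a ->
  geo r (fun i j => (m * i + n * j + k)%:R * a i j).
Proof.
move=> ga; have gy : geo r (fun i j => j%:R * a i j) := geo_flip (geo_muln (geo_flip ga)).
have := geoD m%:R (geo_muln ga) (geoD n%:R gy (geoZ k%:R ga)).
congr (geo r _); apply/funext => i; apply/funext => j.
by rewrite !natrD !natrM; ring.
Qed.

(** Everything is read on coefficients. The Euler operator multiplies the coefficient [(i, j)] by
    [m * i + n * j + k], which is at least [1] since [k > 0]; dividing by it keeps the domain of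
    convergence. *)
Lemma analytic_calculus : @germ_calculus K c.
Proof.
have one0 : 0 < 1 :> K by [].
split.
- rewrite -germ_of1 (_ : germ_of 1 = germ_of (ev (delta 0 0))).
    exact: ev_germs one0 (@geo_delta K _ _ _).
  by apply: (germ_of_box one0) => z _; rewrite ev_delta !expr0 mulr1.
- rewrite /germ_x (_ : germ_of _ = germ_of (ev (delta 1 0))).
    exact: ev_germs one0 (@geo_delta K _ _ _).
  by apply: (germ_of_box one0) => z _; rewrite ev_delta expr0 mulr1 expr1.
- rewrite /germ_y (_ : germ_of _ = germ_of (ev (delta 0 1))).
    exact: ev_germs one0 (@geo_delta K _ _ _).
  by apply: (germ_of_box one0) => z _; rewrite ev_delta expr0 mul1r expr1.
- move=> u v /germs_ev[r [a [r0 ga ->]]] /germs_ev[s [b [s0 gb ->]]].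
  have [q q0 [qr qs]] := real_min2 r0 s0.
  have ga' := geo_le qr ga; have gb' := geo_le qs gb.
  rewrite -germ_ofM (_ : germ_of _ = germ_of (ev (cauchy a b))).
    exact: ev_germs q0 (geo_cauchy ga' gb').
  by apply: (germ_of_box q0) => z qz; rewrite (ev_mul KS ga' gb' qz).
- move=> u /germs_ev[r [a [r0 ga ->]]]; rewrite (germ_ev_dx r0 ga).
  exact: ev_germs r0 (geo_d1 r0 ga).
- move=> u /germs_ev[r [a [r0 ga ->]]]; rewrite (germ_ev_dy r0 ga).
  exact: ev_germs r0 (geo_d2 r0 ga).
- move=> u /germs_ev[r [a [r0 ga ->]]].
  rewrite (germ_ev_dx r0 ga) (germ_ev_dy r0 ga).
  rewrite (germ_ev_dx r0 (geo_d2 r0 ga)) (germ_ev_dy r0 (geo_d1 r0 ga)).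
  congr (germ_of (ev _)); apply/funext => i; apply/funext => j.
  by rewrite /d2 /d1 /flip_coef; ring.
- move=> m n k u k0 /germs_ev[r [a [r0 ga ->]]].
  pose b i j := (m * i + n * j + k)%:R^-1 * a i j.
  have gb : geo r b.
    move=> s s0 sr; have [M aM] := ga _ s0 sr; exists M => i j.
    apply: le_trans (aM i j); apply: ler_wpM2r; first by rewrite exprn_ge0// ltW.
    rewrite /b normrM normfV normr_nat ler_piMl// invf_le1 ?ltr0n ?addn_gt0 ?k0 ?orbT//.
    by rewrite ler1n addn_gt0 k0 orbT.
  exists (germ_of (ev b)); first exact: ev_germs r0 gb.
  rewrite (germ_ev_euler m n k r0 gb); congr (germ_of (ev _)).
  apply/funext => i; apply/funext => j; rewrite /b mulrA mulfV ?mul1r//.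
  by rewrite pnatr_eq0 -lt0n addn_gt0 k0 orbT.
- move=> m n k v k0 /germs_ev[r [a [r0 ga ->]]].
  rewrite (germ_ev_euler m n k r0 ga) => E.
  have z0 : geo r (fun _ _ => 0) by move=> s _ _; exists 0 => i j; rewrite normr0 mul0r.
  have ev0 : germ_of (ev (fun _ _ => 0)) = 0 :> @germ K.
    rewrite -germ_of0; apply: (germ_of_box r0) => z rz.
    rewrite (_ : (fun _ _ => 0) = fun i j => 0 * delta 0 0 i j).
      by rewrite (evZ KS 0 (@geo_delta _ 0 0 r) rz) mul0r.
    by apply/funext => i; apply/funext => j; rewrite mul0r.
  have {E}E := germ_of_ev_inj r0 (geo_euler m n k ga) z0 (etrans E (esym ev0)).
  rewrite -ev0; congr (germ_of (ev _)); apply/funext => i; apply/funext => j.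
  have /eqP := congr1 (fun f => f i j) E; rewrite mulf_eq0 pnatr_eq0.
  by rewrite -leqn0 leqNgt addn_gt0 k0 orbT /= => /eqP.
- move=> u /germs_ev[r [a [r0 ga ->]]].
  rewrite (germ_ev_dx r0 ga) (germ_ev_dy r0 ga) => ax ay.
  have z0 : geo r (fun _ _ => 0) by move=> s _ _; exists 0 => i j; rewrite normr0 mul0r.
  have ev0 : germ_of (ev (fun _ _ => 0)) = 0 :> @germ K.
    rewrite -germ_of0; apply: (germ_of_box r0) => z rz.
    rewrite (_ : (fun _ _ => 0) = fun i j => 0 * delta 0 0 i j).
      by rewrite (evZ KS 0 (@geo_delta _ 0 0 r) rz) mul0r.
    by apply/funext => i; apply/funext => j; rewrite mul0r.
  have {}ax := germ_of_ev_inj r0 (geo_d1 r0 ga) z0 (etrans ax (esym ev0)).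
  have {}ay := germ_of_ev_inj r0 (geo_d2 r0 ga) z0 (etrans ay (esym ev0)).
  exists (a 0%N 0%N); rewrite -germ_ofA; apply: (germ_of_box r0) => z rz.
  rewrite (_ : a = fun i j => a 0%N 0%N * delta 0 0 i j).
    by rewrite (evZ KS _ (@geo_delta _ 0 0 r) rz) ev_delta /delta !expr0 !mulr1.
  apply/funext => -[|i]; apply/funext => -[|j]; rewrite /delta /= ?mulr1 ?mulr0//.
  + have /eqP := congr1 (fun f => f 0%N j) ay.
    by rewrite /d2 /d1 /flip_coef mulf_eq0 pnatr_eq0 /= => /eqP.
  + have /eqP := congr1 (fun f => f i 0%N) ax.
    by rewrite /d1 mulf_eq0 pnatr_eq0 /= => /eqP.
  + have /eqP := congr1 (fun f => f i j.+1) ax.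
    by rewrite /d1 mulf_eq0 pnatr_eq0 /= => /eqP.
- move=> f /germs_ev[r [a [r0 ga fa]]] f0; rewrite fa.
  have a1 : a 0%N 0%N = 1.
    rewrite -(ev_at0 r0 ga) -f0; move/germ_ofP: fa => /nbhs_singleton; exact: esym.
  have [s s0 gi] := geo_inverse a1 r0 ga.
  have [q q0 [qr qs]] := real_min2 r0 s0.
  exists (germ_of (ev (inverse a))); first exact: ev_germs s0 gi.
  rewrite -germ_ofM -germ_of1; apply: (germ_of_box q0) => z qz.
  have := ev_mul KS (geo_le qr ga) (geo_le qs gi) qz.
  by rewrite (cauchy_inverse a1) ev_delta !expr0 mulr1 => E; exact: (etrans (esym E)).
Qed.

End AnalyticGerms.

(** * The real and the complex field are summable *)

Section SummableFields.

Lemma psum_nondecreasing (R : numFieldType) (t : nat -> nat -> R) :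
  (forall i j, 0 <= t i j) -> nondecreasing_seq (psum t).
Proof.
move=> t0; apply/nondecreasing_seqP => n.
rewrite /psum big_ord_recr/= -[leLHS]addr0; apply: lerD; last by rewrite sumr_ge0.
by apply: ler_sum => i _; rewrite big_ord_recr/= lerDl.
Qed.

Lemma real_summable_field (R : realType) : @summable_field (R : numFieldType).
Proof.
split=> [r r0 r1|t [M tM]]; first by apply: cvg_expr; rewrite ger0_norm.
have cvg_pos (u : nat -> nat -> R) : (forall i j, 0 <= u i j) -> (exists B, forall n, psum u n <= B) ->
    cvg (psum u @ \oo).
  move=> u0 [B uB]; apply: nondecreasing_is_cvgn; first exact: psum_nondecreasing.
  by exists B => _ [n _ <-].
have c1 : cvg (psum (fun i j => `|t i j|) @ \oo) by apply: cvg_pos => //; exists M.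
(* [t] is the difference of the nonnegative families [|t| + t] and [|t|], whose partial sums are
   monotone and bounded. *)
have c2 : cvg (psum (fun i j => `|t i j| + t i j) @ \oo).
  apply: cvg_pos => [i j|].
    by rewrite -lerBlDr sub0r (le_trans (ler_norm _))// normrN.
  exists (M + M) => n; rewrite psumD lerD//.
  by rewrite (le_trans (ler_norm _))// (le_trans (ler_norm_psum _ _)).
rewrite (_ : psum t = fun n => psum (fun i j => `|t i j| + t i j) n -
    psum (fun i j => `|t i j|) n); first exact: is_cvgB c2 c1.
by apply/funext => n; rewrite psumD addrC addKr.
Qed.

Lemma cvg_real_complex (R : realType) (u : nat -> R) (l : R) : u @ \oo --> l ->
  (fun n => (u n)%:C%C : (R[i] : numFieldType)) @ \oo --> (l%:C%C : (R[i] : numFieldType)).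
Proof.
move=> ul; apply/cvgrPdist_le => e e0.
have eE : e = (complex.Re e)%:C%C by rewrite RRe_real// gtr0_real.
have {}e0 : 0 < complex.Re e by rewrite -ltcR -eE.
move/cvgrPdist_le : ul => /(_ _ e0); apply: filterS => n un.
rewrite eE -rmorphB normc_def /= expr0n /= addr0 sqrtr_sqr lecR.
exact: un.
Qed.

Lemma complex_summable_field (R : realType) : @summable_field (R[i] : numFieldType).
Proof.
have [Rexp Rsum] := real_summable_field R.
split=> [r r0 r1|t [M tM]].
  have rE : r = (complex.Re r)%:C%C by rewrite RRe_real// ger0_real.
  have re0 : 0 <= complex.Re r by rewrite -lecR -rE.
  have re1 : complex.Re r < 1 by rewrite -ltcR -rE.
  rewrite (_ : (fun n => r ^+ n) = fun n => ((complex.Re r) ^+ n)%:C%C).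
    exact: (cvg_real_complex (Rexp _ re0 re1)).
  by apply/funext => n; rewrite {1}rE rmorphXn.
have psumC (u : nat -> nat -> R) n : (psum u n)%:C%C = psum (fun i j => (u i j)%:C%C) n.
  rewrite /psum rmorph_sum; apply: eq_bigr => i _.
  by rewrite rmorph_sum.
have cvg_le (u : nat -> nat -> R) : (forall i j, `|u i j|%:C%C <= `|t i j|) ->
    cvg ((fun n => (psum u n)%:C%C : (R[i] : numFieldType)) @ \oo).
  move=> ut; have /cvg_ex[l ul] : cvg (psum u @ \oo).
    apply: Rsum; exists (complex.Re M) => n.
    have := tM n; have : (psum (fun i j => `|u i j|) n)%:C%C <= psum (fun i j => `|t i j|) n.
      by rewrite psumC; apply: ler_psum.
    by move=> /le_trans/[apply]; rewrite lecE /= => /andP[].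
  by apply/cvg_ex; exists l%:C%C; exact: cvg_real_complex.
have c1 := cvg_le (fun i j => complex.Re (t i j)) (fun i j => normc_ge_Re (t i j)).
have c2 : cvg ((fun n => (psum (fun i j => complex.Im (t i j)) n)%:C%C : (R[i] : numFieldType)) @ \oo).
  apply: cvg_le => i j; case: (t i j) => x y.
  rewrite normc_def /= lecR -sqrtr_sqr ler_sqrt; first by rewrite lerDr sqr_ge0.
  by rewrite addr_ge0// sqr_ge0.
move/cvg_ex : c1 => [l1 l1E]; move/cvg_ex : c2 => [l2 l2E].
have tE : psum t = (fun n => (psum (fun i j => complex.Re (t i j)) n)%:C%C +
    'i%C * (psum (fun i j => complex.Im (t i j)) n)%:C%C).
  apply/funext => n; rewrite !psumC -psumZ -psumD; apply: eq_psum => i j.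
  exact: complexE.
rewrite tE; apply/cvg_ex; exists (l1 + 'i%C * l2).
by apply: cvgD; [exact: l1E|apply: cvgMl_tmp; exact: l2E].
Qed.

End SummableFields.

(** * The Euler integral of a smooth germ *)

Section UnitIntegral.
Context {R : realType}.
Implicit Types (f g F : R -> R) (t : R).

(** Two-sided continuity, also at [0] and [1]: the integrands below are continuous around the
    endpoints because boxes are open. *)
Definition cont01 f := forall t, 0 <= t -> t <= 1 -> {for t, continuous f}.

Definition integral01 f : R := (\int[lebesgue_measure]_(t in `[0, 1]) f t)%R.

Let mu := @lebesgue_measure R.

Lemma cont01_within f : cont01 f -> {within `[0, 1], continuous f}.
Proof.
move=> cf; apply: continuous_in_subspaceT => t /set_mem /=.
by rewrite in_itv /= => /andP[t0 t1]; exact: cf.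
Qed.

Lemma cont01_integrable f : cont01 f -> mu.-integrable `[0, 1] (EFin \o f).
Proof.
move=> cf; apply: continuous_compact_integrable; first exact: segment_compact.
exact: cont01_within.
Qed.

Lemma integral01_linear k f g : cont01 f -> cont01 g ->
  integral01 (fun t => k * f t + g t) = k * integral01 f + integral01 g.
Proof.
move=> cf cg; have ckf : cont01 (fun t => k * f t).
  by move=> t t0 t1; apply: cvgMl_tmp; exact: cf.
rewrite /integral01 RintegralD//; [|exact: cont01_integrable|exact: cont01_integrable].
by rewrite RintegralZl//; exact: cont01_integrable.
Qed.

Lemma integral01_bound f M : cont01 f -> (forall t, 0 <= t -> t <= 1 -> `|f t| <= M) ->
  `|integral01 f| <= M.
Proof.
move=> cf fM; apply: (le_trans (le_normr_Rintegral _ (cont01_integrable cf))) => //.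
apply: (@le_trans _ _ (\int[mu]_(t in `[0, 1]) M)%R).
  apply: le_Rintegral => //.
  - by apply: cont01_integrable => t t0 t1; apply: cvg_norm; exact: cf.
  - by apply: cont01_integrable => t t0 t1; exact: cvg_cst.
  - by move=> t /=; rewrite in_itv /= => /andP[t0 t1]; exact: fM.
have m01 : mu `[0, 1] = 1%E.
  by apply: (etrans (lebesgue_measure_itv _)); rewrite /= lte_fin ltr01 oppr0 adde0.
by rewrite Rintegral_cst// [fine _](congr1 fine m01) mulr1.
Qed.

Lemma integral01_FTC f F : cont01 f ->
  (forall t, 0 <= t -> t <= 1 -> is_derive t 1 F (f t)) -> integral01 f = F 1 - F 0.
Proof.
move=> cf dF.
have cF t : 0 <= t -> t <= 1 -> {for t, continuous F}.
  move=> t0 t1; have := dF t t0 t1 => dFt.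
  by apply: differentiable_continuous; apply/derivable1_diffP; exact: ex_derive.
rewrite /integral01 /Rintegral (@continuous_FTC2 _ f F) //.
- exact: cont01_within.
- split.
  + move=> t; rewrite in_itv /= => /andP[t0 t1].
    by have := dF t (ltW t0) (ltW t1) => dFt; exact: ex_derive.
  + by apply: cvg_at_right_filter; exact: cF.
  + by apply: cvg_at_left_filter; exact: cF.
- move=> t; rewrite in_itv /= => /andP[t0 t1].
  by have := dF t (ltW t0) (ltW t1) => dFt; rewrite derive1E derive_val.
Qed.

(** The tube lemma for the compact interval [[0, 1]]: it turns joint local estimates into estimates
    uniform in [t]. *)
Lemma near01 (T : topologicalType) (z : T) (P : T -> R -> Prop) :
  (forall t, 0 <= t -> t <= 1 -> \forall t' \near t & z' \near z, P z' t') ->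
  \forall z' \near z, forall t, 0 <= t -> t <= 1 -> P z' t.
Proof.
move=> tP; have := @segment_compact R 0 1; rewrite compact_near_coveringP.
move=> /(_ T (nbhs z) P _) H.
have : \forall z' \near z, `[0, 1]%classic `<=` P z'.
  by apply: H => t /=; rewrite in_itv /= => /andP[t0 t1]; exact: tP.
by apply: filterS => z' zP t t0 t1; apply: zP; rewrite /= in_itv /= t0.
Qed.

Lemma integral01_cvg (T : Type) (G : set_system T) {FG : Filter G} (phi : T -> R -> R) f :
  cont01 f -> (\forall z \near G, cont01 (phi z)) ->
  (forall e, 0 < e -> \forall z \near G, forall t, 0 <= t -> t <= 1 -> `|f t - phi z t| <= e) ->
  integral01 (phi z) @[z --> G] --> integral01 f.
Proof.
move=> cf cphi fphi; apply/cvgrPdist_le => e e0.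
apply: filterS2 cphi (fphi e e0) => z cz zP.
have := integral01_linear (-1) cz cf; rewrite mulN1r addrC => <-.
apply: integral01_bound => [t t0 t1|t t0 t1].
  apply: cvgD; last exact: cf.
  by apply: cvgMl_tmp; exact: cz.
by rewrite mulN1r addrC; exact: zP.
Qed.

End UnitIntegral.

(** * Mean value theorem and chain rule from partial derivatives *)

Section RealPlane.
Context {R : realType}.
Implicit Types (b : R * R -> R) (z : R * R).

Definition regular_on (r : R) b := forall z, box r z -> regular_at b z.

Lemma mvt_dx r b (x x' y : R) : regular_on r b -> box r (x, y) -> box r (x', y) ->
  exists xi, [/\ `|xi - x| <= `|x' - x|, `|xi - x'| <= `|x' - x| &
    b (x', y) - b (x, y) = dx b (xi, y) * (x' - x)].
Proof.
move=> rb; wlog xx' : x x' / x <= x'.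
  move=> H rx rx'; have [xx'|/ltW xx'] := leP x x'; first exact: H.
  have [xi [xi1 xi2 E]] := H _ _ xx' rx' rx; exists xi; rewrite [`|x' - x|]distrC; split=> //.
  by rewrite -[LHS]opprB E -mulrN opprB.
move=> [/= rx ry] [/= rx' _].
have seg t : x <= t -> t <= x' -> box r (t, y).
  move=> xt tx'; split=> //=; rewrite ltr_norml.
  move: rx rx'; rewrite !ltr_norml => /andP[rx _] /andP[_ rx'].
  by rewrite (lt_le_trans rx)// (le_lt_trans tx').
have [||xi] := @MVT_segment R (fun t => b (t, y)) (fun t => dx b (t, y)) x x' xx'.
- move=> t; rewrite in_itv /= => /andP[xt tx'].
  have [_ dbx _] := rb _ (seg _ (ltW xt) (ltW tx')).
  by apply: (DeriveDef dbx); rewrite /dx derive1E.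
- apply: continuous_in_subspaceT => t /set_mem /=; rewrite in_itv /= => /andP[xt tx'].
  have [_ dbx _] := rb _ (seg _ xt tx').
  by apply: differentiable_continuous; apply/derivable1_diffP.
rewrite in_itv /= => /andP[xxi xix'] E; exists xi; split=> //.
- by rewrite !ger0_norm ?subr_ge0// lerD2r.
- by rewrite distrC !ger0_norm ?subr_ge0// lerD2l lerN2.
Qed.

Definition flip b : R * R -> R := fun z => b (z.2, z.1).

Lemma regular_on_flip r b : regular_on r b -> regular_on r (flip b).
Proof.
move=> rb [x y] [/= rx ry]; have [cb dbx dby] := rb (y, x) (conj ry rx).
split; [|exact: dby|exact: dbx].
exact: (cvg_comp _ _ (@swap_continuous R R (x, y)) cb).
Qed.

Lemma is_derive_cvg (f : R -> R) (t l : R) :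
  (h^-1 *: (f (h *: (1 : R) + t) - f t)) @[h --> 0^'] --> l -> is_derive t 1 f l.
Proof.
move=> fl; apply: DeriveDef; first by apply/cvg_ex; exists l.
exact: (cvg_lim (@norm_hausdorff _ _) fl).
Qed.

(** Regularity provides partial derivatives rather than a differential, so the increment is split.
    Moving [y] at fixed [x = p t] is a one-variable chain rule; moving [x] is handled by the mean
    value theorem, whose intermediate point tends to [p t], and by the continuity of [dx b]. *)
Lemma is_derive_curve r b (p q : R -> R) (t p' q' : R) :
  regular_on r b -> {for (p t, q t), continuous (dx b)} -> box r (p t, q t) ->
  is_derive t 1 p p' -> is_derive t 1 q q' ->
  is_derive t 1 (fun s => b (p s, q s)) (p' * dx b (p t, q t) + q' * dy b (p t, q t)).
Proof.
move=> rb cdx rpq dp dq.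
have cp : {for t, continuous p}.
  by apply: differentiable_continuous; apply/derivable1_diffP; exact: ex_derive.
have cq : {for t, continuous q}.
  by apply: differentiable_continuous; apply/derivable1_diffP; exact: ex_derive.
have [_ _ dby] := rb _ rpq.
pose s (h : R) := h *: (1 : R) + t.
have st : s h @[h --> 0^'] --> t.
  apply/cvgrPdist_le => e e0; apply/nbhs_ballP; exists e => //= h.
  rewrite -ball_normE /= sub0r normrN => he _.
  by rewrite /s /GRing.scale /= mulr1 opprD addrCA subrr addr0 normrN ltW.
have Qp : (h^-1 *: (p (s h) - p t)) @[h --> 0^'] --> p'.
  by rewrite -[p']derive_val; exact: ex_derive.
have Qb : (h^-1 *: (b (p t, q (s h)) - b (p t, q t))) @[h --> 0^'] --> q' * dy b (p t, q t).
  have dB : is_derive (q t) 1 (fun y => b (p t, y)) (dy b (p t, q t)).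
    by apply: (DeriveDef dby); rewrite /dy derive1E.
  have dBq := @is_derive1_comp _ (fun y => b (p t, y)) q t _ _ dB dq.
  rewrite mulrC -[X in _ --> X](@derive_val _ _ _ _ _ _ _ dBq).
  exact: (@ex_derive _ _ _ _ _ _ _ dBq).
have /choice[xi xiP] : forall h : R, exists xi, box r (p t, q (s h)) ->
    box r (p (s h), q (s h)) -> `|xi - p t| <= `|p (s h) - p t| /\
    b (p (s h), q (s h)) - b (p t, q (s h)) = dx b (xi, q (s h)) * (p (s h) - p t).
  move=> h; have [rh|nr] := pselect (box r (p t, q (s h)) /\ box r (p (s h), q (s h))).
    by have [xi [xi1 _ E]] := mvt_dx rb rh.1 rh.2; exists xi.
  (* Outside the box the value of [xi] is irrelevant, since only [h] near [0] matter for the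
     limit. *)
  by exists 0 => r1 r2; case: nr.
have ps : p (s h) @[h --> 0^'] --> p t by apply: (cvg_comp _ _ st cp).
have qs : q (s h) @[h --> 0^'] --> q t by apply: (cvg_comp _ _ st cq).
have oU := open_nbhs_nbhs (conj (@box_open _ r) rpq).
have r1 : \forall h \near 0^', box r (p t, q (s h)).
  by apply: (cvg_pair (cvg_cst (p t)) qs) oU.
have r2 : \forall h \near 0^', box r (p (s h), q (s h)) by apply: (cvg_pair ps qs) oU.
have xit : xi h @[h --> 0^'] --> p t.
  apply/cvgrPdist_le => e e0; move/cvgrPdist_le : ps => /(_ e e0).
  apply: filterS3 r1 r2 => h r1h r2h ph; have [xih _] := xiP h r1h r2h.
  by rewrite distrC (le_trans xih)// distrC.
have dxi : dx b (xi h, q (s h)) @[h --> 0^'] --> dx b (p t, q t).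
  exact: (cvg_comp _ _ (cvg_pair xit qs) cdx).
apply: is_derive_cvg; rewrite [p' * _]mulrC.
apply: cvg_trans (cvgD (cvgM dxi Qp) Qb); apply: near_eq_cvg.
apply: filterS2 r1 r2 => h r1h r2h; have [_ E] := xiP h r1h r2h.
rewrite -/(s h).
have -> : b (p (s h), q (s h)) - b (p t, q t) =
    dx b (xi h, q (s h)) * (p (s h) - p t) + (b (p t, q (s h)) - b (p t, q t)).
  by rewrite -E; ring.
rewrite /GRing.scale /=.
transitivity (dx b (xi h, q (s h)) * (h^-1 * (p (s h) - p t)) +
  h^-1 * (b (p t, q (s h)) - b (p t, q t))); [by []|ring].
Qed.

End RealPlane.

Section EulerIntegral.
Context {R : realType}.
Implicit Types (b : R * R -> R) (z : R * R) (m n k : nat) (r t : R).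

(** The exponent [k] stands for [c - 1]: the integral inverts the Euler operator with constant
    [k.+1], so positivity of [c] is built in. *)
Definition euler_integrand m n k b z t : R := t ^+ k * b (t ^+ m * z.1, t ^+ n * z.2).

Definition euler_integral m n k b z : R := integral01 (euler_integrand m n k b z).

Definition continuous_on r b := forall z, box r z -> {for z, continuous b}.

Lemma box_curve r m n z t : box r z -> 0 <= t -> t <= 1 -> box r (t ^+ m * z.1, t ^+ n * z.2).
Proof.
move=> [z1 z2] t0 t1.
have le l (x : R) : `|t ^+ l * x| <= `|x|.
  by rewrite normrM ler_piMl// normrX exprn_ile1// ger0_norm.
by split; [exact: le_lt_trans (le _ _) z1|exact: le_lt_trans (le _ _) z2].
Qed.

Lemma integrand_continuous r m n k b z t : continuous_on r b -> box r z -> 0 <= t -> t <= 1 ->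
  euler_integrand m n k b p.2 p.1 @[p --> (t, z)] --> euler_integrand m n k b z t.
Proof.
move=> cb rz t0 t1.
have fstt : p.1 @[p --> (t, z)] --> t by exact: cvg_fst.
have sndz : p.2 @[p --> (t, z)] --> z by exact: cvg_snd.
have X l : p.1 ^+ l @[p --> (t, z)] --> t ^+ l.
  exact: (cvg_comp _ _ fstt (@exprn_continuous _ l t)).
have z1 : p.2.1 @[p --> (t, z)] --> z.1 by apply: cvg_comp sndz _; exact: cvg_fst.
have z2 : p.2.2 @[p --> (t, z)] --> z.2 by apply: cvg_comp sndz _; exact: cvg_snd.
apply: cvgM; first exact: X.
apply: cvg_comp (cvg_pair (cvgM (X m) z1) (cvgM (X n) z2)) _.
exact: (cb _ (box_curve m n rz t0 t1)).
Qed.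

Lemma cont01_integrand r m n k b z : continuous_on r b -> box r z ->
  cont01 (euler_integrand m n k b z).
Proof.
move=> cb rz t t0 t1.
have pz : (s, z) @[s --> t] --> (t, z) by exact (cvg_pair cvg_id (cvg_cst z)).
exact: (cvg_comp _ _ pz (@integrand_continuous r m n k b z t cb rz t0 t1)).
Qed.

Lemma euler_integral_continuous r m n k b :
  continuous_on r b -> continuous_on r (euler_integral m n k b).
Proof.
move=> cb z rz; apply: integral01_cvg.
- exact: cont01_integrand cb rz.
- apply: filterS (open_nbhs_nbhs (conj (@box_open _ r) rz)) => z' rz'.
  exact: cont01_integrand cb rz'.
move=> e e0; apply: (near01 (P := fun z' t =>
  `|euler_integrand m n k b z t - euler_integrand m n k b z' t| <= e)) => t t0 t1.
have e20 : 0 < e / 2 by rewrite divr_gt0.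
have pz : (p.1, z) @[p --> (t, z)] --> (t, z).
  exact (cvg_pair cvg_fst (cvg_cst z)).
have c1 := @integrand_continuous r m n k b z t cb rz t0 t1.
have c2 := cvg_comp _ _ pz c1.
move/cvgrPdist_le : c1 => /(_ _ e20); move/cvgrPdist_le : c2 => /(_ _ e20).
apply: filterS2 => -[t' z'] /= h2 h1.
rewrite [e]splitr; apply: le_trans (lerD h2 h1).
rewrite -[X in `|X| + _]opprB normrN; apply: le_trans (ler_normD _ _).
by rewrite addrA subrK.
Qed.

Lemma cont01_bounded (f : R -> R) : cont01 f -> exists M, forall t, 0 <= t -> t <= 1 -> `|f t| <= M.
Proof.
move=> cf; have [|c _ cM] := @EVT_max R (fun t => `|f t|) 0 1 ler01.
  by apply: cont01_within => t t0 t1; apply: cvg_norm; exact: cf.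
by exists `|f c| => t t0 t1; apply: cM; rewrite in_itv /= t0.
Qed.

Lemma is_derive_mull (c x : R) : is_derive x 1 (fun y => c * y) c.
Proof.
have [|d1 d2] := @derive1_quadratic R (fun y => c * y) x c 0 1 (lexx _) ltr01.
  by move=> h _; rewrite mul0r (_ : _ - _ = 0) ?normr0//; ring.
by apply: (DeriveDef d1); rewrite -derive1E.
Qed.

Lemma integrand_dx r m n k b z t : regular_on r b -> box r z -> 0 <= t -> t <= 1 ->
  is_derive z.1 1 (fun x => euler_integrand m n k b (x, z.2) t)
    (euler_integrand m n (k + m) (dx b) z t).
Proof.
move=> rb rz t0 t1; have [_ db _] := rb _ (box_curve m n rz t0 t1).
have dB : is_derive (t ^+ m * z.1) 1 (fun x => b (x, t ^+ n * z.2))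
   (dx b (t ^+ m * z.1, t ^+ n * z.2)).
  by apply: (DeriveDef db); rewrite /dx derive1E.
have dc := @is_derive1_comp _ (fun x => b (x, t ^+ n * z.2)) (fun x : R => t ^+ m * x) z.1 _ _ dB
  (is_derive_mull _ _).
rewrite (_ : euler_integrand _ _ _ _ _ _ = t ^+ k * (dx b (t ^+ m * z.1, t ^+ n * z.2) * t ^+ m)).
  exact: (@is_derive1_comp _ (fun y : R => t ^+ k * y) _ z.1 _ _ (is_derive_mull _ _) dc).
by rewrite /euler_integrand exprD; ring.
Qed.

(** Differentiation under the integral sign. The constant dominating the derivative is its maximum
    over [[0, 1]] at [z] plus [1], a bound that persists near [z.1] by compactness. Each
    [x]-derivative brings out a factor [t ^+ m], hence the exponent [k + m]. *)
Lemma euler_integral_dx r m n k b z : regular_on r b -> continuous_on r (dx b) -> box r z ->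
  derivable (fun x => euler_integral m n k b (x, z.2)) z.1 1 /\
  dx (euler_integral m n k b) z = euler_integral m n (k + m) (dx b) z.
Proof.
move=> rb cdb rz.
have cb : continuous_on r b by move=> w rw; have [] := rb w rw.
have [M0 M0P] := cont01_bounded (@cont01_integrand r m n (k + m) _ z cdb rz).
have bnd : \forall x \near z.1, forall t, 0 <= t -> t <= 1 ->
    `|euler_integrand m n (k + m) (dx b) (x, z.2) t| <= M0 + 1.
  apply: (near01 (P := fun x t =>
    `|euler_integrand m n (k + m) (dx b) (x, z.2) t| <= M0 + 1)) => t t0 t1.
  have pz : (p.1, (p.2, z.2)) @[p --> (t, z.1)] --> (t, z).
    rewrite [z in _ --> (t, z)]surjective_pairing.
    exact (cvg_pair cvg_fst (cvg_pair cvg_snd (cvg_cst z.2))).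
  have c := cvg_comp _ _ pz (@integrand_continuous r m n (k + m) _ z t cdb rz t0 t1).
  have lt : `|euler_integrand m n (k + m) (dx b) z t| < M0 + 1.
    by rewrite (le_lt_trans (M0P t t0 t1))// ltrDl.
  by apply: filterS (cvgr_norm_le _ c _ lt) => -[t' x'].
have inbox : \forall x \near z.1, box r (x, z.2).
  by have [z1 z2] := rz; apply: filterS (open_nbhs_nbhs (conj (@norm_lt_open _ r) z1)).
have /nbhs_ballP[d /= d0 dP] : nbhs z.1 [set x | (forall t, 0 <= t -> t <= 1 ->
    `|euler_integrand m n (k + m) (dx b) (x, z.2) t| <= M0 + 1) /\ box r (x, z.2)].
  by apply: filterS2 bnd inbox.
pose u := z.1 - d; pose v := z.1 + d.
have Iz : `]u, v[%classic z.1 by rewrite /= in_itv /= ltrBlDr ltrDl d0.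
have IP x : `]u, v[%classic x -> (forall t, 0 <= t -> t <= 1 ->
    `|euler_integrand m n (k + m) (dx b) (x, z.2) t| <= M0 + 1) /\ box r (x, z.2).
  rewrite /= in_itv /= => /andP[ux xv]; apply: dP.
  by rewrite -ball_normE /= distrC ltr_distl ux.
pose f x t := euler_integrand m n k b (x, z.2) t.
have intf x : `]u, v[%classic x -> (@lebesgue_measure R).-integrable `[0, 1] (EFin \o f x).
  by move=> /IP[_ rx]; apply: cont01_integrable; exact: cont01_integrand cb rx.
have drf x t : `]u, v[%classic x -> `[0, 1]%classic t -> is_derive x 1 (f ^~ t)
    (euler_integrand m n (k + m) (dx b) (x, z.2) t).
  move=> /IP[_ rx]; rewrite /= in_itv /= => /andP[t0 t1].
  exact: (@integrand_dx r m n k b (x, z.2) t rb rx t0 t1).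
have drf1 x t : `]u, v[%classic x -> `[0, 1]%classic t -> derivable (f ^~ t) x 1.
  by move=> ux t01; have := drf x t ux t01 => dft; exact: ex_derive.
have M1 : 0 <= M0 + 1.
  by rewrite addr_ge0// (le_trans _ (M0P 0 (lexx _) ler01)).
have intG : (@lebesgue_measure R).-integrable `[0, 1] (EFin \o cst (M0 + 1)).
  by apply: cont01_integrable => t t0 t1; exact: cvg_cst.
have Gub x t : `]u, v[%classic x -> `[0, 1]%classic t -> `|partial1of2 f x t| <= M0 + 1.
  move=> ux t01; have dft := drf x t ux t01.
  rewrite partial1of2E derive_val; have [H _] := IP _ ux.
  by move: t01; rewrite /= in_itv /= => /andP[t0 t1]; exact: H.
have m01 : measurable (`[0, 1]%classic : set (measurableTypeR R)) by exact: measurable_itv.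
split; first exact: (derivable_under_integral m01 Iz intf drf1 (fun=> M1) intG Gub).
rewrite /dx; apply: (etrans (differentiation_under_integral m01 Iz intf drf1 (fun=> M1) intG Gub)).
apply: eq_Rintegral => t; rewrite inE => t01.
by have dft := drf _ t Iz t01; rewrite partial1of2E derive_val -surjective_pairing.
Qed.

(** Exchanging the coordinates together with [m] and [n] leaves the integrand unchanged, so the
    statement on [dx] applies to [flip b]. *)
Lemma euler_integral_dy r m n k b z : regular_on r b -> continuous_on r (dy b) -> box r z ->
  derivable (fun y => euler_integral m n k b (z.1, y)) z.2 1 /\
  dy (euler_integral m n k b) z = euler_integral m n (k + n) (dy b) z.
Proof.
move=> rb cdb [z1 z2].
have cf : continuous_on r (dx (flip b)).
  move=> [x y] [/= rx ry].
  exact: (cvg_comp _ _ (@swap_continuous R R (x, y)) (cdb (y, x) (conj ry rx))).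
exact: (@euler_integral_dx r n m k (flip b) (z.2, z.1) (regular_on_flip rb) cf (conj z2 z1)).
Qed.

Lemma is_derive_pow m t : is_derive t 1 (fun s : R => s ^+ m) (m%:R * t ^+ m.-1).
Proof.
elim: m => [|m IH].
  rewrite mul0r (_ : (fun s : R => s ^+ 0) = cst 1); first exact: is_derive_cst.
  by apply/funext => s; rewrite expr0.
have -> : (fun s : R => s ^+ m.+1) = (fun s => s ^+ m) * id.
  by apply/funext => s; exact: exprSr.
have := @is_deriveM _ _ (fun s : R => s ^+ m) id t 1 _ _ IH (is_derive_id t 1).
congr (is_derive _ _ _ _); rewrite /GRing.scale /= mulr1 -natr1.
case: m {IH} => [|m] /=; first by rewrite !mul0r mulr0; ring.
by rewrite exprS; ring.
Qed.

Lemma smooth_regular_on r b : smooth_on (box r) b -> regular_on r b.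
Proof. by move=> sb w rw; exact: smooth_on_regular sb rw. Qed.

Lemma smooth_continuous_on r b : smooth_on (box r) b -> continuous_on r b.
Proof. by move=> sb w rw; have [] := smooth_on_regular sb rw. Qed.

Definition euler_op m n k b : R * R -> R := fun z =>
  m%:R * (z.1 * dx b z) + n%:R * (z.2 * dy b z) + k%:R * b z.

Lemma euler_op_smooth r m n k b : smooth_on (box r) b -> smooth_on (box r) (euler_op m n k b).
Proof.
move=> sb; apply: smooth_closureP; first exact: box_open.
have sx := SmoothBase (smooth_on_dx sb); have sy := SmoothBase (smooth_on_dy sb).
apply: SmoothAdd; last by apply: SmoothMul; [exact: SmoothCst|exact: SmoothBase].
apply: SmoothAdd; apply: SmoothMul; try exact: SmoothCst.
  by apply: SmoothMul; [exact: SmoothX|].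
by apply: SmoothMul; [exact: SmoothY|].
Qed.

(* The integrand is the derivative of t |-> t^(k+1) b(t^m x, t^n y). *)
Lemma euler_integral_op r m n k b z : smooth_on (box r) b -> box r z ->
  euler_integral m n k (euler_op m n k.+1 b) z = b z.
Proof.
move=> sb rz; have rb := smooth_regular_on sb.
have cdx := smooth_continuous_on (smooth_on_dx sb).
have cop := smooth_continuous_on (euler_op_smooth m n k.+1 sb).
have cphi := @cont01_integrand r m n k _ z cop rz.
have dF t : 0 <= t -> t <= 1 ->
    is_derive t 1 (fun s => s ^+ k.+1 * b (s ^+ m * z.1, s ^+ n * z.2))
      (euler_integrand m n k (euler_op m n k.+1 b) z t).
  move=> t0 t1; have rt := box_curve m n rz t0 t1.
  have dp l (c : R) : is_derive t 1 (fun s : R => s ^+ l * c) (c * (l%:R * t ^+ l.-1)).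
    have := @is_derive1_comp _ (fun x : R => c * x) (fun s : R => s ^+ l) t _ _
      (is_derive_mull _ _) (is_derive_pow l t).
    by congr (is_derive _ _ _ _); apply/funext => s; exact: mulrC.
  have dc := @is_derive_curve R r b (fun s => s ^+ m * z.1) (fun s => s ^+ n * z.2) t _ _
    rb (cdx _ rt) rt (dp m z.1) (dp n z.2).
  have := @is_deriveM _ _ _ _ t 1 _ _ (is_derive_pow k.+1 t) dc.
  congr (is_derive _ _ _ _); rewrite /GRing.scale /= /euler_integrand /euler_op /= exprS.
  have pow l : t * t ^+ k * (l%:R * t ^+ l.-1) = t ^+ k * (l%:R * t ^+ l).
    by case: l => [|l] /=; [rewrite !mul0r !mulr0 | rewrite exprS; ring].
  transitivity (z.1 * (t * t ^+ k * (m%:R * t ^+ m.-1)) * dx b (t ^+ m * z.1, t ^+ n * z.2) +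
     (z.2 * (t * t ^+ k * (n%:R * t ^+ n.-1)) * dy b (t ^+ m * z.1, t ^+ n * z.2) +
     b (t ^+ m * z.1, t ^+ n * z.2) * (k.+1%:R * t ^+ k))); first ring.
  by rewrite !pow; ring.
rewrite /euler_integral (integral01_FTC cphi dF) !expr1n expr0n /= mul0r subr0 !mul1r.
by rewrite -surjective_pairing.
Qed.

(** Differentiation under the integral shows that the operator commutes with its integral; the right
    inverse thus reduces to the left inverse [euler_integral_op]. *)
Lemma euler_op_integral r m n k b z : smooth_on (box r) b -> box r z ->
  euler_op m n k.+1 (euler_integral m n k b) z = b z.
Proof.
move=> sb rz; have rb := smooth_regular_on sb; have cb := smooth_continuous_on sb.
have cdx := smooth_continuous_on (smooth_on_dx sb).
have cdy := smooth_continuous_on (smooth_on_dy sb).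
rewrite /euler_op (@euler_integral_dx r m n k b z rb cdx rz).2.
rewrite (@euler_integral_dy r m n k b z rb cdy rz).2 -(euler_integral_op m n k sb rz).
pose A := euler_integrand m n (k + m) (dx b) z.
pose B := euler_integrand m n (k + n) (dy b) z.
pose C := euler_integrand m n k b z.
have cA : cont01 A by exact: cont01_integrand cdx rz.
have cB : cont01 B by exact: cont01_integrand cdy rz.
have cC : cont01 C by exact: cont01_integrand cb rz.
have cZ c (g : R -> R) : cont01 g -> cont01 (fun t => c * g t).
  by move=> cg t t0 t1; apply: cvgMl_tmp; exact: cg.
have cG c (g h : R -> R) : cont01 g -> cont01 h -> cont01 (fun t => c * g t + h t).
  by move=> cg ch t t0 t1; apply: cvgD; [exact: cZ|exact: ch].
have E3 : integral01 (fun t => k%:R * C t + C t) = k%:R * integral01 C + integral01 C.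
  exact: integral01_linear.
have E2 : integral01 (fun t => n%:R * z.2 * B t + (k%:R * C t + C t)) =
    n%:R * z.2 * integral01 B + integral01 (fun t => k%:R * C t + C t).
  by apply: integral01_linear => //; exact: cG.
have E1 : integral01 (fun t => m%:R * z.1 * A t + (n%:R * z.2 * B t + (k%:R * C t + C t))) =
    m%:R * z.1 * integral01 A + integral01 (fun t => n%:R * z.2 * B t + (k%:R * C t + C t)).
  by apply: integral01_linear => //; exact: (cG _ _ _ cB (cG _ _ _ cC cC)).
have alg (u v w : R) : m%:R * (z.1 * u) + n%:R * (z.2 * v) + k.+1%:R * w =
    m%:R * z.1 * u + (n%:R * z.2 * v + (k%:R * w + w)) by rewrite -natr1; ring.
apply: (etrans (alg (integral01 A) (integral01 B) (integral01 C))).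
have E := etrans E1 (congr1 (+%R _) (etrans E2 (congr1 (+%R _) E3))).
apply: (etrans (esym E)); rewrite /euler_integral; congr (integral01 _); apply/funext => t.
by rewrite /A /B /C /euler_integrand /euler_op /= !exprD -natr1; ring.
Qed.

(** The coinductive family lets [k] and [b] vary, because a derivative changes both. *)
Lemma euler_integral_smooth r m n k b : smooth_on (box r) b ->
  smooth_on (box r) (euler_integral m n k b).
Proof.
move=> sb.
apply: (smooth_on_coind (P := fun g => exists k b, smooth_on (box r) b /\ g = euler_integral m n k b)).
- exact: box_open.
- move=> {k b sb} _ [k [b [sb ->]]].
  have rb := smooth_regular_on sb.
  have cb := smooth_continuous_on sb; have cdx := smooth_continuous_on (smooth_on_dx sb).
  have cdy := smooth_continuous_on (smooth_on_dy sb).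
  split.
  + move=> z rz; split; first exact: (@euler_integral_continuous r m n k b cb z rz).
      exact: (@euler_integral_dx r m n k b z rb cdx rz).1.
    exact: (@euler_integral_dy r m n k b z rb cdy rz).1.
  + exists (euler_integral m n (k + m) (dx b)).
      by exists (k + m)%N, (dx b); split; [exact: smooth_on_dx|].
    by move=> z /[!inE] rz; exact: (@euler_integral_dx r m n k b z rb cdx rz).2.
  + exists (euler_integral m n (k + n) (dy b)).
      by exists (k + n)%N, (dy b); split; [exact: smooth_on_dy|].
    by move=> z /[!inE] rz; exact: (@euler_integral_dy r m n k b z rb cdy rz).2.
by exists k, b.
Qed.

Lemma euler_op_inj r m n k b : smooth_on (box r) b ->
  (forall z, box r z -> euler_op m n k.+1 b z = 0) -> forall z, box r z -> b z = 0.
Proof.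
move=> sb b0 z rz; rewrite -(euler_integral_op m n k sb rz).
have cop := smooth_continuous_on (euler_op_smooth m n k.+1 sb).
apply/eqP; rewrite -normr_le0; apply: integral01_bound.
  exact: cont01_integrand cop rz.
by move=> t t0 t1; rewrite /euler_integrand b0 ?mulr0 ?normr0//; exact: box_curve.
Qed.

Lemma dx0_const r b : regular_on r b -> (forall z, box r z -> dx b z = 0) ->
  forall z, box r z -> b z = b (0, z.2).
Proof.
move=> rb b0 [x y] [/= rx ry].
have r0 : box r (0, y) by split=> //=; rewrite normr0 (le_lt_trans _ rx).
have [xi [xi1 _ E]] := mvt_dx rb r0 (conj rx ry).
apply/eqP; rewrite -subr_eq0 E b0 ?mul0r//; split=> //=.
by move: xi1; rewrite !subr0 => /le_lt_trans; exact.
Qed.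

Lemma dxy0_const r b : regular_on r b -> (forall z, box r z -> dx b z = 0) ->
  (forall z, box r z -> dy b z = 0) -> forall z, box r z -> b z = b 0.
Proof.
move=> rb bx by0 z rz; rewrite (dx0_const rb bx rz).
have [_ z2] := rz.
have r0 : box r (z.2, 0) by split=> //=; rewrite normr0 (le_lt_trans _ z2).
apply: (dx0_const (regular_on_flip rb) _ r0) => -[x y] [rx ry].
exact: (by0 (y, x) (conj ry rx)).
Qed.

(* Schwarz: U = U(0, y) + x V with V the Euler integral of dU/dx, and the
   Euler integral commutes with d/dy. *)
Lemma dx_dy_comm r b : smooth_on (box r) b -> forall z, box r z -> dx (dy b) z = dy (dx b) z.
Proof.
move=> sb; have oU := @box_open _ r.
have sdx := smooth_on_dx sb; have sdyx := smooth_on_dy sdx.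
(* With parameters [1 0 0] the integral inverts [g |-> x dg/dx + g], the [x]-derivative of [x g];
   hence [x V] is the primitive of [dx b] that vanishes on [x = 0], and [W] will be [dy V]. *)
pose V := euler_integral 1 0 0 (dx b); pose W := euler_integral 1 0 0 (dy (dx b)).
have sV : smooth_on (box r) V by exact: euler_integral_smooth.
have sW : smooth_on (box r) W by exact: euler_integral_smooth.
have dxM (g : R * R -> R) z : smooth_on (box r) g -> box r z ->
    is_derive z.1 1 (fun t => t * g (t, z.2)) (z.1 * dx g z + g z).
  move=> sg rz; have [_ dg _] := smooth_on_regular sg rz.
  have dG : is_derive z.1 1 (fun t => g (t, z.2)) (dx g z).
    by apply: (DeriveDef dg); rewrite /dx derive1E.
  have := @is_deriveM _ _ id _ z.1 1 _ _ (is_derive_id _ _) dG.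
  by congr (is_derive _ _ _ _); rewrite /GRing.scale /= mulr1 -surjective_pairing.
have sG : smooth_on (box r) (fun z => b z + (-1) * (z.1 * V z)).
  apply: smooth_closureP => //; apply: SmoothAdd; first exact: SmoothBase.
  apply: SmoothMul; first exact: SmoothCst.
  by apply: SmoothMul; [exact: SmoothX|exact: SmoothBase].
have bV : {in box r, b =1 fun z => b (0, z.2) + z.1 * V z}.
  move=> z /[!inE] rz.
  have := @dx0_const r _ (smooth_regular_on sG) _ z rz; rewrite /= mul0r mulr0 addr0 => <-.
    ring.
  move=> {z rz}z rz; have [_ db _] := smooth_on_regular sb rz.
  have dB : is_derive z.1 1 (fun t => b (t, z.2)) (dx b z).
    by apply: (DeriveDef db); rewrite /dx derive1E.
  have dN := @is_derive1_comp _ (fun x : R => (-1) * x) (fun t => t * V (t, z.2)) z.1 _ _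
      (is_derive_mull _ _) (dxM V z sV rz).
  have dS := is_deriveD dB dN.
  rewrite /dx derive1E (@derive_val _ _ _ _ _ _ _ dS) -/(dx b z).
  have := euler_op_integral 1 0 0 sdx rz; rewrite /euler_op -/V => <-; ring.
have byW : {in box r, dy b =1 fun z => dy b (0, z.2) + z.1 * W z}.
  move=> z rz; rewrite (eq_dy oU bV rz); move: rz; rewrite inE => rz.
  have r0 : box r (0, z.2).
    by have [z1 z2] := rz; split=> //=; rewrite normr0 (le_lt_trans _ z1).
  have [_ _ db] := smooth_on_regular sb r0; have [_ _ dV] := smooth_on_regular sV rz.
  have dB : is_derive z.2 1 (fun t => b (0, t)) (dy b (0, z.2)).
    by apply: (DeriveDef db); rewrite /dy derive1E.
  have dV' : is_derive z.2 1 (fun t => V (z.1, t)) (dy V z).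
    by apply: (DeriveDef dV); rewrite /dy derive1E.
  have dN := @is_derive1_comp _ (fun x : R => z.1 * x) (fun t => V (z.1, t)) z.2 _ _
      (is_derive_mull _ _) dV'.
  have dS := is_deriveD dB dN.
  rewrite /dy derive1E (@derive_val _ _ _ _ _ _ _ dS); congr (_ + _ * _).
  exact: (@euler_integral_dy r 1 0 0 (dx b) z (smooth_regular_on sdx)
    (smooth_continuous_on sdyx) rz).2.
move=> z rz; rewrite (eq_dx oU byW) ?inE//.
have dS := is_deriveD (is_derive_cst (dy b (0, z.2)) z.1 1) (dxM W z sW rz).
rewrite /dx derive1E (@derive_val _ _ _ _ _ _ _ dS) -/(dx W z).
have := euler_op_integral 1 0 0 sdyx rz; rewrite /euler_op -/W => <-; ring.
Qed.

End EulerIntegral.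

Section SmoothGerms.
Context {R : realType}.
Local Notation K := (R : numFieldType).
Implicit Types (u v : @germ K) (f : R * R -> R).

Lemma germs_smooth r f : 0 < r -> smooth_on (box r) f -> @germs K Smooth (germ_of f).
Proof.
move=> r0 sf; exists f => //; split; last by left.
by apply/smooth_boxP; exists r.
Qed.

Lemma smooth_germs u : germs Smooth u ->
  exists r f, [/\ 0 < r, smooth_on (box r) f & u = germ_of f].
Proof. by move=> [f [/smooth_boxP[r r0 sf] _] <-]; exists r, f. Qed.

Lemma germ_of0P f : germ_of f = 0 :> @germ K -> exists2 r, 0 < r & forall z, box r z -> f z = 0.
Proof. by rewrite -germ_of0 => /germ_ofP/near_boxP. Qed.

Lemma smooth_calculus : @germ_calculus K Smooth.
Proof.
split.
- rewrite -germ_of1; apply: (@germs_smooth 1) => //.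
  by apply: smooth_closureP; [exact: box_open|exact: SmoothCst].
- apply: (@germs_smooth 1) => //.
  by apply: smooth_closureP; [exact: box_open|exact: SmoothX].
- apply: (@germs_smooth 1) => //.
  by apply: smooth_closureP; [exact: box_open|exact: SmoothY].
- move=> u v /smooth_germs[r [f [r0 sf ->]]] /smooth_germs[s [g [s0 sg ->]]].
  have [q q0 [qr qs]] := real_min2 r0 s0; rewrite -germ_ofM; apply: (germs_smooth q0).
  apply: smooth_closureP; first exact: box_open.
  apply: SmoothMul; apply: SmoothBase.
    by apply: smooth_on_sub sf => z; exact: box_le.
  by apply: smooth_on_sub sg => z; exact: box_le.
- move=> u /smooth_germs[r [f [r0 sf ->]]]; rewrite germ_dxE.
  exact: germs_smooth r0 (smooth_on_dx sf).
- move=> u /smooth_germs[r [f [r0 sf ->]]]; rewrite germ_dyE.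
  exact: germs_smooth r0 (smooth_on_dy sf).
- move=> u /smooth_germs[r [f [r0 sf ->]]]; rewrite !(germ_dxE, germ_dyE).
  by apply: (germ_of_box r0) => z; exact: dx_dy_comm.
- move=> m n [//|k] u _ /smooth_germs[r [f [r0 sf ->]]].
  exists (germ_of (euler_integral m n k f)).
    exact: germs_smooth r0 (euler_integral_smooth _ _ _ sf).
  rewrite germ_euler; apply: (germ_of_box r0) => z.
  exact: euler_op_integral.
- move=> m n [//|k] v _ /smooth_germs[r [f [r0 sf ->]]].
  rewrite germ_euler => /germ_of0P[s s0 fs].
  have [q q0 [qr qs]] := real_min2 r0 s0; rewrite -germ_of0; apply: (germ_of_box q0).
  apply: (@euler_op_inj _ q m n k f).
    by apply: smooth_on_sub sf => z; exact: box_le.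
  by move=> z qz; apply: fs; exact: box_le qz.
- move=> u /smooth_germs[r [f [r0 sf ->]]]; rewrite germ_dxE germ_dyE.
  move=> /germ_of0P[s s0 fx] /germ_of0P[t t0 fy].
  have [p p0 [pr ps]] := real_min2 r0 s0; have [q q0 [qp qt]] := real_min2 p0 t0.
  exists (f 0); rewrite -germ_ofA; apply: (germ_of_box q0).
  apply: (@dxy0_const _ q f).
  + apply: smooth_regular_on; apply: smooth_on_sub sf => z /(box_le qp); exact: box_le.
  + by move=> z /(box_le qp) /(box_le ps); exact: fx.
  + by move=> z /(box_le qt); exact: fy.
- move=> f /smooth_germs[r [g [r0 sg fg]]] f0; rewrite fg.
  have g0 : g 0 = 1 by rewrite -f0; move/germ_ofP: fg => /nbhs_singleton; exact: esym.
  have cg : {for 0, continuous g} by have [] := smooth_on_regular sg (box0 r0).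
  have : \forall z \near (0 : K * K), g z != 0.
    have : g 0 != 0 by rewrite g0 oner_neq0.
    by move/(cvgr_neq0 _ cg).
  move=> /near_boxP[s s0 gs].
  have [q q0 [qr qs]] := real_min2 r0 s0.
  exists (germ_of (fun z => (g z)^-1)).
    apply: (germs_smooth q0); apply: smooth_closureP; first exact: box_open.
    apply: SmoothInv; last by move=> z /(box_le qs); exact: gs.
    by apply/SmoothBase; apply: smooth_on_sub sg => z; exact: box_le.
  rewrite -germ_ofM -germ_of1; apply: (germ_of_box q0) => z /(box_le qs) /gs gz.
  exact: mulfV.
Qed.

End SmoothGerms.

Lemma base_calculus (R : realType) (c : category) : @germ_calculus (base_field R c) c.
Proof.
case: c => /=; last exact: smooth_calculus.
- by apply: analytic_calculus => //; exact: complex_summable_field.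
- by apply: analytic_calculus => //; exact: real_summable_field.
Qed.

(** * Poisson cohomology *)

Section GermAlgebra.
Context {K : numFieldType} {c : category}.
Variable GC : @germ_calculus K c.

(** The calculus is an argument of the predicate so that the subalgebra structure, whose closure
    under products comes from it, can be attached to the predicate. *)
Definition in_germs of @germ_calculus K c : {pred @germ K} := fun u => `[<germs c u>].

Lemma in_germsP u : reflect (germs c u) (u \in in_germs GC).
Proof. exact: asboolP. Qed.

Fact in_germs_subalg : GRing.subalg_closed (in_germs GC).
Proof.
split.
- by apply/in_germsP; exact: gc_one.
- by move=> a u v /in_germsP gu /in_germsP gv; apply/in_germsP; exact: germs_linear.
- by move=> u v /in_germsP gu /in_germsP gv; apply/in_germsP; exact: gc_mul.
Qed.

HB.instance Definition _ := GRing.isSubalgClosed.Build K (@germ K) (in_germs GC)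
  in_germs_subalg.

(** The ambient ring contains germs of arbitrary functions, on which [germ_dx] and [germ_dy] need
    not be additive; the derivations of a plane algebra exist only on the germs of the category. *)
Record germ_alg := GermAlg { germ_val : @germ K; germ_valP : germ_val \in in_germs GC }.

HB.instance Definition _ := [isSub for germ_val].
HB.instance Definition _ := [Choice of germ_alg by <:].
HB.instance Definition _ := [SubChoice_isSubComNzRing of germ_alg by <:].
HB.instance Definition _ := [SubZmodule_isSubLmodule of germ_alg by <:].

Fact germ_alg_scaleAl (a : K) (u v : germ_alg) : a *: (u * v) = a *: u * v.
Proof.
apply: val_inj; change (a *: (germ_val u * germ_val v) = a *: germ_val u * germ_val v).
exact: germ_scaleAl.
Qed.

HB.instance Definition _ := GRing.Lmodule_isLalgebra.Build K germ_alg germ_alg_scaleAl.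
HB.instance Definition _ := GRing.Lalgebra_isComAlgebra.Build K germ_alg.

Lemma germ_valD u v : germ_val (u + v) = germ_val u + germ_val v. Proof. by []. Qed.
Lemma germ_valN u : germ_val (- u) = - germ_val u. Proof. by []. Qed.
Lemma germ_valM u v : germ_val (u * v) = germ_val u * germ_val v. Proof. by []. Qed.
Lemma germ_valZ (a : K) u : germ_val (a *: u) = a *: germ_val u. Proof. by []. Qed.
Lemma germ_val0 : germ_val 0 = 0. Proof. by []. Qed.

Lemma germ_val_inj u v : germ_val u = germ_val v -> u = v.
Proof. exact: val_inj. Qed.

Lemma germ_alg_germs (u : germ_alg) : germs c (germ_val u).
Proof. exact/in_germsP/germ_valP. Qed.

Definition to_germ_alg u (gu : germs c u) : germ_alg := GermAlg (introT (in_germsP u) gu).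

Definition gdx (u : germ_alg) := to_germ_alg (gc_dx GC (germ_alg_germs u)).
Definition gdy (u : germ_alg) := to_germ_alg (gc_dy GC (germ_alg_germs u)).
Definition gX := to_germ_alg (gc_x GC).
Definition gY := to_germ_alg (gc_y GC).

Fact gdx_linear : linear gdx.
Proof.
move=> a u v; apply: germ_val_inj.
exact: (germ_partial_linear a (germ_alg_germs u) (germ_alg_germs v)).1.
Qed.

Fact gdy_linear : linear gdy.
Proof.
move=> a u v; apply: germ_val_inj.
exact: (germ_partial_linear a (germ_alg_germs u) (germ_alg_germs v)).2.
Qed.

HB.instance Definition _ := GRing.isLinear.Build K germ_alg germ_alg _ gdx gdx_linear.
HB.instance Definition _ := GRing.isLinear.Build K germ_alg germ_alg _ gdy gdy_linear.

Lemma germ_reduced (u : @germ K) : u * u = 0 -> u = 0.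
Proof.
rewrite -[u]reprK -!/(germ_of _) -germ_ofM -germ_of0 => /germ_ofP uu.
apply/germ_ofP; apply: filterS uu => z uz; apply/eqP.
by have /eqP : repr u z * repr u z = 0 := uz; rewrite mulf_eq0 orbb.
Qed.

Lemma nat_scaleE (n : nat) (u v : germ_alg) : n%:R * u * v = n%:R *: (u * v).
Proof. by rewrite scaler_nat -mulrA mulr_natl. Qed.

Lemma germ_val_euler (a b k : nat) v :
  germ_val (a%:R * gX * gdx v + b%:R * gY * gdy v + k%:R * v) =
  a%:R *: (germ_x * germ_dx (germ_val v)) + b%:R *: (germ_y * germ_dy (germ_val v)) +
    k%:R *: germ_val v.
Proof.
rewrite !nat_scaleE [k%:R * v]mulr_natl -[v *+ k]scaler_nat !germ_valD.
by rewrite (germ_valZ a%:R) (germ_valZ b%:R) (germ_valZ k%:R) !germ_valM.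
Qed.

Lemma germ_alg_plane : plane_algebra gdx gdy gX gY.
Proof.
split.
- by move=> u v; apply: germ_val_inj; exact: (germs_leibniz (germ_alg_germs u) (germ_alg_germs v)).1.
- by move=> u v; apply: germ_val_inj; exact: (germs_leibniz (germ_alg_germs u) (germ_alg_germs v)).2.
- by apply: germ_val_inj; exact: germ_dx_x.
- by apply: germ_val_inj; exact: germ_dx_y.
- by apply: germ_val_inj; exact: germ_dy_x.
- by apply: germ_val_inj; exact: germ_dy_y.
- by move=> u; apply: germ_val_inj; exact: (gc_comm GC (germ_alg_germs u)).
- move=> a b k u k0; have [v gv E] := gc_surj GC a b k0 (germ_alg_germs u).
  exists (to_germ_alg gv); apply: germ_val_inj; rewrite -E.
  exact: germ_val_euler.
- move=> a b k v k0 E; apply: germ_val_inj; apply: (gc_inj GC (m := a) (n := b) k0 (germ_alg_germs v)).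
  by rewrite -germ_val_euler E.
- move=> u ux uy; have [k E] := gc_const GC (germ_alg_germs u) (congr1 germ_val ux) (congr1 germ_val uy).
  by exists k; apply: germ_val_inj.
- move=> a b; set w := 1 + gX * a + gY * b.
  have [f _ fw] := germ_alg_germs w.
  (* The value at the origin is the same for all representatives of a germ, so it can be computed
     from representatives of [a] and [b]. *)
  have f0 : f 0 = 1.
    have [ra _ fa] := germ_alg_germs a; have [rb _ fb] := germ_alg_germs b.
    have : germ_of f = germ_of (1 + (fun z => z.1) * ra + (fun z => z.2) * rb).
      by rewrite fw !germ_ofD !germ_ofM fa fb germ_of1.
    move/germ_ofP/nbhs_singleton => ->.
    have -> : (1 + (fun z : K * K => z.1) * ra + (fun z => z.2) * rb) 0 =
       1 + 0 * ra 0 + 0 * rb 0 by [].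
    by rewrite !mul0r !addr0.
  have gf : germs c (germ_of f) by rewrite fw; exact: germ_alg_germs.
  have [u gu E] := gc_unit GC gf f0.
  by exists (to_germ_alg gu); apply: germ_val_inj; rewrite germ_valM -fw.
- by move=> u uu; apply: germ_val_inj; apply: germ_reduced; exact: (congr1 germ_val uu).
Qed.

Lemma germ_val_sum (I : finType) (F : I -> germ_alg) :
  germ_val (\sum_i F i) = \sum_i germ_val (F i).
Proof. exact: (big_morph germ_val germ_valD germ_val0). Qed.

Lemma germ_valX (u : germ_alg) n : germ_val (u ^+ n) = germ_val u ^+ n.
Proof. by elim: n => [|n IH] //; rewrite !exprS germ_valM IH. Qed.

Lemma germ_of_exp (f : K * K -> K) n : germ_of (fun z => f z ^+ n) = germ_of f ^+ n.
Proof.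
elim: n => [|n IH]; last rewrite exprS -IH -germ_ofM.
  rewrite expr0 -germ_of1; congr germ_of; apply/funext => z; exact: expr0.
by congr germ_of; apply/funext => z; exact: exprS.
Qed.

Lemma poly_germD (p q : mpoly 2 K) : poly_germ (p + q) = poly_germ p + poly_germ q.
Proof.
by rewrite /poly_germ -germ_ofD; congr germ_of; apply/funext => z; rewrite mevalD.
Qed.

Lemma poly_germE (p : mpoly 2 K) : poly_germ p = germ_val (@peval K germ_alg gX gY p).
Proof.
elim/mpolyind: p => [|a m p _ _ IH].
  rewrite raddf0 germ_val0 -germ_of0; congr germ_of; apply/funext => z.
  exact: meval0.
rewrite poly_germD IH [peval (_ + _)]rmorphD/=; congr (_ + _); rewrite pevalZ germ_valZ pevalX.
rewrite germ_valM !germ_valX -[germ_val gX]/germ_x -[germ_val gY]/germ_y.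
rewrite -(germ_of_exp fst) -(germ_of_exp snd) -germ_ofM -germ_ofZ.
congr germ_of; apply/funext => z; rewrite mevalZ mevalX !big_ord_recl big_ord0 mulr1.
by congr (_ * (_ ^+ m _ * _ ^+ m _)); apply: val_inj.
Qed.

End GermAlgebra.

Section PoissonCohomology.
Context {K : numFieldType} {c : category}.
Variable GC : @germ_calculus K c.
Local Notation T := (germ_alg GC).
Local Notation PA := (germ_alg_plane GC).
Local Notation x := (gX GC).
Local Notation y := (gY GC).

Lemma germ_val_linear (a : K) (A B : T) : a *: germ_val A + germ_val B = germ_val (a *: A + B).
Proof. by rewrite germ_valD germ_valZ. Qed.

Lemma germ_val_sub (A B : T) : germ_val A - germ_val B = germ_val (A - B).
Proof. by rewrite germ_valD germ_valN. Qed.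

Definition vf_val (A B : T) : @vfield K := (germ_val A, germ_val B).

Lemma cocycleP (F : T) (A B : T) :
  reflect (A * gdx F + B * gdy F = (gdx A + gdy B) * F)
    (vf_val A B \in cocycle c (germ_val F)).
Proof.
have E : delta2 (germ_val F) (vf_val A B) =
    germ_val (A * gdx F + B * gdy F - (gdx A + gdy B) * F).
  by rewrite germ_valD germ_valN germ_valD !germ_valM germ_valD.
apply: (iffP idP) => [/asboolP[_ _]|AB].
  rewrite E => AB0; apply/eqP; rewrite -subr_eq0; apply/eqP.
  by apply: germ_val_inj; exact: AB0.
apply/asboolP; split; [exact: germ_alg_germs|exact: germ_alg_germs|].
by rewrite E AB subrr.
Qed.

Lemma coboundaryP (F : T) (A B : T) :
  reflect (exists k, A = F * gdy k /\ B = - (F * gdx k))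
    (vf_val A B \in coboundary c (germ_val F)).
Proof.
apply: (iffP idP) => [/asboolP[k gk [EA EB]]|[k [-> ->]]].
  exists (to_germ_alg GC gk); split; apply: germ_val_inj.
    by rewrite EA germ_valM.
  by rewrite EB germ_valN germ_valM mulrN.
apply/asboolP; exists (germ_val k); first exact: germ_alg_germs.
by rewrite /vf_val /delta1 /gscale /hamiltonian /= mulrN.
Qed.

Lemma cocycle_val (F : T) Z : Z \in cocycle c (germ_val F) -> exists A B : T, Z = vf_val A B.
Proof.
case: Z => a b /asboolP[/= ga gb _].
by exists (to_germ_alg GC ga), (to_germ_alg GC gb).
Qed.

Variables (w1 w2 : nat) (d : int) (f : mpoly 2 K).
Hypotheses (w1_gt0 : (0 < w1)%N) (w2_gt0 : (0 < w2)%N).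
Hypothesis f_homog : quasi_homogeneous w1 w2 d f.
Hypothesis f_codim : finite_codim c (poly_germ f).

Local Notation s := (d - w1%:Z - w2%:Z).
Local Notation pev := (@peval K T x y).
Local Notation W := (@eulerD K T (@gdx _ _ GC) (@gdy _ _ GC) x y w1 w2).

Let fT : T := pev f.
Let P : T := gdx fT.
Let Q : T := gdy fT.

Lemma quasi_homogeneousP (k : int) p : quasi_homogeneous w1 w2 k p <-> W (pev p) = k%:~R * pev p.
Proof.
rewrite (peval_euler PA) /quasi_homogeneous /=; split=> [->|E].
  by rewrite pevalZ scaler_int mulrzl.
apply/eqP; rewrite -subr_eq0; apply/eqP; apply: (peval_inj PA).
by rewrite rmorphB /= E pevalZ scaler_int mulrzl subrr.
Qed.

Let fT_homog : W fT = d%:~R * fT.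
Proof. exact/quasi_homogeneousP. Qed.

Lemma jacobian_finite : exists n (g : 'I_n -> T), forall u : T,
  exists (k : 'I_n -> K) (a b : T), u - \sum_i k i *: g i = a * P + b * Q.
Proof.
have [n [g [gg gP]]] := f_codim.
exists n, (fun i => to_germ_alg GC (gg i)) => u.
have [k [a ga [b gb E]]] := gP _ (germ_alg_germs u).
exists k, (to_germ_alg GC ga), (to_germ_alg GC gb); apply: germ_val_inj.
rewrite germ_valD germ_valN germ_val_sum germ_valD !germ_valM.
rewrite (poly_germE GC) in E; by rewrite [RHS]E.
Qed.

Lemma x_power_jacobian : exists N (a b : T), x ^+ N = a * P + b * Q.
Proof.
have [n [g gP]] := jacobian_finite; apply: (finite_codim_xX _ gP) => p p0.
have [k [l [a [l0 E]]]] := poly_at x p0.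
have [u uE] := unit_ne0 PA a 0 l0.
by exists k, (l%:A + x * a), u; split=> //; rewrite mulr0 addr0 in uE.
Qed.

Lemma y_power_jacobian : exists N (a b : T), y ^+ N = a * P + b * Q.
Proof.
have [n [g gP]] := jacobian_finite; apply: (finite_codim_xX _ gP) => p p0.
have [k [l [a [l0 E]]]] := poly_at y p0.
have [u uE] := unit_ne0 PA 0 a l0.
by exists k, (l%:A + y * a), u; split=> //; rewrite mulr0 addr0 in uE.
Qed.

Variables (v v' : T).
Hypothesis vv' : v * v' = 1.

Let F : @germ K := germ_val (fT * v).

(* v (l H_f + u W) *)
Definition generator (l : K) (u : T) : @vfield K :=
  vf_val (v * (l%:A * Q + u * (w1%:R * x))) (v * (- (l%:A * P) + u * (w2%:R * y))).

Lemma generator_linear a l u l' u' :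
  a *: generator l u + generator l' u' = generator (a * l + l') (a *: u + u').
Proof.
have A2 (A B : T) : a *: A + B = a%:A * A + B by rewrite mulr_algl.
have lE : (a * l + l')%:A = a%:A * l%:A + l'%:A :> T by rewrite scalerDl -scalerA mulr_algl.
by congr (_, _); apply: (etrans (germ_val_linear _ _ _)); congr germ_val; rewrite !A2 lE; ring.
Qed.

Lemma generator_mem_cocycle l u : W u = s%:~R * u -> generator l u \in cocycle c F.
Proof.
by move=> uE; apply/cocycleP/(unit_cocycle PA _ _ _ vv')/(generator_cocycle PA fT_homog).
Qed.

(** Dividing by [v] gives a cocycle of [f], to which the decomposition applies. Multiplying back
    turns its remainder [f H_k] into [(f v) H_k], which is exactly a coboundary of the new
    structure. *)
Lemma generator_span Z : Z \in cocycle c F -> exists l u, W u = s%:~R * u /\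
  Z - generator l u \in coboundary c F.
Proof.
move=> ZF; have [A [B ZE]] := cocycle_val ZF; move: ZF; rewrite ZE => /cocycleP AB.
have vA (C : T) : C = v * (v' * C) by rewrite mulrA vv' mul1r.
have {}AB : (v' * A) * P + (v' * B) * Q = (gdx (v' * A) + gdy (v' * B)) * fT.
  by apply/(unit_cocycle PA fT (v' * A) (v' * B) vv'); rewrite -!vA.
have := cocycle_decomposition PA w1_gt0 w2_gt0 fT_homog x_power_jacobian y_power_jacobian AB.
move=> [l [u [k [uE EA EB]]]]; exists l, u; split=> //.
have -> : vf_val A B - generator l u = vf_val (fT * v * gdy k) (- (fT * v * gdx k)).
  rewrite (vA A) (vA B) EA EB; congr (_, _); apply: (etrans (germ_val_sub _ _));
  by congr germ_val; rewrite -/P -/Q; ring.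
by apply/coboundaryP; exists k.
Qed.

(** Cancelling the unit [v] reduces the statement to [cocycle_independence] for [f]. *)
Lemma generator_free l u : W u = s%:~R * u -> generator l u \in coboundary c F ->
  l = 0 /\ u = 0.
Proof.
move=> uE /coboundaryP[k [EA EB]].
have v'v (A B : T) : v * A = fT * v * B -> A = fT * B.
  move=> E; transitivity (v * A * v'); first by rewrite mulrAC vv' mul1r.
  by rewrite E; transitivity (fT * B * (v * v')); [ring | rewrite vv' mulr1].
apply: (cocycle_independence PA w1_gt0 w2_gt0 fT_homog x_power_jacobian (k := k)) => //.
  exact: (v'v _ _ EA).
by rewrite -[RHS]mulrN; apply: v'v; rewrite [RHS]mulrN; exact: EB.
Qed.

End PoissonCohomology.

(** * Bases and linear isomorphisms *)

Section Bases.
Context {K : numFieldType}.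

Lemma big_option (V : nmodType) (I : finType) (F : option I -> V) :
  \sum_i F i = F None + \sum_i F (Some i).
Proof.
rewrite (bigD1 None)//=; congr (_ + _).
rewrite (reindex_omap Some id) /=; last by case.
by apply: eq_bigl => i; rewrite eqxx.
Qed.

Lemma basis_of_free (V : lmodType K) (I : finType) (b : I -> V) :
  (forall u, exists k : {ffun I -> K}, u = \sum_i k i *: b i) ->
  (forall k : {ffun I -> K}, \sum_i k i *: b i = 0 -> k = 0) ->
  is_basis_of [set: V] b.
Proof.
move=> span free; split=> // u _; have [k uk] := span u; exists k; split=> // k' uk'.
apply/eqP; rewrite -subr_eq0; apply/eqP/free.
under eq_bigr do rewrite !ffunE scalerBl.
by rewrite sumrB -uk -uk' subrr.
Qed.

Lemma basis_of_coord (V : lmodType K) (I : finType) (b : I -> V) :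
  is_basis_of [set: V] b -> exists2 co : V -> {ffun I -> K},
    (forall u, u = \sum_i co u i *: b i) & forall k : {ffun I -> K}, co (\sum_i k i *: b i) = k.
Proof.
move=> [_ bP]; have /choice[co coP] : forall u : V, exists k : {ffun I -> K}, u = \sum_i k i *: b i.
  by move=> u; have [k [uk _]] := bP u Logic.I; exists k.
exists co => // k; have [k' [_ uni]] := bP (\sum_i k i *: b i) Logic.I.
by rewrite -(uni _ (coP _)) (uni k).
Qed.

Lemma basis_isomorphism (V W : lmodType K) (I : finType) (b : I -> V) (b' : I -> W) :
  is_basis_of [set: V] b -> is_basis_of [set: W] b' ->
  exists phi : {linear V -> W}, bijective phi.
Proof.
move=> /basis_of_coord[co coE coK] /basis_of_coord[co' coE' coK'].
pose phi u := \sum_i co u i *: b' i.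
have lin : linear phi.
  move=> a u w; rewrite /phi.
  have -> : co (a *: u + w) = [ffun i => a * co u i + co w i].
    rewrite -[RHS]coK; congr co; rewrite {1}[u]coE {1}[w]coE scaler_sumr -big_split/=.
    by apply: eq_bigr => i _; rewrite ffunE scalerDl scalerA.
  rewrite scaler_sumr -big_split/=; apply: eq_bigr => i _.
  by rewrite ffunE scalerDl scalerA.
pose phiL : {linear V -> W} := HB.pack phi (GRing.isLinear.Build K V W _ phi lin).
exists phiL.
exists (fun w => \sum_i co' w i *: b i) => u /=; rewrite /phi.
  by rewrite coK' -coE.
by rewrite coK -coE'.
Qed.

End Bases.

(** * The basis of the cohomology of [f v] for an arbitrary unit [v] *)

Section PoissonBasis.
Context {K : numFieldType} {c : category}.
Variable GC : @germ_calculus K c.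
Variables (w1 w2 : nat) (d : int) (f : mpoly 2 K).
Hypotheses (w1_gt0 : (0 < w1)%N) (w2_gt0 : (0 < w2)%N).
Hypothesis f_homog : quasi_homogeneous w1 w2 d f.
Hypothesis f_codim : finite_codim c (poly_germ f).
Local Notation s := (d - w1%:Z - w2%:Z).
Variables (r : nat) (e : 'I_r -> mpoly 2 K).
Hypothesis e_basis : is_basis_of (quasi_homogeneous w1 w2 s) e.
Variables (v v' F : @germ K).
Hypotheses (gv : germs c v) (gv' : germs c v') (vv' : v * v' = 1).
Hypothesis FE : F = poly_germ f * v.

Definition poisson_field (i : option 'I_r) : @vfield K :=
  if i is Some j then gscale (v * poly_germ (e j)) (euler_field w1 w2)
  else gscale v (hamiltonian (poly_germ f)).

Local Notation T := (germ_alg GC).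
Local Notation pev := (@peval K T (gX GC) (gY GC)).
Local Notation W := (@eulerD K T (@gdx _ _ GC) (@gdy _ _ GC) (gX GC) (gY GC) w1 w2).
Let vT : T := to_germ_alg GC gv.
Let vT' : T := to_germ_alg GC gv'.
Local Notation gen := (@generator K c GC w1 w2 f vT).

Let vvT : vT * vT' = 1.
Proof. by apply: germ_val_inj; exact: vv'. Qed.

Let FvT : F = germ_val (pev f * vT).
Proof. by rewrite FE (poly_germE GC). Qed.

Lemma poisson_field_generator i :
  poisson_field i = gen (if i is None then 1 else 0) (pev (if i is Some j then e j else 0)).
Proof.
case: i => [j|].
  rewrite /generator scale0r !mul0r oppr0 !add0r /poisson_field (poly_germE GC).
  congr (_, _); rewrite germ_valM germ_valM mulrA; congr (_ * _).
    by rewrite mulr_natl -scaler_nat germ_valZ -germ_ofZ.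
  by rewrite mulr_natl -scaler_nat germ_valZ -germ_ofZ.
rewrite /generator raddf0 !mul0r !addr0 scale1r !mul1r /poisson_field /hamiltonian (poly_germE GC).
by congr (_, _); rewrite germ_valM ?germ_valN.
Qed.

Lemma quasi_homogeneous_sum (k : 'I_r -> K) :
  quasi_homogeneous w1 w2 s (\sum_j k j *: e j).
Proof.
have [eh _] := e_basis; rewrite /quasi_homogeneous /=.
have lin a p q : euler_poly w1 w2 (a *: p + q) = a *: euler_poly w1 w2 p + euler_poly w1 w2 q.
  rewrite /euler_poly !linearP /= !mulrDr -!scalerAr !scalerDr !scalerA.
  by rewrite ![a * _]mulrC addrACA.
have e0 : euler_poly w1 w2 (0 : mpoly 2 K) = 0 by rewrite /euler_poly !linear0 !mulr0 !scaler0 addr0.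
rewrite scaler_sumr; elim/big_rec2: _ => [//|j p q _ IH].
by rewrite lin IH eh scalerA mulrC -scalerA scalerA mulrC -scalerA.
Qed.

Lemma poisson_field_sum (k : option 'I_r -> K) :
  \sum_i k i *: poisson_field i = gen (k None) (pev (\sum_j k (Some j) *: e j)).
Proof.
have gen0 : gen 0 0 = 0.
  by rewrite /generator scale0r !mul0r oppr0 !addr0 mulr0.
have genD I (q : seq I) (l : I -> K) (u : I -> T) (a : I -> K) :
    \sum_(i <- q) a i *: gen (l i) (u i) = gen (\sum_(i <- q) a i * l i) (\sum_(i <- q) a i *: u i).
  elim: q => [|i q IH]; first by rewrite !big_nil gen0.
  by rewrite !big_cons IH generator_linear.
transitivity (gen (\sum_i k i * (if i is None then 1 else 0))
    (\sum_i k i *: pev (if i is Some j then e j else 0))).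
  by rewrite -genD; apply: eq_bigr => i _; rewrite poisson_field_generator.
have -> : \sum_i k i * (if i is None then 1 else 0) = k None.
  rewrite (@big_option K 'I_r (fun i => k i * (if i is None then 1 else 0))) mulr1.
  by rewrite big1 ?addr0// => j _; rewrite mulr0.
congr (gen _ _).
rewrite (@big_option T 'I_r (fun i => k i *: pev (if i is Some j then e j else 0))).
rewrite raddf0 scaler0 add0r [RHS]raddf_sum; apply: eq_bigr => j _.
exact: esym (pevalZ _ _).
Qed.

Lemma poisson_basis : exists XZ : forall i, poisson_field i \in cocycle c F,
  is_basis_of [set: H1 c F] (fun i => H1_class (MkZ1 (XZ i))).
Proof.
have [eh eP] := e_basis.
have qh0 : quasi_homogeneous w1 w2 s (0 : mpoly 2 K).
  by have := quasi_homogeneous_sum (fun=> 0); rewrite big1// => i _; rewrite scale0r.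
have XZ i : poisson_field i \in cocycle c F.
  rewrite poisson_field_generator FvT.
  apply: (generator_mem_cocycle f_homog vvT).
  apply/(quasi_homogeneousP GC); case: i => [j|]; [exact: eh|exact: qh0].
exists XZ.
have spanF Z : Z \in cocycle c F -> exists l t,
    W t = s%:~R * t /\
    Z - gen l t \in coboundary c F.
  by rewrite FvT; exact: (generator_span w1_gt0 w2_gt0 f_homog f_codim vvT).
have freeF l t : W t = s%:~R * t ->
    gen l t \in coboundary c F -> l = 0 /\ t = 0.
  by rewrite FvT; exact: (generator_free w1_gt0 w2_gt0 f_homog f_codim vvT).
(* Spanning and independence in the quotient both become statements on a single field [gen l t],
   since combinations of the generators are again of this form. *)
have classE (Z : Z1 c F) (k : option 'I_r -> K) : H1_class Z = \sum_i k i *: H1_class (MkZ1 (XZ i)) <->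
    val Z - gen (k None) (pev (\sum_j k (Some j) *: e j)) \in coboundary c F.
  pose S := \sum_i k i *: MkZ1 (XZ i).
  have SE : H1_class S = \sum_i k i *: H1_class (MkZ1 (XZ i)).
    rewrite /S; elim: (index_enum _) => [|i q IH].
      by rewrite !big_nil; apply/eqP; rewrite H1_class_eq0 raddf0 rpred0.
    by rewrite !big_cons H1_class_linear IH.
  have valS : val S = gen (k None) (pev (\sum_j k (Some j) *: e j)).
    rewrite -poisson_field_sum /S; elim: (index_enum _) => [|i q IH].
      by rewrite !big_nil raddf0.
    by rewrite !big_cons -IH; exact: linearP.
  rewrite -SE -valS; have -> : val Z - val S = val (-1 *: S + Z).
    by rewrite raddfD scaleN1r raddfN addrC.
  rewrite -H1_class_eq0 H1_class_linear scaleN1r addrC subr_eq0.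
  by split=> [->|/eqP].
apply: basis_of_free => [u|k].
  have : val (repr u) \in cocycle c F := Z1P (repr u).
  move=> /spanF[l [t [tE Zlt]]].
  (* The coefficient [t] is a priori only a germ; being quasi-homogeneous it is a polynomial, so it
     has coordinates in the basis [e]. *)
  have [p tp] := eulerD_poly (germ_alg_plane GC) w1_gt0 w2_gt0 tE.
  rewrite tp in tE; have [b [pb _]] := eP _ ((quasi_homogeneousP GC _ _ _ _).2 tE).
  exists [ffun i => if i is Some j then b j else l].
  rewrite -[u in LHS]reprK -/(H1_class _); apply/classE.
  rewrite ffunE (_ : \sum_j _ = p); last first.
    by rewrite pb; apply: eq_bigr => j _; rewrite ffunE.
  by rewrite -tp.
have class0 : H1_class (0 : Z1 c F) = 0 by apply/eqP; rewrite H1_class_eq0 raddf0 rpred0.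
move=> kE; have := (classE 0 k).1 (etrans class0 (esym kE)).
rewrite raddf0 sub0r rpredN.
set p := \sum_j _ => kp.
have ph : quasi_homogeneous w1 w2 s p by exact: quasi_homogeneous_sum.
have [k0 /(peval_inj (germ_alg_plane GC)) p0] :=
  freeF _ _ ((quasi_homogeneousP GC _ _ _ _).1 ph) kp.
(* Both the zero family and the coefficients [k (Some j)] are coordinates of the zero polynomial, so
   uniqueness identifies them. *)
have [b [_ uni]] := eP _ qh0.
have b0 : b = [ffun=> 0].
  by apply: uni; rewrite big1// => j _; rewrite ffunE scale0r.
have bk : b = [ffun j => k (Some j)].
  by apply: uni; apply: etrans (esym p0) _; apply: eq_bigr => j _; rewrite ffunE.
apply/ffunP => -[j|]; last by rewrite k0 ffunE.
by have := congr1 (fun g : {ffun 'I_r -> K} => g j) (etrans (esym bk) b0); rewrite !ffunE.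
Qed.

End PoissonBasis.

Theorem theorem4p6 (R : realType) (c : category) (w1 w2 : nat) (d : int)
    (f h : mpoly 2 (base_field R c)) (r : nat)
    (e : 'I_r -> mpoly 2 (base_field R c)) :
  (0 < w1)%N -> (0 < w2)%N ->
  quasi_homogeneous w1 w2 d f ->
  finite_codim c (poly_germ f) ->
  (0 < d - w1%:Z - w2%:Z -> quasi_homogeneous w1 w2 (d - w1%:Z - w2%:Z) h) ->
  (~~ (0 < d - w1%:Z - w2%:Z) -> h = 0) ->
  is_basis_of (quasi_homogeneous w1 w2 (d - w1%:Z - w2%:Z)) e ->
  let F0 := poly_germ f in
  let F := poly_germ f * (1 + poly_germ h) in
  let X := fun i : option 'I_r =>
    if i is Some j then
      gscale ((1 + poly_germ h) * poly_germ (e j)) (euler_field w1 w2)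
    else gscale (1 + poly_germ h) (hamiltonian (poly_germ f)) in
  (exists XZ : forall i, X i \in cocycle c F,
     is_basis_of [set: H1 c F] (fun i => H1_class (MkZ1 (XZ i)))) /\
  (exists phi : {linear H1 c F -> H1 c F0}, bijective phi).
Proof.
move=> w1_gt0 w2_gt0 f_homog f_codim h_homog h0 e_basis F0 F X.
have GC := base_calculus R c; have PA := germ_alg_plane GC.
have gv : germs c (1 + poly_germ h).
  rewrite (poly_germE GC); exact: (germ_alg_germs (1 + peval h : germ_alg GC)).
have [v' gv' vv'] : exists2 v', germs c v' & (1 + poly_germ h) * v' = 1.
  (* [h] is zero or of positive degree, so it has no constant term, and [1 + h] is one of the units
     of [pa_unit]. *)
  have [a [b hE]] : exists a b : germ_alg GC,
      @peval _ (germ_alg GC) (gX GC) (gY GC) h = gX GC * a + gY GC * b.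
    have [s0|s0] := boolP (0 < d - w1%:Z - w2%:Z); last first.
      by exists 0, 0; rewrite h0// raddf0 !mulr0 addr0.
    apply: (eulerD_max_ideal PA (lt0r_neq0 s0)).
    exact/quasi_homogeneousP/h_homog.
  have [u uE] := pa_unit PA a b; rewrite -addrA -hE in uE.
  exists (germ_val u); first exact: germ_alg_germs.
  by rewrite (poly_germE GC); exact: (congr1 (@germ_val _ _ GC) uE).
have basis := poisson_basis GC w1_gt0 w2_gt0 f_homog f_codim e_basis gv gv' vv' (erefl F).
split; first exact: basis.
have [XZ XZ_basis] := basis.
have g1 : germs c (1 : @germ (base_field R c)) by exact: gc_one.
(* The unperturbed structure is the case [v = v' = 1]. Both bases are indexed by [option 'I_r],
   which gives the isomorphism. *)
have [XZ0 XZ0_basis] := poisson_basis GC w1_gt0 w2_gt0 f_homog f_codim e_basis g1 g1 (mulr1 1)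
  (esym (mulr1 F0)).
exact: basis_isomorphism XZ_basis XZ0_basis.
Qed.
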